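(* Let $1\le p<\infty$ and $\mathcal{H}=\ell^2(\mathbb{N},\mathbb{C})$. Let $\lambda\in\mathbb{Z}^{(\mathbb{N})}$ be a finitely supported integer-valued sequence and let $(\pi_\lambda,\mathcal{H}_\lambda)$ be the corresponding unitary highest weight representation of $U_p(\mathcal{H})$. Then $$H^1(U_p(\mathcal{H}),\pi_\lambda,\mathcal{H}_\lambda)=\{0\}\iff |\lambda|\le 1,$$ where $|\lambda|=\sum_{i=1}^\infty|\lambda_i|$.
   Context: Cohomology. For a continuous unitary representation $(\pi,\mathcal{K})$ of a topological group $G$ (strong operator topology on $U(\mathcal{K})$), a 1-cocycle is a map $\beta:G\to\mathcal{K}$ with $\beta(gh)=\beta(g)+\pi(g)\beta(h)$ for all $g,h\in G$; it is a 1-coboundary if $\beta(g)=\pi(g)v-v$ for all $g\in G$, for some $v\in\mathcal{K}$. $H^1(G,\pi,\mathcal{K})$ is the space of continuous 1-cocycles modulo the 1-coboundaries. The group. $\mathcal{B}_p(\mathcal{H})$ is the $p$-th Schatten ideal, and $U_p(\mathcal{H})=U(\mathcal{H})\cap(\mathbf{1}+\mathcal{B}_p(\mathcal{H}))$ carries the topology induced by the metric $(g,h)\mapsto\|g-h\|_p$ (Schatten norm). Representations for non-negative weights. Let $(\mathbb{N}_0)^{(\mathbb{N})}_\downarrow$ be the set of decreasing sequences $\lambda=(\lambda_1\ge\lambda_2\ge\dots)$ of non-negative integers with finitely many nonzero entries, and $|\lambda|=\sum_i\lambda_i$. The Young diagram $D_\lambda$ has $\lambda_j$ boxes in row $j$.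 The Young tableau $T_\lambda$ is obtained by filling the boxes with $1,\dots,|\lambda|$ column by column, from left to right, top to bottom in each column. In the permutation group $S_\lambda$ of $\{1,\dots,|\lambda|\}$, $R_\lambda$ (resp. $C_\lambda$) is the subgroup preserving each of the subsets given by the rows (resp. columns) of $T_\lambda$. $S_\lambda$ acts unitarily on the Hilbert tensor product $\mathcal{H}^{\widehat\otimes|\lambda|}$ by $\rho(\sigma)(v_1\otimes\dots\otimes v_{|\lambda|})=v_{\sigma^{-1}(1)}\otimes\dots\otimes v_{\sigma^{-1}(|\lambda|)}$. Put $P_\lambda=\sum_{r\in R_\lambda,\,c\in C_\lambda}\mathrm{sgn}(c)\rho(cr)$ and $\mathcal{H}_\lambda=P_\lambda(\mathcal{H}^{\widehat\otimes|\lambda|})$. This is invariant under the action $g\mapsto g^{\otimes|\lambda|}$ of $U_p(\mathcal{H})$; the resulting representation is $(\pi_\lambda,\mathcal{H}_\lambda)$. (For $\lambda=0$ it is the trivial representation on $\mathbb{C}$.) General finitely supported weights. For $\lambda\in\mathbb{Z}^{(\mathbb{N})}$ (integer sequences with finitely many nonzero entries), let $\lambda^{\pm}\in(\mathbb{N}_0)^{(\mathbb{N})}_\downarrow$ be the decreasing rearrangement of $\max(\pm\lambda,0)$. The unitary highest weight representation of $U_p(\mathcal{H})$ with highest weight $\lambda$ is $(\pi_\lambda,\mathcal{H}_\lambda):=(\pi_{\lambda^-}^*,\mathcal{H}_{\lambda^-}^* )\widehat\otimes(\pi_{\lambda^+},\mathcal{H}_{\lambda^+})$, where $\pi^*(g)f=f\circ\pi(g^{-1})$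 is the dual representation on the topological dual. *)

(* Defs.v *)
From HB Require Import structures.
From mathcomp Require Import all_boot all_order all_algebra all_fingroup.
From mathcomp Require Import finmap.
From mathcomp Require Import complex.
From mathcomp Require Import sesquilinear.
From mathcomp Require Import boolp classical_sets functions cardinality fsbigop.
From mathcomp Require Import reals ereal topology normedtype sequences esum exp.
From mathcomp Require Import lra ring.

Set Implicit Arguments.
Unset Strict Implicit.
Unset Printing Implicit Defensive.

Import Order.TTheory GRing.Theory Num.Theory Normc.
Local Open Scope classical_set_scope.
Local Open Scope ring_scope.
Local Open Scope complex_scope.

Local Notation Re := (@complex.Re _).
Local Notation Im := (@complex.Im _).

(* [rsum] and [csum] are the unordered sums; they are meaningful for absolutely
   summable families. *)
Section Sums.
Variables (R : realType) (I : choiceType).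

Definition rsum (f : I -> R) : R :=
  fine (\esum_(i in [set: I]) (Num.max (f i) 0)%:E) -
  fine (\esum_(i in [set: I]) (Num.max (- f i) 0)%:E).

Definition csum (f : I -> R[i]) : R[i] :=
  rsum (fun i => Re (f i)) +i* rsum (fun i => Im (f i)).

Definition rsummable (f : I -> R) : Prop :=
  (\esum_(i in [set: I]) (`|f i|)%:E < +oo)%E.

Definition csummable (f : I -> R[i]) : Prop :=
  rsummable (fun i => Re (f i)) /\ rsummable (fun i => Im (f i)).

Lemma rsummable_le (f g : I -> R) :
  (forall i, `|f i| <= `|g i|) -> rsummable g -> rsummable f.
Proof.
by move=> fg; apply: le_lt_trans; apply: le_esum => i _; rewrite lee_fin.
Qed.

Lemma rsummableD (f g : I -> R) :
  rsummable f -> rsummable g -> rsummable (fun i => f i + g i).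
Proof.
move=> sf sg; apply: le_lt_trans (lte_add_pinfty sf sg).
rewrite -esumD; [|by move=> *; rewrite lee_fin..].
by apply: le_esum => i _; rewrite -EFinD lee_fin ler_normD.
Qed.

Lemma esumZ_le (c : R) (f : I -> R) : 0 <= c -> (forall i, 0 <= f i) ->
  (\esum_(i in [set: I]) (c * f i)%:E <= c%:E * \esum_(i in [set: I]) (f i)%:E)%E.
Proof.
move=> c0 f0; apply: ge_ereal_sup => _ [A [finA _] <-].
under eq_fsbigr do rewrite EFinM.
rewrite -ge0_mule_fsumr; last by move=> i; rewrite lee_fin.
apply: lee_wpmul2l; first by rewrite lee_fin.
by apply: ereal_sup_ubound; exists A.
Qed.

Lemma rsummableZ (c : R) (f : I -> R) :
  rsummable f -> rsummable (fun i => c * f i).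
Proof.
move=> sf; rewrite /rsummable; under eq_esum do rewrite normrM.
apply: (le_lt_trans (esumZ_le _ _)) => //.
have : (\esum_(i in [set: I]) (`|f i|)%:E \is a fin_num)%E.
  rewrite ge0_fin_numE//; by apply: esum_ge0 => i _; rewrite lee_fin.
by move=> /fineK <-; rewrite -EFinM ltry.
Qed.

Lemma ge0_rsum (f : I -> R) : (forall i, 0 <= f i) ->
  rsum f = fine (\esum_(i in [set: I]) (f i)%:E).
Proof.
move=> f0; rewrite /rsum [X in _ - fine X]esum1 ?subr0.
  by congr fine; apply: eq_esum => i _; rewrite max_l.
by move=> i _; rewrite max_r// oppr_le0.
Qed.

Lemma rsum_fin (f : I -> R) : rsummable f -> (forall i, 0 <= f i) ->
  (\esum_(i in [set: I]) (f i)%:E \is a fin_num)%E.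
Proof.
move=> sf f0; rewrite ge0_fin_numE; last first.
  by apply: esum_ge0 => i _; rewrite lee_fin.
by move: sf; rewrite /rsummable; under eq_esum do rewrite ger0_norm//.
Qed.

Lemma rsumB (f g h : I -> R) : rsummable g -> rsummable h ->
  (forall i, 0 <= g i) -> (forall i, 0 <= h i) ->
  (forall i, f i = g i - h i) ->
  rsum f = rsum g - rsum h.
Proof.
move=> sg sh g0 h0 fE; rewrite (ge0_rsum g0) (ge0_rsum h0) /rsum.
set P := fun i => Num.max (f i) 0; set N := fun i => Num.max (- f i) 0.
have P0 i : 0 <= P i by rewrite /P le_max lexx orbT.
have N0 i : 0 <= N i by rewrite /N le_max lexx orbT.
have sf : rsummable f.
  have := rsummableD sg (rsummableZ (-1) sh).
  by congr rsummable; apply/funext => i; rewrite fE mulN1r.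
have sP : rsummable P.
  apply: rsummable_le sf => i; rewrite (ger0_norm (P0 i)) /P ge_max normr_ge0.
  by rewrite ler_norm.
have sN : rsummable N.
  apply: rsummable_le sf => i; rewrite (ger0_norm (N0 i)) /N ge_max normr_ge0.
  by rewrite -normrN ler_norm.
have E : (\esum_(i in [set: I]) (P i)%:E + \esum_(i in [set: I]) (h i)%:E =
          \esum_(i in [set: I]) (N i)%:E + \esum_(i in [set: I]) (g i)%:E)%E.
  rewrite -!esumD; [|by move=> *; rewrite lee_fin..].
  apply: eq_esum => i _; rewrite -!EFinD; congr EFin.
  by rewrite /P /N fE; case: (leP (g i) (h i)) => gh;
    [rewrite max_r ?max_l| rewrite max_l ?max_r]; lra.
have := congr1 fine E.
rewrite !fineD ?rsum_fin// -/P -/N => {}E.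
by rewrite -[LHS]/(fine (esum _ (fun i => (P i)%:E)) -
  fine (esum _ (fun i => (N i)%:E))); lra.
Qed.

Lemma rsum_posneg (f : I -> R) : rsum f =
  rsum (fun i => Num.max (f i) 0) - rsum (fun i => Num.max (- f i) 0).
Proof.
by rewrite {1}/rsum !ge0_rsum// => i; rewrite le_max lexx orbT.
Qed.

Lemma rsummable_pos (f : I -> R) :
  rsummable f -> rsummable (fun i => Num.max (f i) 0).
Proof.
apply: rsummable_le => i; rewrite ger0_norm ?le_max ?lexx ?orbT//.
by rewrite ge_max normr_ge0 ler_norm.
Qed.

Lemma rsummable_neg (f : I -> R) :
  rsummable f -> rsummable (fun i => Num.max (- f i) 0).
Proof.
apply: rsummable_le => i; rewrite ger0_norm ?le_max ?lexx ?orbT//.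
by rewrite ge_max normr_ge0 -normrN ler_norm.
Qed.

Lemma ge0_rsumD (f g : I -> R) : rsummable f -> rsummable g ->
  (forall i, 0 <= f i) -> (forall i, 0 <= g i) ->
  rsum (fun i => f i + g i) = rsum f + rsum g.
Proof.
move=> sf sg f0 g0; rewrite !ge0_rsum//; last by move=> i; rewrite addr_ge0.
rewrite -fineD ?rsum_fin//; congr fine.
by rewrite -esumD// => *; rewrite lee_fin.
Qed.

Lemma rsumD (f g : I -> R) : rsummable f -> rsummable g ->
  rsum (fun i => f i + g i) = rsum f + rsum g.
Proof.
move=> sf sg.
have M x : 0 <= Num.max x (0 : R) by rewrite le_max lexx orbT.
have [fp fn] := (rsummable_pos sf, rsummable_neg sf).
have [gp gn] := (rsummable_pos sg, rsummable_neg sg).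
rewrite (@rsumB _ (fun i => Num.max (f i) 0 + Num.max (g i) 0)
   (fun i => Num.max (- f i) 0 + Num.max (- g i) 0)).
- rewrite !ge0_rsumD// [in RHS](rsum_posneg f) [in RHS](rsum_posneg g).
  by lra.
- exact: rsummableD.
- exact: rsummableD.
- by move=> i; rewrite addr_ge0.
- by move=> i; rewrite addr_ge0.
- move=> i; have D x : x = Num.max x 0 - Num.max (- x) (0 : R).
    by case: (leP 0 x) => x0; [rewrite max_r|rewrite max_l]; lra.
  by rewrite [in LHS](D (f i)) [in LHS](D (g i)); lra.
Qed.

Lemma rsumN (f : I -> R) : rsum (fun i => - f i) = - rsum f.
Proof.
by rewrite /rsum opprB; under [in X in _ - fine X]eq_esum do rewrite opprK.
Qed.

Lemma ge0_rsumZ (c : R) (f : I -> R) : 0 <= c -> rsummable f ->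
  (forall i, 0 <= f i) -> rsum (fun i => c * f i) = c * rsum f.
Proof.
move=> c0 sf f0; rewrite !ge0_rsum//; last by move=> i; rewrite mulr_ge0.
have [->|cn0] := eqVneq c 0.
  by rewrite mul0r esum1// => i _; rewrite mul0r.
have c_gt0 : 0 < c by rewrite lt_def cn0.
suff -> : (\esum_(i in [set: I]) (c * f i)%:E =
           c%:E * \esum_(i in [set: I]) (f i)%:E)%E.
  by rewrite -(fineK (rsum_fin sf f0)).
apply/eqP; rewrite eq_le esumZ_le//=.
have := @esumZ_le c^-1 (fun i => c * f i).
rewrite invr_ge0 => /(_ c0 (fun i => mulr_ge0 c0 (f0 i))).
under eq_esum do rewrite mulKf//.
move=> H; apply: (le_trans (lee_wpmul2l _ H)); rewrite ?lee_fin//.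
by rewrite muleA -EFinM divff// mul1e.
Qed.

Lemma rsumZ (c : R) (f : I -> R) : rsummable f ->
  rsum (fun i => c * f i) = c * rsum f.
Proof.
move=> sf; wlog c0 : c / 0 <= c.
  move=> H; have [|c0] := leP 0 c; first exact: H.
  rewrite -[c in RHS]opprK mulNr -H; last by rewrite oppr_ge0 ltW.
  by rewrite -rsumN; congr rsum; apply/funext => i; rewrite mulNr opprK.
have M x : 0 <= Num.max x (0 : R) by rewrite le_max lexx orbT.
have sp := rsummable_pos sf; have sn := rsummable_neg sf.
rewrite (@rsumB _ (fun i => c * Num.max (f i) 0) (fun i => c * Num.max (- f i) 0)).
- by rewrite !ge0_rsumZ// (rsum_posneg f) [RHS]mulrBr.
- exact: rsummableZ.
- exact: rsummableZ.
- by move=> i; rewrite mulr_ge0.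
- by move=> i; rewrite mulr_ge0.
- move=> i; rewrite -mulrBr; congr *%R.
  by case: (leP 0 (f i)) => x0; [rewrite max_r|rewrite max_l]; lra.
Qed.

Lemma csumD (f g : I -> R[i]) : csummable f -> csummable g ->
  csum (fun i => f i + g i) = csum f + csum g.
Proof.
move=> [f1 f2] [g1 g2]; rewrite /csum.
have -> : (fun i => Re (f i + g i)) = (fun i => Re (f i) + Re (g i)).
  by apply/funext => i; case: (f i); case: (g i).
have -> : (fun i => Im (f i + g i)) = (fun i => Im (f i) + Im (g i)).
  by apply/funext => i; case: (f i); case: (g i).
by rewrite !rsumD.
Qed.

Lemma csumZ (a : R[i]) (f : I -> R[i]) : csummable f ->
  csum (fun i => a * f i) = a * csum f.
Proof.
case: a => a b [f1 f2]; rewrite /csum.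
have -> : (fun i => Re ((a +i* b) * f i)) =
          (fun i => a * Re (f i) + (- b) * Im (f i)).
  by apply/funext => i; case: (f i) => x y /=; rewrite mulNr.
have -> : (fun i => Im ((a +i* b) * f i)) =
          (fun i => a * Im (f i) + b * Re (f i)).
  by apply/funext => i; case: (f i) => x y /=.
rewrite !rsumD; [|exact: rsummableZ..].
by rewrite !rsumZ//; simpc.
Qed.

Lemma csum_conj (f : I -> R[i]) : csum (fun i => conjc (f i)) = conjc (csum f).
Proof.
rewrite /csum /= -rsumN; congr (rsum _ +i* rsum _).
  by apply/funext => i; case: (f i).
by apply/funext => i; case: (f i).
Qed.

End Sums.

Section SquareSummable.
Variables (R : realType) (I : choiceType).
Local Notation C := R[i].

Lemma normc_ge0 (z : C) : 0 <= normc z.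
Proof. by case: z => a b; exact: sqrtr_ge0. Qed.

Definition sqsum (x : I -> C) : \bar R :=
  (\esum_(i in [set: I]) (normc (x i) ^+ 2)%:E)%E.

Definition l2_pred : {pred I -> C^o} := fun x => (sqsum x < +oo)%E.

Lemma sqr_normc (z : C) : normc z ^+ 2 = Re z ^+ 2 + Im z ^+ 2.
Proof. by case: z => a b /=; rewrite sqr_sqrtr// addr_ge0 ?sqr_ge0. Qed.

Lemma l2_predE (x : I -> C^o) :
  (x \in l2_pred) <-> rsummable (fun i => normc (x i) ^+ 2).
Proof.
rewrite /rsummable; under eq_esum do rewrite ger0_norm ?sqr_ge0//.
by split.
Qed.

Lemma l2_submod_closed : submod_closed l2_pred.
Proof.
split.
  rewrite -topredE /= /l2_pred /sqsum esum1 ?ltry// => i _.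
  by rewrite normc0 expr0n.
move=> a x y /l2_predE sx /l2_predE sy; apply/l2_predE.
have := rsummableD (rsummableZ (2 * normc a ^+ 2) sx) (rsummableZ 2 sy).
apply: rsummable_le => i; 
rewrite !ger0_norm; [|by rewrite ?addr_ge0 ?mulr_ge0 ?exprn_ge0 ?normc_ge0..].
have -> : (a *: x + y) i = a * x i + y i by [].
rewrite -mulrA -exprMn -normcM; move: (a * x i) (y i) => u v.
rewrite !sqr_normc; case: u v => [u1 u2] [v1 v2] /=.
have := sqr_ge0 (u1 - v1); have := sqr_ge0 (u2 - v2); nra.
Qed.

HB.instance Definition _ :=
  GRing.isSubmodClosed.Build C (I -> C^o) l2_pred l2_submod_closed.

Record l2 := L2 { l2_fun :> I -> C^o; _ : l2_fun \in l2_pred }.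

HB.instance Definition _ := [isSub for l2_fun].
HB.instance Definition _ := [Choice of l2 by <:].
HB.instance Definition _ := [SubChoice_isSubLmodule of l2 by <:].

Definition l2_dot (x y : l2) : C := csum (fun i => x i * conjc (y i)).

Lemma l2_summableM (x y : l2) : csummable (fun i => x i * conjc (y i)).
Proof.
have /l2_predE sx := valP x; have /l2_predE sy := valP y.
have s := rsummableD sx sy; split; apply: rsummable_le s => i;
  rewrite /= [leRHS]ger0_norm ?addr_ge0 ?sqr_ge0// !sqr_normc;
  case: (x i) (y i) => [a b] [c d] /=; rewrite ler_norml; apply/andP; split;
  have := sqr_ge0 (a - c); have := sqr_ge0 (a + c);
  have := sqr_ge0 (b - d); have := sqr_ge0 (b + d);
  have := sqr_ge0 (a - d); have := sqr_ge0 (a + d);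
  have := sqr_ge0 (b - c); have := sqr_ge0 (b + c); nra.
Qed.

Lemma l2_dotPl (a : C) (x y z : l2) :
  l2_dot (a *: x + y) z = a * l2_dot x z + l2_dot y z.
Proof.
rewrite /l2_dot -csumZ; last exact: l2_summableM.
rewrite -csumD; [|case: (l2_summableM (a *: x) z)|exact: l2_summableM].
- by congr csum; apply/funext => i; rewrite mulrA -mulrDl.
- by move=> h1 h2; split; [apply: rsummable_le h1|apply: rsummable_le h2] => i;
    rewrite mulrA.
Qed.

Lemma l2_dotC (x y : l2) : l2_dot x y = conjc (l2_dot y x).
Proof.
rewrite /l2_dot -csum_conj; congr csum; apply/funext => i.
by case: (x i) (y i) => [a b] [c d]; simpc; congr (_ +i* _); ring.
Qed.

Lemma l2_dotxx (x : l2) : l2_dot x x = (fine (sqsum x))%:C.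
Proof.
have E i : x i * conjc (x i) = (normc (x i) ^+ 2)%:C.
  by rewrite sqr_normc; case: (x i) => a b; simpc; congr (_ +i* _) => /=; ring.
rewrite /l2_dot /csum; congr (_ +i* _).
  rewrite -ge0_rsum; last by move=> i; exact: sqr_ge0.
  by congr rsum; apply/funext => i; rewrite E.
rewrite ge0_rsum; last by move=> i; rewrite E.
by rewrite esum1// => i _; rewrite E.
Qed.

Lemma l2_bilinear : bilinear_for
  (GRing.Scale.Law.clone _ _ ( *%R ) _)
  (GRing.Scale.Law.clone _ _ (Num.conj \; *%R ) _) l2_dot.
Proof.
split=> [z a x y|x a y z] /=; first exact: l2_dotPl.
by rewrite !(l2_dotC x) l2_dotPl rmorphD rmorphM.
Qed.

HB.instance Definition _ :=
  bilinear_isBilinear.Build C l2 l2 C _ _ l2_dot l2_bilinear.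

Lemma l2_hermitian (x y : l2) :
  l2_dot x y = (-1) ^+ false * Num.conj (l2_dot y x).
Proof. by rewrite expr0 mul1r l2_dotC. Qed.

HB.instance Definition _ :=
  isHermitianSesquilinear.Build C l2 false Num.conj l2_dot l2_hermitian.

Lemma l2_dot_gt0 (x : l2) : x != 0 -> 0 < l2_dot x x.
Proof.
move=> x0; rewrite l2_dotxx ltcR lt_def fine_ge0 ?andbT; last first.
  by apply: esum_ge0 => i _; rewrite lee_fin sqr_ge0.
apply: contra x0 => /eqP s0; apply/eqP/val_inj/funext => i.
have h j : (0 <= (normc (x j) ^+ 2)%:E)%E by rewrite lee_fin sqr_ge0.
have : ((normc (x i) ^+ 2)%:E <= sqsum x)%E.
  by apply: esum_ge; exists [set i]; rewrite ?fsbig_set1//; split.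
have -> : sqsum x = 0.
  have sf : (sqsum x \is a fin_num)%E.
    rewrite ge0_fin_numE; first exact: (valP x).
    by apply: esum_ge0.
  by rewrite -(fineK sf) s0.
rewrite lee_fin => n0; apply: eq0_normc; apply/eqP.
by rewrite -sqrf_eq0 eq_le n0 sqr_ge0.
Qed.

HB.instance Definition _ := isDotProduct.Build C l2 l2_dot l2_dot_gt0.

End SquareSummable.

Section HilbertSpaces.
Variables (R : realType) (V : lmodType R[i]) (dot : {dot V for Num.conj}).

Definition hnorm (v : V) : R := Num.sqrt (Re (dot v v)).

Definition hcvg (u : nat -> V) (l : V) : Prop :=
  forall eps : R, 0 < eps ->
    exists N, forall n, (N <= n)%N -> hnorm (u n - l) < eps.

Definition hcauchy (u : nat -> V) : Prop :=
  forall eps : R, 0 < eps ->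
    exists N, forall m n, (N <= m)%N -> (N <= n)%N -> hnorm (u m - u n) < eps.

Definition hcomplete : Prop :=
  forall u, hcauchy u -> exists l, hcvg u l.

Definition orthonormal_seq (e : nat -> V) : Prop :=
  forall m n, dot (e m) (e n) = (m == n)%:R.

Definition unitary (g : V -> V) : Prop :=
  [/\ linear g, forall u v, dot (g u) (g v) = dot u v
    & forall w, exists v, g v = w].

(* [s] lists the singular values of [T] in some order, possibly with extra
   zeros: T = sum_n s_n <., e_n> f_n in the strong sense. *)
Definition singular_values (T : V -> V) (s : nat -> R) : Prop :=
  (forall n, 0 <= s n) /\
  exists e f : nat -> V, [/\ orthonormal_seq e, orthonormal_seq f &
    forall v, hcvg (fun N => \sum_(n < N) ((s n)%:C * dot v (e n)) *: f n) (T v)].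

(* ||T||_p = (sum_n s_n^p)^(1/p). The value does not depend on the choice of
   [s], and the infimum is +oo when [T] has no singular value expansion. *)
Definition schatten_norm (p : R) (T : V -> V) : \bar R :=
  ereal_inf [set ((\sum_(n <oo) ((s n) `^ p)%:E) `^ p^-1)%E
            | s in singular_values T].

Definition schatten (p : R) : set (V -> V) :=
  [set T | (schatten_norm p T < +oo)%E].

Definition Up (p : R) : set (V -> V) :=
  [set g | unitary g /\ schatten p (fun v => g v - v)].

Definition Up_dist (p : R) (g h : V -> V) : \bar R :=
  schatten_norm p (fun v => g v - h v).

Definition op_inv (g : V -> V) : V -> V :=
  fun w => xget 0 [set v | g v = w].

End HilbertSpaces.

Section Cohomology.
Variables (R : realType) (H : lmodType R[i]) (dotH : {dot H for Num.conj}).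
Variables (p : R) (K : lmodType R[i]) (dotK : {dot K for Num.conj}).
Variable pi : (H -> H) -> K -> K.
Local Notation G := (Up dotH p).

(* Functions on the group G are represented by functions on all of H -> H whose
   values outside G are irrelevant; these values are quotiented out in H1
   because they are unconstrained in B1. *)
Definition Z1 : set ((H -> H) -> K) :=
  [set b | (forall g h, G g -> G h -> b (g \o h) = b g + pi g (b h)) /\
    forall g, G g -> forall eps : R, 0 < eps -> exists2 delta : R, 0 < delta &
      forall h, G h -> (Up_dist dotH p g h < delta%:E)%E ->
        hnorm dotK (b g - b h) < eps].

Definition B1 : set ((H -> H) -> K) :=
  [set b | exists v, forall g, G g -> b g = pi g v - v].

Definition H1 : set (set ((H -> H) -> K)) :=
  [set [set b + c | c in B1] | b in Z1].

Definition H1_zero : Prop := H1 = [set B1].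

Lemma H1_zeroP : (forall g, G g -> linear (pi g)) ->
  H1_zero <-> Z1 `<=` B1.
Proof.
move=> lin.
have pi0 g : G g -> pi g 0 = 0.
  by move=> /lin l; have := l (-1) 0 0; rewrite scaler0 addr0 scaleN1r addNr.
have piD g : G g -> {morph pi g : x y / x + y}.
  by move=> /lin l x y; have := l 1 x y; rewrite !scale1r.
have piB g : G g -> {morph pi g : x y / x - y}.
  move=> Gg x y; apply/eqP; rewrite eq_sym subr_eq; apply/eqP.
  by rewrite -piD// subrK.
have B0 : B1 0 by exists 0 => g /pi0 ->; rewrite subrr.
have Z0 : Z1 0.
  split=> [g h Gg Gh|g _ eps eps0]; first by rewrite /= pi0// addr0.
  by exists 1 => // h _ _; rewrite subrr /hnorm linear0r sqrtr0.
have BB b : B1 b -> [set b + c | c in B1] = B1.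
  move=> [v bv]; apply/seteqP; split=> [_ [c [w cw] <-]|c [w cw]].
    exists (v + w) => g Gg; rewrite piD// opprD addrACA -bv// -cw//.
  exists (c - b); last by rewrite addrC subrK.
  exists (w - v) => g Gg; rewrite piB//.
  have -> : (c - b) g = c g - b g by [].
  by rewrite bv// cw// !opprD !opprK addrACA.
split=> [HE b Zb|ZB].
  have : H1 [set b + c | c in B1] by exists b.
  by rewrite HE => <-; exists 0 => //; rewrite addr0.
apply/seteqP; split=> [_ [b Zb <-]|_ ->]; first exact/BB/ZB.
by exists 0 => //; exact: BB.
Qed.

End Cohomology.

(* The n-th Hilbert tensor power of l^2(N) is l^2(N^n), where
   (v_0 (x) ... (x) v_(n-1))(i) = prod_k v_k(i_k). *)
Section TensorPowers.
Variables (R : realType) (n : nat).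
Local Notation C := R[i].
Local Notation idx := {ffun 'I_n -> nat}.
Implicit Types (F : l2 R idx) (i : idx) (k : 'I_n) (s : {perm 'I_n}).

Definition tens_fun (v : 'I_n -> l2 R nat) : idx -> C^o :=
  fun i => \prod_k v k (i k).

Lemma normc_prod (T : finType) (z : T -> C) :
  normc (\prod_t z t) = \prod_t normc (z t).
Proof. by elim/big_rec2: _ => [|t x y _ <-]; rewrite ?normc1 ?normcM. Qed.

Lemma tens_subproof (v : 'I_n -> l2 R nat) : tens_fun v \in @l2_pred R idx.
Proof.
pose a k j := normc (v k j) ^+ 2; pose S k := fine (sqsum (v k)).
have a0 k j : 0 <= a k j by exact: sqr_ge0.
suff : (sqsum (tens_fun v) <= (\prod_k S k)%:E)%E.
  by move=> h; apply: le_lt_trans h _; rewrite ltry.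
apply: ge_ereal_sup => _ [A [finA _] <-].
pose w i := \prod_k a k (i k).
have w0 i : 0 <= w i by apply: prodr_ge0.
under eq_fsbigr => i _.
  rewrite /tens_fun normc_prod -prodrXl; over.
have [N AN] : exists N, forall i k, A i -> (i k < N)%N.
  exists (\max_(i <- fset_set A) \max_k (i k).+1)%N => i k Ai.
  apply: (@leq_trans (\max_l (i l).+1)%N); first exact: (leq_bigmax k).
  by apply: (@leq_bigmax_seq _ _ xpredT (fun i : idx => \max_l (i l).+1)%N) => //; rewrite in_fset_set// inE.
pose emb (t : {ffun 'I_n -> 'I_N}) : idx := [ffun k => t k : nat].
have emb_inj : injective emb.
  by move=> t u /ffunP tu; apply/ffunP => k; apply/val_inj; have := tu k; rewrite !ffunE.
pose r := [seq emb t | t <- enum {ffun 'I_n -> 'I_N}].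
have ur : uniq r by rewrite map_inj_uniq ?enum_uniq.
have AB : A `<=` [set` r].
  move=> i Ai; apply/mapP; exists [ffun k => Ordinal (AN i k Ai)].
    by rewrite mem_enum.
  by apply/ffunP => k; rewrite !ffunE.
apply: (@le_trans _ _ (\sum_(i \in [set` r]) (w i)%:E)%E).
  apply: lee_fsum_nneg_subset => //.
  - exact: finite_seq.
  - by move=> i; rewrite !inE => Ai; exact: AB.
  - by move=> i _; rewrite lee_fin; exact: w0.
rewrite -fsbig_seq//= big_map big_enum/= sumEFin lee_fin.
have -> : \sum_t w (emb t) = \sum_(t : {ffun 'I_n -> 'I_N}) \prod_k a k (t k).
  by apply: eq_bigr => t _; apply: eq_bigr => k _; rewrite ffunE.
rewrite -(bigA_distr_bigA (fun k (j : 'I_N) => a k j)).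
apply: ler_prod => k _; rewrite sumr_ge0//= -lee_fin fineK; last first.
  rewrite ge0_fin_numE; first exact: (valP (v k)).
  by apply: esum_ge0 => j _; rewrite lee_fin sqr_ge0.
rewrite -sumEFin; apply: esum_ge; exists `I_N.
  by split=> //; exact: finite_II.
by rewrite (fsbig_ord _ _ (fun j => (a k j)%:E)).
Qed.

Definition tens (v : 'I_n -> l2 R nat) : l2 R idx := L2 (tens_subproof v).

Lemma perm_idx_bij s :
  set_bij [set: idx] [set: idx] (fun i => [ffun k => i (s k)]).
Proof.
split=> // [i j _ _ /ffunP ij|i _].
  by apply/ffunP => k; have := ij (s^-1 k)%g; rewrite !ffunE permKV.
exists [ffun k => i (s^-1 k)%g] => //.
by apply/ffunP => k; rewrite !ffunE permK.
Qed.

Lemma rho_subproof s F :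
  ((fun i => F [ffun k => i (s k)]) : idx -> C^o) \in @l2_pred R idx.
Proof.
have := valP F; rewrite -!topredE /= /l2_pred /sqsum.
by rewrite (reindex_esum _ _ _ _ (perm_idx_bij s)).
Qed.

(* rho(s)(v_0 (x) ... (x) v_(n-1)) = (x)_k v_(s^-1 k) *)
Definition rho s F : l2 R idx := L2 (rho_subproof s F).

Lemma rho_tens s (v : 'I_n -> l2 R nat) :
  rho s (tens v) = tens (fun k => v (s^-1 k)%g).
Proof.
apply/val_inj/funext => i; rewrite /= /tens_fun [RHS](reindex_inj (@perm_inj _ s)).
by apply: eq_bigr => k _; rewrite ffunE permK.
Qed.

Lemma rho_linear s : linear (rho s).
Proof. by move=> a F G; apply/val_inj. Qed.

Definition upd i k (j : nat) : idx := [ffun l => if l == k then j else i l].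

Lemma updk i k j : upd i k j k = j. Proof. by rewrite ffunE eqxx. Qed.

Lemma upd_id i k : upd i k (i k) = i.
Proof. by apply/ffunP => l; rewrite ffunE; case: eqP => [->|]. Qed.

Lemma upd_upd i k j j' : upd (upd i k j) k j' = upd i k j'.
Proof. by apply/ffunP => l; rewrite !ffunE; case: eqP. Qed.

Lemma upd_bij k : set_bij ([set i : idx | i k = 0%N] `*`` (fun=> [set: nat]))
  [set: idx] (fun ij => upd ij.1 k ij.2).
Proof.
split=> // [[i j] [i' j'] /set_mem[/= ik _] /set_mem[/= ik' _] E|i _].
  have jj : j = j' by have := congr1 (fun f : idx => f k) E; rewrite !updk.
  rewrite -jj in E *; congr pair.
  have := congr1 (fun f => upd f k 0%N) E; rewrite !upd_upd -{1}ik -{1}ik'.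
  by rewrite !upd_id.
exists (upd i k 0%N, i k); last by rewrite /= upd_upd upd_id.
by split=> //=; rewrite updk.
Qed.

Lemma esum_upd k (a : idx -> \bar R) : (forall i, 0 <= a i)%E ->
  (\esum_(i in [set: idx]) a i =
   \esum_(i in [set i : idx | i k = 0%N]) \esum_(j in [set: nat]) a (upd i k j))%E.
Proof.
by move=> a0; rewrite esum_esum// (reindex_esum _ _ _ _ (upd_bij k)).
Qed.

Lemma slice_subproof k i F :
  ((fun j => F (upd i k j)) : nat -> C^o) \in @l2_pred R nat.
Proof.
apply: le_lt_trans (valP F); rewrite /sqsum (esum_upd k); last first.
  by move=> ?; rewrite lee_fin sqr_ge0.
apply: esum_ge; exists [set upd i k 0%N].
  by split=> // _ ->; rewrite /= updk.
rewrite fsbig_set1; apply: le_esum => j _.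
by rewrite upd_upd.
Qed.

Definition slice k i F : l2 R nat := L2 (slice_subproof k i F).

(* The operator g acting on the k-th tensor factor; [insubd] only matters
   when [g] is not bounded, see [slotE]. *)
Definition slot_fun (g : l2 R nat -> l2 R nat) k F : idx -> C^o :=
  fun i => g (slice k i F) (i k).

Definition slot (g : l2 R nat -> l2 R nat) k F : l2 R idx :=
  insubd 0 (slot_fun g k F).

(* g (x) ... (x) g *)
Definition tpow (g : l2 R nat -> l2 R nat) F : l2 R idx :=
  foldr (slot g) F (enum 'I_n).

Lemma slice_upd k i j F : slice k (upd i k j) F = slice k i F.
Proof. by apply/val_inj/funext => j' /=; rewrite upd_upd. Qed.

Lemma sqsum_slot (g : l2 R nat -> l2 R nat) k F : unitary (@l2_dot R nat) g ->
  sqsum (slot_fun g k F) = sqsum F.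
Proof.
move=> [_ gi _]; have g_sq x : sqsum (g x) = sqsum x.
  have : l2_dot (g x) (g x) = l2_dot x x := gi x x; rewrite !l2_dotxx => -[] E.
  have fin (y : l2 R nat) : sqsum y \is a fin_num.
    rewrite ge0_fin_numE; first exact: (valP y).
    by apply: esum_ge0 => ? _; rewrite lee_fin sqr_ge0.
  by rewrite -(fineK (fin (g x))) E fineK.
rewrite /sqsum !(esum_upd k); [|by move=> ?; rewrite lee_fin sqr_ge0..].
apply: eq_esum => i _; transitivity (sqsum (g (slice k i F))).
  by apply: eq_esum => j _; rewrite /slot_fun slice_upd updk.
by rewrite g_sq.
Qed.

Lemma slotE (g : l2 R nat -> l2 R nat) k F i : unitary (@l2_dot R nat) g ->
  slot g k F i = g (slice k i F) (i k).
Proof.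
move=> gu; rewrite /slot.
have h : slot_fun g k F \in @l2_pred R idx.
  by rewrite -topredE /= /l2_pred sqsum_slot//; exact: (valP F).
by rewrite -[LHS]/(val (insubd 0 (slot_fun g k F)) i) insubdK.
Qed.

Lemma tens_slice (v : 'I_n -> l2 R nat) k i :
  slice k i (tens v) = (\prod_(l | l != k) v l (i l)) *: v k.
Proof.
apply/val_inj/funext => j; rewrite /= /tens_fun (bigD1 k)//= updk mulrC.
by congr *%R; apply: eq_bigr => l /negPf lk; rewrite ffunE lk.
Qed.

Lemma tpow_tens (g : l2 R nat -> l2 R nat) (v : 'I_n -> l2 R nat) :
  unitary (@l2_dot R nat) g -> tpow g (tens v) = tens (fun k => g (v k)).
Proof.
move=> gu; have glin : linear g by case: gu.
have gZ a x : g (a *: x) = a *: g x.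
  have := glin (-1) 0 0; rewrite scaler0 addr0 scaleN1r addNr => g0.
  by have := glin a x 0; rewrite g0 !addr0.
have slot_tens k (u : 'I_n -> l2 R nat) :
    slot g k (tens u) = tens (fun l => if l == k then g (u l) else u l).
  apply/val_inj/funext => i /=; rewrite slotE// tens_slice gZ.
  rewrite /tens_fun [RHS](bigD1 k)//= eqxx mulrC; congr *%R.
  by apply: eq_bigr => l /negPf ->.
have E r : uniq r -> foldr (slot g) (tens v) r =
    tens (fun l => if l \in r then g (v l) else v l).
  elim: r => [|k r ih]/= => [_|/andP[kr ur]]; first exact: congr1.
  rewrite ih// slot_tens; congr tens; apply/funext => l.
  by rewrite inE; case: eqP => [->|//]; rewrite (negPf kr).
rewrite /tpow E ?enum_uniq//; congr tens; apply/funext => k.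
by rewrite mem_enum.
Qed.

End TensorPowers.

(* Boxes (row, column) of the Young diagram with row lengths [s], listed column
   by column and from top to bottom: entry k is the box of the tableau T_s
   filled with k (entries start from 0). *)
Definition young_boxes (s : seq nat) : seq (nat * nat) :=
  [seq b <- [seq (r, c) | c <- iota 0 (head 0%N s), r <- iota 0 (size s)]
  | (b.2 < nth 0 s b.1)%N].

Definition box (s : seq nat) (k : 'I_(sumn s)) : nat * nat :=
  nth (0, 0)%N (young_boxes s) k.

Lemma size_young_boxes (s : seq nat) :
  sorted geq s -> size (young_boxes s) = sumn s.
Proof.
move=> ss; rewrite /young_boxes size_filter -sum1_count big_mkcond big_allpairs_dep/=.
rewrite exchange_big/= sumnE [RHS](big_nth 0%N) /index_iota subn0.
apply: eq_big_seq => r; rewrite mem_iota add0n => /= rs.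
have sh : (nth 0 s r <= head 0 s)%N.
  case: s ss r rs => //= x s' ss [|r] //= rs.
  have /(order_path_min (fun a b c h1 h2 => leq_trans h2 h1))/allP := ss.
  by apply; rewrite mem_nth.
rewrite -big_mkcond sum1_count -(subnKC sh) iotaD count_cat.
rewrite [X in (X + _)%N](_ : _ = nth 0 s r)%N.
  rewrite (eq_in_count (a2 := pred0)) ?count_pred0 ?addn0// => c.
  by rewrite mem_iota => /andP[h _]; rewrite ltnNge h.
rewrite -[RHS](size_iota 0); apply/eqP; rewrite -all_count; apply/allP => c.
by rewrite mem_iota.
Qed.

Section YoungModules.
Variables (R : realType) (s : seq nat).
Local Notation C := R[i].
Local Notation n := (sumn s).
Local Notation idx := {ffun 'I_n -> nat}.
Local Notation T := (l2 R idx).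

Definition row_stab (t : {perm 'I_n}) : bool :=
  [forall k, (box (t k)).1 == (box k).1].

Definition col_stab (t : {perm 'I_n}) : bool :=
  [forall k, (box (t k)).2 == (box k).2].

(* In {perm _} the product [r * c] applies r first: it is the composite c o r. *)
Definition young_proj (F : T) : T :=
  \sum_(r | row_stab r) \sum_(c | col_stab c) (-1) ^+ odd_perm c *: rho (r * c)%g F.

Definition young_pred : {pred T} := fun F => `[< exists G, F = young_proj G >].

Lemma young_proj_linear : linear young_proj.
Proof.
move=> a F G; rewrite /young_proj scaler_sumr -big_split; apply: eq_bigr => r _.
rewrite scaler_sumr -big_split; apply: eq_bigr => c _ /=.
by rewrite rho_linear scalerDr !scalerA mulrC.
Qed.

Lemma young_submod_closed : submod_closed young_pred.
Proof.
split.
  apply/asboolP; exists 0; have := young_proj_linear (-1) 0 0.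
  by rewrite scaler0 addr0 scaleN1r addNr.
move=> a _ _ /asboolP[F ->] /asboolP[G ->]; apply/asboolP.
by exists (a *: F + G); rewrite young_proj_linear.
Qed.

HB.instance Definition _ :=
  GRing.isSubmodClosed.Build C T young_pred young_submod_closed.

Record young_mod := YoungMod { young_val :> T; _ : young_val \in young_pred }.

HB.instance Definition _ := [isSub for young_val].
HB.instance Definition _ := [Choice of young_mod by <:].
HB.instance Definition _ := [SubChoice_isSubLmodule of young_mod by <:].

Definition young_dot (u v : young_mod) : C := l2_dot (val u) (val v).

Lemma young_bilinear : bilinear_for
  (GRing.Scale.Law.clone _ _ ( *%R ) _)
  (GRing.Scale.Law.clone _ _ (Num.conj \; *%R ) _) young_dot.
Proof.
by split=> [z a x y|x a y z]; rewrite /young_dot/=; [exact: linearPl|exact: linearPr].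
Qed.

HB.instance Definition _ :=
  bilinear_isBilinear.Build C young_mod young_mod C _ _ young_dot young_bilinear.

Lemma young_hermitian (x y : young_mod) :
  young_dot x y = (-1) ^+ false * Num.conj (young_dot y x).
Proof. exact: l2_hermitian. Qed.

HB.instance Definition _ := isHermitianSesquilinear.Build C young_mod false
  Num.conj young_dot young_hermitian.

Lemma young_dot_gt0 (x : young_mod) : x != 0 -> 0 < young_dot x x.
Proof. by move=> x0; exact: l2_dot_gt0. Qed.

HB.instance Definition _ :=
  isDotProduct.Build C young_mod young_dot young_dot_gt0.

(* pi_s(g) is the restriction of g^(x)n; for unitary g it preserves H_s, so the
   default value of [insubd] is not used. *)
Definition young_rep (g : l2 R nat -> l2 R nat) (v : young_mod) : young_mod :=
  insubd 0 (tpow g (val v)).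

End YoungModules.

Section Dual.
Variables (R : realType) (V : lmodType R[i]) (dot : {dot V for Num.conj}).
Local Notation C := R[i].

Definition dual_pred : {pred V -> C^o} := fun f =>
  `[< scalar f /\ exists M : R, forall v, normc (f v) <= M * hnorm dot v >].

Lemma dual_submod_closed : submod_closed dual_pred.
Proof.
split.
  apply/asboolP; split=> [a x y|]; first by rewrite /= mulr0 addr0.
  by exists 0 => v; rewrite mul0r normc0.
move=> a f g /asboolP[fl [M fM]] /asboolP[gl [N gN]]; apply/asboolP; split.
  move=> b x y; have E z : (a *: f + g) z = a * f z + g z by [].
  by rewrite !E fl gl; ring.
exists (normc a * M + N) => v; have E : (a *: f + g) v = a * f v + g v by [].
rewrite E mulrDl; apply: le_trans (le_normcD _ _) _; rewrite lerD//.
by rewrite normcM -mulrA ler_wpM2l ?normc_ge0.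
Qed.

HB.instance Definition _ :=
  GRing.isSubmodClosed.Build C (V -> C^o) dual_pred dual_submod_closed.

Record dual := Dual { dual_fun :> V -> C^o; _ : dual_fun \in dual_pred }.

HB.instance Definition _ := [isSub for dual_fun].
HB.instance Definition _ := [Choice of dual by <:].
HB.instance Definition _ := [SubChoice_isSubLmodule of dual by <:].

(* The vector u with f = <., u>. *)
Definition riesz (f : dual) : V := xget 0 [set u | forall v, f v = dot v u].

Definition dual_dot (f f' : dual) : C := dot (riesz f') (riesz f).

End Dual.

(* (K, tau) is the Hilbert tensor product of V and W; these properties determine
   it up to a unique unitary isomorphism compatible with [tau]. *)
Definition hilbert_tensor (R : realType) (V W K : lmodType R[i])
    (dotV : V -> V -> R[i]) (dotW : W -> W -> R[i]) (dotK : {dot K for Num.conj})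
    (tau : {bilinear V -> W -> K}) : Prop :=
  [/\ hcomplete dotK,
      forall v v' w w', dotK (tau v w) (tau v' w') = dotV v v' * dotW w w'
    & forall (x : K) (eps : R), 0 < eps -> exists m (v : 'I_m -> V) (w : 'I_m -> W),
        hnorm dotK (x - \sum_i tau (v i) (w i)) < eps].

(* The decreasing rearrangements of max(lambda, 0) and max(- lambda, 0), up to
   trailing zeros. *)
Definition weight_pos (lambda : {fsfun nat -> int with 0}) : seq nat :=
  sort geq [seq `|Num.max (lambda i) 0|%N | i <- finsupp lambda].

Definition weight_neg (lambda : {fsfun nat -> int with 0}) : seq nat :=
  sort geq [seq `|Num.max (- lambda i) 0|%N | i <- finsupp lambda].

Section HighestWeight.
Variables (R : realType) (p : R) (lambda : {fsfun nat -> int with 0}).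
Local Notation H := (l2 R nat).
Local Notation Hpos := (young_mod R (weight_pos lambda)).
Local Notation Hneg := (young_mod R (weight_neg lambda)).

(* f o pi(g^-1), which is again a bounded functional for unitary g. *)
Definition young_dual_rep (s : seq nat) (g : H -> H)
    (f : dual (@young_dot R s)) : dual (@young_dot R s) :=
  insubd 0 (fun v => f (young_rep (op_inv g) v)).

(* (pi, K) is (a model of) the representation of U_p(l^2(N)) with highest weight
   lambda, i.e. the Hilbert tensor product of the dual of the representation
   for lambda^- with the representation for lambda^+. *)
Definition highest_weight_rep (K : lmodType R[i]) (dotK : {dot K for Num.conj})
    (pi : (H -> H) -> K -> K) : Prop :=
  exists tau : {bilinear dual (@young_dot R (weight_neg lambda)) -> Hpos -> K},
    hilbert_tensor (@dual_dot R Hneg (@young_dot R _)) (@young_dot R _) dotK tau /\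
    forall g, Up (@l2_dot R nat) p g -> unitary dotK (pi g) /\
      forall f v, pi g (tau f v) = tau (young_dual_rep g f) (young_rep g v).

End HighestWeight.

(* Main.v *)
(** All that matters about [K] is read off the inner products of the vectors
    [tau f v]; no Hilbert tensor product has to be constructed.

    If [lambda = 0], a cocycle is a continuous homomorphism [b] into [K]. For [g]
    in [U_p] with [g - 1 = sum_n s_n <., e_n> f_n], the vectors [e_n] with
    [s_n >= t] and the vectors [f_n] with [s_n >= t] span the same finite
    dimensional space, an eigenspace sum of [|g - 1|^2 = 2 - g - g^*]. Hence [g] is
    a limit of unitaries diagonal on a finite orthonormal family, and these form
    tori. On a torus [b] is bounded, as every element is a [2^j]-th power of one
    close to [1] with [j] fixed; being additive on powers, [b] is zero.

    If [|lambda| = 1], then [K] is [H] up to a linear or antilinear isometry [J].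
    For the reflection [r_x] in [x], the cocycle [b] satisfies
    [b r_x = A x / |x|^2 J x] for a number [A x], and [r_x r_e = r_w r_x] with
    [w = r_x e] gives [A w = A e - 2 A x / |x|^2 <J x, J e>]. As
    [r_x r_y (x + y) = - (x + y)] for orthogonal [x] and [y], the map [A] is
    additive on orthogonal vectors; commuting [r_x] with a complex reflection near
    [1] shows that it is bounded. So [A x = <y, J x>], and subtracting a coboundary
    one may assume [b r_x = 0]. Then [g r_x = r_(g x) g] shows that [b g] is fixed
    by all reflections, hence zero.

    If [n = |lambda| >= 2], let [w_k] be the image under the Young projectors of a
    product of [n] basis vectors, with disjoint blocks of basis vectors for
    different [k]. Then [b g = sum_k a_k (pi g w_k - w_k)] converges for suitable
    [a] outside [l^2]: the inner products of [pi g w_k] and [pi h w_l], [k <> l], are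
    products of [n >= 2] overlaps [<g e, h e'> = <(g - h) e, h e'>], so that the
    Schur test bounds [|b g - b h|^2] by a multiple of
    [sum_k a_k^2 |(g - h) e_k|^2], which is finite on the [p]-th Schatten class if
    [a_k^2 = b_k^M] with [b] in [l^(M+1)] and [p <= 2(M+1)]. Reflections in basis
    vectors show that [b = pi(.) v - v] would force [<v, w_k> = a_k |w_k|^2]. *)

Require Import Defs.
From HB Require Import structures.
From mathcomp Require Import all_boot all_order all_algebra all_fingroup.
From mathcomp Require Import finmap complex sesquilinear spectral.
From mathcomp Require Import boolp classical_sets functions cardinality fsbigop.
From mathcomp Require Import reals ereal topology normedtype sequences esum exp.
From mathcomp Require Import lra ring.

Set Implicit Arguments.
Unset Strict Implicit.
Unset Printing Implicit Defensive.

Import Order.TTheory GRing.Theory Num.Theory Normc.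
Import numFieldNormedType.Exports.
Local Open Scope classical_set_scope.
Local Open Scope ring_scope.
Local Open Scope complex_scope.

Local Notation Re := (@complex.Re _).
Local Notation Im := (@complex.Im _).

(** * Hilbert spaces *)

Section ComplexNorm.
Variable R : realType.
Implicit Types z w : R[i].

Lemma normc_conj z : normc (conjc z) = normc z.
Proof. by case: z => a b /=; rewrite sqrrN. Qed.

Lemma normcB z w : normc (z - w) = normc (w - z).
Proof. by rewrite -normcN opprB. Qed.

Lemma normcR (x : R) : normc x%:C = `|x|.
Proof. by rewrite /= expr0n /= addr0 sqrtr_sqr. Qed.

Lemma normc_eq0 z : (normc z == 0) = (z == 0).
Proof.
by apply/eqP/eqP => [/eq0_normc|->]; rewrite ?normc0.
Qed.

Lemma normc_gt0 z : (0 < normc z) = (z != 0).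
Proof. by rewrite lt_def normc_ge0 andbT normc_eq0. Qed.

Lemma normcX z n : normc (z ^+ n) = normc z ^+ n.
Proof. by elim: n => [|n ih]; rewrite ?normc1// !exprS normcM ih. Qed.

Lemma mulJc z : z * conjc z = (normc z ^+ 2)%:C.
Proof.
by rewrite Defs.sqr_normc; case: z => a b; simpc; congr (_ +i* _) => /=; ring.
Qed.

Lemma ler_Re z : Re z <= normc z.
Proof.
case: z => a b /=; apply: (le_trans (ler_norm _)).
by rewrite -sqrtr_sqr ler_wsqrtr// lerDl sqr_ge0.
Qed.

Lemma normc_sum (I : Type) (r : seq I) (P : pred I) (F : I -> R[i]) :
  normc (\sum_(i <- r | P i) F i) <= \sum_(i <- r | P i) normc (F i).
Proof.
elim/big_rec2: _ => [|i x y _ h]; first by rewrite normc0.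
by apply: (le_trans (le_normcD _ _)); rewrite lerD2l.
Qed.

Lemma ReD z w : Re (z + w) = Re z + Re w. Proof. by case: z; case: w. Qed.
Lemma ReN z : Re (- z) = - Re z. Proof. by case: z. Qed.
Lemma ReJ z : Re (conjc z) = Re z. Proof. by case: z. Qed.
Lemma ReRM (x : R) z : Re (x%:C * z) = x * Re z.
Proof. by case: z => a b /=; rewrite mul0r subr0. Qed.

Lemma Re_sum (I : Type) (r : seq I) (P : pred I) (F : I -> R[i]) :
  Re (\sum_(i <- r | P i) F i) = \sum_(i <- r | P i) Re (F i).
Proof. by elim/big_rec2: _ => [//|i x y _ <-]; rewrite ReD. Qed.

End ComplexNorm.

Section Hilbert.
Variables (R : realType) (V : lmodType R[i]) (dot : {dot V for Num.conj}).
Local Notation C := R[i].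
Local Notation "''[' u , v ]" := (dot u%R v%R) : ring_scope.
Local Notation N := (hnorm dot).
Implicit Types (u v w : V) (a : C).

Lemma dotC u v : '[u, v] = conjc '[v, u].
Proof. by rewrite [LHS]hermC expr0 mul1r. Qed.

Lemma dotZl a u v : '[a *: u, v] = a * '[u, v].
Proof. by rewrite linearZl_LR. Qed.

Lemma dotZr a u v : '[u, a *: v] = conjc a * '[u, v].
Proof. by rewrite linearZr_LR. Qed.

Lemma hnorm_ge0 v : 0 <= (N v). Proof. exact: sqrtr_ge0. Qed.

Lemma dotvv v : '[v, v] = ((N v) ^+ 2)%:C.
Proof.
have := dnorm_ge0 dot v; rewrite lecE => /andP[/eqP i0 r0].
rewrite /hnorm sqr_sqrtr//; move: i0 r0; case: '[v, v] => a b /= -> _; by [].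
Qed.

Lemma sqr_hnorm v : (N v) ^+ 2 = Re '[v, v].
Proof. by rewrite dotvv. Qed.

Lemma hnorm0 : (N 0) = 0.
Proof. by rewrite /hnorm linear0l sqrtr0. Qed.

Lemma hnorm_eq0 v : ((N v) == 0) = (v == 0).
Proof.
rewrite -(dnorm_eq0 dot) dotvv; apply/eqP/eqP => [->|].
  by rewrite expr0n.
by move=> /(@complexI _ _ 0)/eqP; rewrite sqrf_eq0 => /eqP.
Qed.

Lemma hnorm_gt0 v : (0 < (N v)) = (v != 0).
Proof. by rewrite lt_def hnorm_ge0 andbT hnorm_eq0. Qed.

Lemma hnormZ a v : (N (a *: v)) = normc a * (N v).
Proof.
apply/eqP; rewrite -(@eqrXn2 _ 2)// ?hnorm_ge0// ?mulr_ge0 ?hnorm_ge0 ?normc_ge0//.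
rewrite sqr_hnorm dotZl dotZr mulrA mulJc ReRM -sqr_hnorm exprMn; exact: eqxx.
Qed.

Lemma hnormN v : (N (- v)) = (N v).
Proof. by rewrite -scaleN1r hnormZ normcN normc1 mul1r. Qed.

Lemma hnormB u v : (N (u - v)) = (N (v - u)).
Proof. by rewrite -hnormN opprB. Qed.

Lemma sqr_hnormD u v :
  (N (u + v)) ^+ 2 = (N u) ^+ 2 + (N v) ^+ 2 + 2 * Re '[u, v].
Proof.
rewrite !sqr_hnorm linearDl/= !linearDr/= !ReD (dotC v u) ReJ; ring.
Qed.

Lemma sqr_hnormB u v :
  (N (u - v)) ^+ 2 = (N u) ^+ 2 + (N v) ^+ 2 - 2 * Re '[u, v].
Proof. by rewrite sqr_hnormD hnormN linearNr ReN; ring. Qed.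

Lemma cauchy_schwarz u v : normc '[u, v] <= (N u) * (N v).
Proof.
have [->|v0] := eqVneq v 0; first by rewrite linear0r normc0 hnorm0 mulr0.
have nv : 0 < (N v) by rewrite hnorm_gt0.
set c := '[u, v] * ((N v) ^- 2)%:C.
have := sqr_ge0 (N (u - c *: v)).
rewrite sqr_hnormB hnormZ dotZr.
have -> : Re (conjc c * '[u, v]) = N v ^- 2 * normc '[u, v] ^+ 2.
  rewrite /c rmorphM/= oppr0 -/(_%:C) mulrC mulrA mulJc mulrC.
  by rewrite -rmorphM/=.
rewrite /c normcM normcR normrV ?unitfE ?expf_neq0 ?gt_eqF// ger0_norm ?exprn_ge0 ?hnorm_ge0//.
rewrite !exprMn => h.
rewrite -(@ler_pXn2r _ 2)// ?nnegrE ?mulr_ge0 ?hnorm_ge0 ?normc_ge0// exprMn.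
rewrite -ler_pdivrMr ?exprn_gt0// -subr_ge0; apply: le_trans h _.
rewrite le_eqVlt; apply/orP; left; apply/eqP.
by field; rewrite gt_eqF.
Qed.

Lemma hnormD u v : (N (u + v)) <= (N u) + (N v).
Proof.
rewrite -(@ler_pXn2r _ 2)// ?nnegrE ?addr_ge0 ?hnorm_ge0//.
rewrite sqr_hnormD sqrrD.
have := le_trans (ler_Re _) (cauchy_schwarz u v); lra.
Qed.

Lemma hnorm_sum (I : Type) (r : seq I) (P : pred I) (F : I -> V) :
  (N (\sum_(i <- r | P i) F i)) <= \sum_(i <- r | P i) (N (F i)).
Proof.
elim/big_rec2: _ => [|i x y _ h]; first by rewrite hnorm0.
by apply: (le_trans (hnormD _ _)); rewrite lerD2l.
Qed.

Lemma hnorm_triangle w u v : (N (u - v)) <= (N (u - w)) + (N (w - v)).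
Proof. by rewrite -[u - v](subrKA w) hnormD. Qed.

Lemma ler_dist_hnorm u v : `| (N u) - (N v) | <= (N (u - v)).
Proof.
have h1 := hnormD (u - v) v; have h2 := hnormD (v - u) u.
rewrite !subrK [X in _ <= X + _]hnormB in h1 h2.
by rewrite (hnormB u) ler_norml; apply/andP; split; rewrite ?lerBrDr ?lerBlDr; lra.
Qed.

Lemma sqr_hnormD_le u v : (N (u + v)) ^+ 2 <= 2 * ((N u) ^+ 2 + (N v) ^+ 2).
Proof.
have := sqr_ge0 (N (u - v)); rewrite sqr_hnormB sqr_hnormD; lra.
Qed.

Lemma dot_ext u v : (forall w, '[u, w] = '[v, w]) -> u = v.
Proof.
move=> h; apply/eqP; rewrite -subr_eq0 -(dnorm_eq0 dot) linearBl/=.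
by rewrite h subrr.
Qed.

Lemma pythagoras (I : eqType) (r : seq I) (c : I -> C) (E : I -> V) :
  uniq r -> (forall i j, i \in r -> j \in r -> '[E i, E j] = (i == j)%:R) ->
  (N (\sum_(i <- r) c i *: E i)) ^+ 2 = \sum_(i <- r) normc (c i) ^+ 2.
Proof.
move=> ur oE; rewrite sqr_hnorm linear_sumlz/= Re_sum.
apply: eq_big_seq => i ir; rewrite linear_sumr/= (bigD1_seq i)//=.
rewrite big_seq_cond big1 ?addr0 => [|j /andP[jr ji]].
  by rewrite dotZl dotZr oE// eqxx mulr1 mulJc.
by rewrite dotZl dotZr oE// eq_sym (negPf ji) !mulr0.
Qed.

(** The squared norm of [v] minus its projection on the span of [E] is nonnegative. *)
Lemma bessel (I : eqType) (r : seq I) (E : I -> V) v :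
  uniq r -> (forall i j, i \in r -> j \in r -> '[E i, E j] = (i == j)%:R) ->
  \sum_(i <- r) normc '[v, E i] ^+ 2 <= (N v) ^+ 2.
Proof.
move=> ur oE; have := sqr_ge0 (N (v - \sum_(i <- r) '[v, E i] *: E i)).
rewrite sqr_hnormB pythagoras// linear_sumr/= Re_sum.
under [X in 2 * X]eq_bigr => i _ do rewrite dotZr mulrC mulJc /=.
lra.
Qed.

(** After expanding the square, each product [a k * a l] is split by 2xy <= x^2 + y^2. The symmetry
    of [S] makes the two halves equal, and the row sums of [S] finish the estimate. *)
Lemma schur_test (m : nat) (a d : nat -> R) (S : nat -> nat -> R) (c : R)
    (z : nat -> V) (r : seq nat) :
  (forall k, 0 <= a k) ->
  (forall k l, k \in r -> l \in r -> normc '[z k, z l] <= S k l) ->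
  (forall k l, S k l = S l k) ->
  (forall k, k \in r -> \sum_(l <- r) S k l <= c * d k) ->
  (N (\sum_(k <- r) (a k)%:C *: z k)) ^+ 2 <= c * \sum_(k <- r) a k ^+ 2 * d k.
Proof.
move=> a0 zS sS Sd.
have S0 k l : k \in r -> l \in r -> 0 <= S k l.
  by move=> kr lr; apply: le_trans (zS _ _ kr lr); exact: normc_ge0.
rewrite sqr_hnorm linear_sumlz/=.
apply: (le_trans (ler_Re _)); apply: (le_trans (normc_sum _ _ _)).
apply: (@le_trans _ _ (\sum_(k <- r) \sum_(l <- r)
    (a k ^+ 2 / 2 * S k l + a l ^+ 2 / 2 * S k l))).
  rewrite big_seq [leRHS]big_seq; apply: ler_sum => k kr.
  rewrite linear_sumr/=; apply: (le_trans (normc_sum _ _ _)).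
  rewrite big_seq [leRHS]big_seq; apply: ler_sum => l lr.
  rewrite dotZl dotZr !normcM conjc_real !normcR !ger0_norm//.
  rewrite mulrA -mulrDl; apply: (@le_trans _ _ (a k * a l * S k l)).
    by rewrite ler_wpM2l ?mulr_ge0// zS.
  rewrite ler_wpM2r ?S0//; have := sqr_ge0 (a k - a l); rewrite sqrrB; lra.
under [leLHS]eq_bigr => k _ do rewrite big_split/=.
rewrite big_split/= [X in _ + X]exchange_big/=.
under [X in _ + X]eq_bigr => k _.
  under eq_bigr => l _ do rewrite sS; over.
rewrite -big_split/= mulr_sumr big_seq [leRHS]big_seq; apply: ler_sum => k kr.
rewrite -mulr_sumr; have := ler_wpM2l (sqr_ge0 (a k)) (Sd k kr); lra.
Qed.

Lemma hcvg_unique (u : nat -> V) l l' : hcvg dot u l -> hcvg dot u l' -> l = l'.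
Proof.
move=> ul ul'; apply/eqP; rewrite -subr_eq0 -hnorm_eq0.
apply: contraT => n0; have np : 0 < (N (l - l')) by rewrite lt_def n0 hnorm_ge0.
have e0 : 0 < (N (l - l')) / 2 by rewrite divr_gt0.
have [N hN] := ul _ e0; have [M hM] := ul' _ e0.
have := hnorm_triangle (u (maxn N M)) l l'; rewrite (hnormB l (u _)).
by have := hN _ (leq_maxl N M); have := hM _ (leq_maxr N M); lra.
Qed.

Lemma hcvgP (u : nat -> V) l :
  hcvg dot u l <-> ((fun n => (N (u n - l))) @ \oo --> (0 : R)).
Proof.
split=> [ul|].
  apply/cvgrPdist_lt => e e0; have [N hN] := ul _ e0.
  by exists N => // n /= Nn; rewrite sub0r normrN ger0_norm ?hnorm_ge0// hN.
move=> /cvgrPdist_lt h e e0; have [N _ hN] := h _ e0.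
by exists N => n Nn; have := hN n Nn; rewrite sub0r normrN ger0_norm ?hnorm_ge0.
Qed.

Lemma hcvg_norm (u : nat -> V) l :
  hcvg dot u l -> (fun n => (N (u n))) @ \oo --> (N l).
Proof.
move=> ul; apply/cvgrPdist_lt => e e0; have [N hN] := ul _ e0.
exists N => // n /= Nn; apply: le_lt_trans (hN n Nn).
by rewrite hnormB ler_dist_hnorm.
Qed.

Lemma hcvg_le (u : nat -> V) l (B : R) :
  hcvg dot u l -> (forall n, (N (u n)) <= B) -> (N l) <= B.
Proof.
move=> /hcvg_norm ul uB.
have -> : N l = limn (fun n => N (u n)) by apply/esym/cvg_lim.
by apply: limr_le; [apply/cvg_ex; exists (N l)|apply: nearW].
Qed.

Lemma hcvg_cst l : hcvg dot (fun=> l) l.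
Proof. by move=> e e0; exists 0%N => n _; rewrite subrr hnorm0. Qed.

Lemma hcvg_near (u v : nat -> V) l (N : nat) :
  (forall n, (N <= n)%N -> u n = v n) -> hcvg dot u l -> hcvg dot v l.
Proof.
move=> uv ul e /ul[M hM]; exists (maxn N M) => n; rewrite geq_max => /andP[Nn Mn].
by rewrite -uv// hM.
Qed.

Lemma hcvgZD (u v : nat -> V) l l' a :
  hcvg dot u l -> hcvg dot v l' -> hcvg dot (fun n => a *: u n + v n) (a *: l + l').
Proof.
move=> ul ul' e e0; have c0 : 0 < normc a + 1 by rewrite ltr_wpDl ?normc_ge0.
have e1 : 0 < e / 2 / (normc a + 1) by rewrite !divr_gt0.
have e2 : 0 < e / 2 by rewrite !divr_gt0.
have [N hN] := ul _ e1; have [M hM] := ul' _ e2.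
exists (maxn N M) => n; rewrite geq_max => /andP[/hN Nn /hM Mn].
rewrite opprD addrACA -scalerBr (le_lt_trans (hnormD _ _))// hnormZ.
rewrite ltr_pdivlMr// mulrDr mulr1 in Nn.
by have := hnorm_ge0 (u n - l); lra.
Qed.

Lemma hcvgD (u v : nat -> V) l l' :
  hcvg dot u l -> hcvg dot v l' -> hcvg dot (fun n => u n + v n) (l + l').
Proof.
move=> ul vl; have := hcvgZD 1 ul vl; rewrite scale1r.
by apply: (@hcvg_near _ _ _ 0) => n _; rewrite scale1r.
Qed.

Lemma hcvgB (u v : nat -> V) l l' :
  hcvg dot u l -> hcvg dot v l' -> hcvg dot (fun n => u n - v n) (l - l').
Proof.
move=> ul vl; have := hcvgZD (-1) vl ul; rewrite scaleN1r addrC.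
by apply: (@hcvg_near _ _ _ 0) => n _; rewrite scaleN1r addrC.
Qed.

Lemma hcvg_dot (u : nat -> V) l w :
  hcvg dot u l -> (fun n => normc ('[u n, w] - '[l, w])) @ \oo --> (0 : R).
Proof.
move=> /hcvgP ul.
have : (fun n => (N (u n - l)) * (N w)) @ \oo --> (0 * (N w) : R) by apply: cvgMl.
rewrite mul0r; apply: squeeze_cvgr; last exact: cvg_cst.
by near=> n; rewrite normc_ge0 -linearBl/= cauchy_schwarz.
Unshelve. all: by end_near. Qed.

Lemma hcvg_dot_eq (u : nat -> V) l w (c : C) (n0 : nat) :
  hcvg dot u l -> (forall n, (n0 <= n)%N -> '[u n, w] = c) -> '[l, w] = c.
Proof.
move=> /(@hcvg_dot _ _ w) h e; apply/eqP; rewrite eq_sym -subr_eq0 -normc_eq0.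
apply/eqP; rewrite -(cvg_lim (@Rhausdorff R) h); apply/esym/cvg_lim => //.
by apply: cvg_near_cst; exists n0 => // n /= Nn; rewrite e.
Qed.

End Hilbert.

(** * Linear isometries and unitary operators *)

Section LinearMaps.
Variables (R : realType) (V W : lmodType R[i]).
Variables (dotV : {dot V for Num.conj}) (dotW : {dot W for Num.conj}).
Variable L : V -> W.
Hypothesis linL : linear L.

Lemma linear_0 : L 0 = 0.
Proof. by have := linL (-1) 0 0; rewrite scaler0 addr0 scaleN1r addNr. Qed.

Lemma linear_Z a v : L (a *: v) = a *: L v.
Proof. by have := linL a v 0; rewrite linear_0 !addr0. Qed.

Lemma linear_D u v : L (u + v) = L u + L v.
Proof. by have := linL 1 u v; rewrite !scale1r. Qed.

Lemma linear_B u v : L (u - v) = L u - L v.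
Proof. by rewrite -scaleN1r linear_D linear_Z scaleN1r. Qed.

Lemma linear_N u : L (- u) = - L u.
Proof. by rewrite -scaleN1r linear_Z scaleN1r. Qed.

Lemma linear_bigsum (I : Type) (r : seq I) (P : pred I) (F : I -> V) :
  L (\sum_(i <- r | P i) F i) = \sum_(i <- r | P i) L (F i).
Proof. by elim/big_rec2: _ => [|i x y _ <-]; rewrite ?linear_0// linear_D. Qed.

(** Expanding |x + y|^2 recovers the real parts of inner products; replacing [x] by ['i *: x] turns
    imaginary parts into real ones. *)
Lemma polarization : (forall v, hnorm dotW (L v) = hnorm dotV v) ->
  forall u v, dotW (L u) (L v) = dotV u v.
Proof.
move=> iL u v.
have re x y : Re (dotW (L x) (L y)) = Re (dotV x y).
  have := iL (x + y); move/(congr1 (fun t => t ^+ 2)).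
  by rewrite linear_D !sqr_hnormD !iL; lra.
have im x y : Im (dotW (L x) (L y)) = Im (dotV x y).
  have := re ('i *: x) y; rewrite linear_Z !dotZl.
  by case: (dotW _ _) => a b; case: (dotV _ _) => c d /=; lra.
by have := re u v; have := im u v; case: (dotW _ _) => a b; case: (dotV _ _) => c d /= -> ->.
Qed.

End LinearMaps.

Section Unitary.
Variables (R : realType) (V : lmodType R[i]) (dot : {dot V for Num.conj}).
Implicit Types g h : V -> V.
Local Notation U := (unitary dot).
Local Notation N := (hnorm dot).

Lemma unitary_lin g : U g -> linear g. Proof. by case. Qed.

Lemma unitary_dot g : U g -> forall u v, dot (g u) (g v) = dot u v.
Proof. by case. Qed.

Lemma unitary_norm g v : U g -> N (g v) = N v.
Proof. by move=> ug; rewrite /hnorm unitary_dot. Qed.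

Lemma unitary_inj g : U g -> injective g.
Proof.
move=> ug u v guv; apply/eqP; rewrite -subr_eq0 -(hnorm_eq0 dot).
by rewrite -(unitary_norm _ ug) (linear_B (unitary_lin ug)) guv subrr hnorm0.
Qed.

Lemma op_invK g : U g -> forall w, g (op_inv g w) = w.
Proof.
move=> [_ _ sg] w; rewrite /op_inv; case: xgetP => [v _ //|/(_ _)].
by have [v vw] := sg w => /(_ v).
Qed.

Lemma op_invKV g : U g -> forall w, op_inv g (g w) = w.
Proof. by move=> ug w; apply: (unitary_inj ug); rewrite op_invK. Qed.

Lemma unitary_inv g : U g -> U (op_inv g).
Proof.
move=> ug; split=> [a u v|u v|w].
- by apply: (unitary_inj ug); rewrite (unitary_lin ug) !op_invK.
- by rewrite -(unitary_dot ug) !op_invK.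
- by exists (g w); rewrite op_invKV.
Qed.

Lemma unitary_comp g h : U g -> U h -> U (g \o h).
Proof.
move=> ug uh; split=> [a u v|u v|w] /=.
- by rewrite (unitary_lin uh) (unitary_lin ug).
- by rewrite (unitary_dot ug) (unitary_dot uh).
- by exists (op_inv h (op_inv g w)); rewrite !op_invK.
Qed.

Lemma unitary_id : U id.
Proof. by split=> // w; exists w. Qed.

Lemma hcvg_unitary g u l : U g -> hcvg dot u l -> hcvg dot (g \o u) (g l).
Proof.
move=> ug ul e /ul[n hn]; exists n => m /hn.
by rewrite /= -(linear_B (unitary_lin ug)) (unitary_norm _ ug).
Qed.

End Unitary.

(** * Square summable families *)

Section L2.
Variables (R : realType) (I : choiceType).
Local Notation C := R[i].
Local Notation T := (l2 R I).
Local Notation dot := (@l2_dot R I : {dot T for Num.conj}).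
Local Notation N := (hnorm dot).

Lemma esum_single (a : I -> \bar R) i : (forall j, 0 <= a j)%E ->
  (forall j, j != i -> a j = 0%E) -> \esum_(j in [set: I]) a j = a i.
Proof.
move=> a0 ai; apply/eqP; rewrite eq_le; apply/andP; split; last first.
  by apply: esum_ge; exists [set i]; rewrite ?fsbig_set1//; split.
apply: ge_ereal_sup => _ [A [finA _] <-].
apply: (@le_trans _ _ (\sum_(j \in [set i]) a j)%E); last by rewrite fsbig_set1.
rewrite (fsbigID [set i])//= [X in (_ + X)%E]fsbig1 ?adde0.
  by apply: lee_fsum_nneg_subset => // [|j]; [exact: finite_setIl|
    rewrite !inE => -[]].
by move=> j [_ /eqP ji]; rewrite ai.
Qed.

Lemma rsum_single (f : I -> R) i : (forall j, j != i -> f j = 0) -> rsum f = f i.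
Proof.
move=> fi; rewrite /rsum.
rewrite (@esum_single _ i) ?(@esum_single (fun j => (Num.max (- f j) 0)%:E) i)/=.
- by case: (leP 0 (f i)) => h; [rewrite max_r|rewrite max_l]; lra.
- by move=> j; rewrite lee_fin le_max lexx orbT.
- by move=> j /fi ->; rewrite oppr0 maxxx.
- by move=> j; rewrite lee_fin le_max lexx orbT.
- by move=> j /fi ->; rewrite maxxx.
Qed.

Lemma csum_single (f : I -> C) i : (forall j, j != i -> f j = 0) -> csum f = f i.
Proof.
by move=> fi; rewrite /csum !(@rsum_single _ i) => [|j /fi ->|j /fi ->]//; case: (f i).
Qed.

Lemma fine_sqsum (x : T) : (fine (sqsum x))%:E = sqsum x.
Proof.
rewrite fineK// ge0_fin_numE; first exact: (valP x).
by apply: esum_ge0 => i _; rewrite lee_fin sqr_ge0.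
Qed.

Lemma sqr_l2_norm (x : T) : (N x ^+ 2)%:E = sqsum x.
Proof. by rewrite sqr_hnorm -[dot x x]/(l2_dot x x) l2_dotxx /= fine_sqsum. Qed.

Lemma l2_predP (x : I -> C^o) (B : R) :
  (forall r : seq I, uniq r -> \sum_(i <- r) normc (x i) ^+ 2 <= B) ->
  x \in @l2_pred R I.
Proof.
move=> xB; rewrite -topredE /= /l2_pred; apply: (@le_lt_trans _ _ B%:E); last exact: ltry.
apply: ge_ereal_sup => _ [A [finA _] <-].
by rewrite fsbig_finite//= sumEFin lee_fin xB.
Qed.

Lemma delta_subproof i : ((fun j => (j == i)%:R) : I -> C^o) \in @l2_pred R I.
Proof.
apply: (@l2_predP _ 1) => r ur.
have [ir|ir] := boolP (i \in r).
  rewrite (bigD1_seq i)//= big1 => [|j /negPf ->]; last by rewrite normc0 expr0n.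
  by rewrite eqxx normc1 expr1n addr0.
rewrite big_seq big1 ?ler01// => j jr.
by have [ji|] := eqVneq j i; [rewrite -ji jr in ir|rewrite normc0 expr0n].
Qed.

Definition delta i : T := L2 (delta_subproof i).

Lemma deltaE i j : delta i j = (j == i)%:R. Proof. by []. Qed.

Lemma dot_delta (x : T) i : dot x (delta i) = x i.
Proof.
rewrite -[LHS]/(l2_dot x (delta i)) /l2_dot (@csum_single _ i) ?deltaE ?eqxx ?conjc1 ?mulr1// => j ji.
by rewrite deltaE (negPf ji) conjc0 mulr0.
Qed.

Lemma dot_deltal (x : T) i : dot (delta i) x = conjc (x i).
Proof. by rewrite dotC dot_delta. Qed.

Lemma delta_on i j : dot (delta i) (delta j) = (i == j)%:R.
Proof. by rewrite dot_delta deltaE eq_sym. Qed.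

Lemma norm_delta i : N (delta i) = 1.
Proof. by rewrite /hnorm delta_on eqxx/= sqrtr1. Qed.

Lemma l2_ext (x y : T) : (forall i, x i = y i) -> x = y.
Proof. by move=> xy; apply/val_inj/funext. Qed.

Definition l2_trunc (r : seq I) (x : T) : T := \sum_(i <- r) x i *: delta i.

Lemma sqr_norm_trunc r (x : T) : uniq r ->
  N (l2_trunc r x) ^+ 2 = \sum_(i <- r) normc (x i) ^+ 2.
Proof. by move=> ur; apply: pythagoras => // i j _ _; rewrite delta_on. Qed.

Lemma sqr_norm_subtrunc r (x : T) : uniq r ->
  N (x - l2_trunc r x) ^+ 2 = N x ^+ 2 - \sum_(i <- r) normc (x i) ^+ 2.
Proof.
move=> ur; rewrite sqr_hnormB sqr_norm_trunc// linear_sumr/= Re_sum.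
under [X in 2 * X]eq_bigr => i _ do rewrite dotZr dot_delta mulrC mulJc /=.
by ring.
Qed.

Lemma sqr_norm_sup (x : T) (e : R) : 0 < e ->
  exists2 r : seq I, uniq r & N x ^+ 2 - e < \sum_(i <- r) normc (x i) ^+ 2.
Proof.
move=> e0; have : (sqsum x > (N x ^+ 2 - e)%:E)%E.
  by rewrite -sqr_l2_norm lte_fin ltrBlDr ltrDl.
move=> /ereal_sup_gt[_ [A [finA _] <-]].
by rewrite fsbig_finite//= sumEFin lte_fin => h; exists (fset_set A).
Qed.

Lemma trunc_dense (x : T) (e : R) : 0 < e ->
  exists2 r : seq I, uniq r & N (x - l2_trunc r x) < e.
Proof.
move=> e0; have [r ur h] := sqr_norm_sup x (exprn_gt0 2 e0); exists r => //.
rewrite -(@ltr_pXn2r _ 2)// ?nnegrE ?hnorm_ge0 ?ltW//.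
by rewrite sqr_norm_subtrunc//; lra.
Qed.

Lemma scalar_trunc (f : T -> C^o) r x : scalar f ->
  f (l2_trunc r x) = \sum_(i <- r) x i * f (delta i).
Proof. by move=> lf; rewrite /l2_trunc (linear_bigsum lf); apply: eq_bigr => i _; rewrite (linear_Z lf). Qed.

Lemma scalar_eq0 (f : T -> C^o) (M : R) : scalar f ->
  (forall x, normc (f x) <= M * N x) -> (forall i, f (delta i) = 0) ->
  forall x, f x = 0.
Proof.
move=> lf bf f0 x; apply: contrapT => /eqP; rewrite -normc_gt0 => fx.
(* [M] may be negative; this number bounds it from above and is positive, so it can be divided
   by. *)
have M0 : 0 < M + `|M| + 1 by have := ler_norm (- M); rewrite normrN; lra.
have [r _ h] := trunc_dense x (divr_gt0 fx M0).
have := bf (x - l2_trunc r x); rewrite (linear_B lf) scalar_trunc//.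
rewrite big1 ?subr0 => [|i _]; last by rewrite f0 mulr0.
rewrite ltr_pdivlMr// in h.
have : M * N (x - l2_trunc r x) <= N (x - l2_trunc r x) * (M + `|M| + 1).
  by rewrite mulrC ler_wpM2l ?hnorm_ge0//; have := normr_ge0 M; lra.
lra.
Qed.

(** The coordinates of [u] have to be the conjugates of the values of [f] on the basis. Testing [f]
    on the truncation [y] of this family gives S = f y <= M sqrt S, hence square summability with
    bound M^2. *)
Lemma l2_riesz (f : T -> C^o) (M : R) : scalar f ->
  (forall x, normc (f x) <= M * N x) -> exists u : T, forall x, f x = dot x u.
Proof.
move=> lf bf.
have hu : ((fun i => conjc (f (delta i))) : I -> C^o) \in @l2_pred R I.
  apply: (@l2_predP _ (M ^+ 2)) => r ur.
  set S := \sum_(i <- r) _.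
  pose y : T := \sum_(i <- r) conjc (f (delta i)) *: delta i.
  have ny : N y ^+ 2 = S by apply: pythagoras => // i j _ _; rewrite delta_on.
  have fy : f y = S%:C.
    rewrite /y (linear_bigsum lf) /S rmorph_sum/=; apply: eq_bigr => i _.
    by rewrite (linear_Z lf) normc_conj -mulJc mulrC.
  have S0 : 0 <= S by apply: sumr_ge0 => i _; exact: sqr_ge0.
  have := bf y; rewrite fy normcR ger0_norm// => h.
  have [/eqP->|Sn0] := boolP (S == 0); first exact: sqr_ge0.
  have Sp : 0 < S by rewrite lt_def Sn0.
  rewrite -(ler_pM2l Sp) -expr2 -{2}ny mulrC -exprMn.
  by rewrite ler_pXn2r// nnegrE//; apply: le_trans h.
pose u : T := L2 hu; exists u.
suff h x : f x - dot x u = 0.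
  by move=> x; apply/eqP; rewrite -subr_eq0 h.
move: x; apply: (@scalar_eq0 (fun x => f x - dot x u) (M + N u)).
- move=> a x y; rewrite lf linearDl/= dotZl /GRing.scale/=; ring.
- move=> x; rewrite mulrDl; apply: (le_trans (le_normcD _ _)).
  by rewrite lerD// normcN mulrC cauchy_schwarz.
- by move=> i; rewrite dot_deltal conjcK subrr.
Qed.

(** Pairing with an arbitrary [w] reduces the claim to bounded functionals, which are determined by
    their values on the basis. *)
Lemma bounded_lin_eq (K : lmodType C) (dotK : {dot K for Num.conj})
    (L1 L2 : T -> K) (M1 M2 : R) : linear L1 -> linear L2 ->
  (forall x, hnorm dotK (L1 x) <= M1 * N x) ->
  (forall x, hnorm dotK (L2 x) <= M2 * N x) ->
  (forall i, L1 (delta i) = L2 (delta i)) -> L1 = L2.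
Proof.
move=> l1 l2 b1 b2 e; apply/funext => x; apply: (@dot_ext _ _ dotK) => w.
apply/eqP; rewrite -subr_eq0 -linearBl/=; apply/eqP; move: x.
apply: (@scalar_eq0 (fun x => dotK (L1 x - L2 x) w) ((M1 + M2) * hnorm dotK w)).
- by move=> a x y; rewrite l1 l2 -linearPl/= scalerBr opprD addrACA.
- move=> x; apply: (le_trans (cauchy_schwarz _ _ _)).
  rewrite mulrAC ler_wpM2r ?hnorm_ge0// (le_trans (hnormD _ _ _))// hnormN mulrDl.
  by rewrite lerD.
- by move=> i; rewrite e subrr linear0l.
Qed.

End L2.

Lemma hcvg_trunc (R : realType) (x : l2 R nat) :
  hcvg (@l2_dot R nat) (fun m => l2_trunc (index_iota 0 m) x) x.
Proof.
move=> e e0; have [r ur h] := sqr_norm_sup x (exprn_gt0 2 e0).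
exists (\max_(i <- r) i.+1)%N => n hn; rewrite hnormB.
rewrite -(@ltr_pXn2r _ 2)// ?nnegrE ?hnorm_ge0 ?ltW//.
rewrite sqr_norm_subtrunc ?iota_uniq//.
suff : \sum_(i <- r) normc (x i) ^+ 2 <= \sum_(0 <= i < n) normc (x i) ^+ 2 by lra.
have rn : {subset r <= index_iota 0 n}.
  move=> i ir; rewrite mem_index_iota /=; apply: leq_trans hn.
  exact: (@leq_bigmax_seq _ _ xpredT (fun i : nat => i.+1)).
rewrite [leRHS](bigID (mem r))/= -[X in _ <= X + _]big_filter.
have pr : perm_eq [seq i <- index_iota 0 n | i \in r] r.
  apply: uniq_perm; rewrite ?filter_uniq ?iota_uniq// => i.
  by rewrite mem_filter; case: (boolP (i \in r)) => // /rn ->.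
by rewrite (perm_big _ pr)/= lerDl sumr_ge0// => i _; exact: sqr_ge0.
Qed.

(** * Schatten classes *)

Lemma cvg_nat_sum (R : realType) (f : nat -> nat -> R) (l : nat -> R) m :
  (forall k, f k @ \oo --> l k) ->
  (fun n => \sum_(0 <= k < m) f k n) @ \oo --> \sum_(0 <= k < m) l k.
Proof.
move=> fl; elim: m => [|m ih].
  by rewrite big_nil; under eq_fun do rewrite big_nil; exact: cvg_cst.
rewrite big_nat_recr//=; under eq_fun do rewrite big_nat_recr//=.
exact: cvgD.
Qed.

Section Schatten.
Variables (R : realType) (V : lmodType R[i]) (dot : {dot V for Num.conj}).
Local Notation C := R[i].
Local Notation N := (hnorm dot).
Implicit Types (T : V -> V) (s : nat -> R) (e f : nat -> V).

Lemma schatten_norm_le p T s (B : R) : 1 <= p -> 0 <= B ->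
  singular_values dot T s ->
  (forall m, \sum_(0 <= n < m) s n `^ p <= B `^ p) ->
  (schatten_norm dot p T <= B%:E)%E.
Proof.
move=> p1 B0 sT sB; have p0 : 0 < p by apply: lt_le_trans p1.
apply: (@le_trans _ _ ((\sum_(n <oo) (s n `^ p)%:E) `^ p^-1)%E).
  by apply: ereal_inf_lbound; exists s.
have h : (\sum_(n <oo) (s n `^ p)%:E <= (B `^ p)%:E)%E.
  apply: lime_le; first by apply: is_cvg_nneseries => n _ _; rewrite lee_fin powR_ge0.
  by apply: nearW => m; rewrite sumEFin lee_fin.
have -> : B%:E = ((B `^ p)%:E `^ p^-1)%E.
  by rewrite poweR_EFin -powRrM divff ?gt_eqF// powRr1.
have i0 : (0 <= \sum_(n <oo) (s n `^ p)%:E)%E.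
  by apply: nneseries_ge0 => n _ _; rewrite lee_fin powR_ge0.
apply: gt0_ler_poweR => //; rewrite ?invr_ge0 ?ltW// in_itv/= ?leey ?andbT//.
by rewrite lee_fin powR_ge0.
Qed.

(** A strict bound on the infimum provides an actual singular value expansion below the bound, and
    forces [D] to be positive. *)
Lemma schatten_lt p T (D : R) : 1 <= p -> (schatten_norm dot p T < D%:E)%E ->
  0 < D /\ exists2 s, singular_values dot T s &
    forall m, \sum_(0 <= n < m) s n `^ p <= D `^ p.
Proof.
move=> p1; have p0 : 0 < p by apply: lt_le_trans p1.
move=> /ereal_inf_lt[_ [s sT <-]] sD.
have D0 : 0 < D by rewrite -lte_fin; apply: le_lt_trans sD; exact: poweR_ge0.
split=> //; exists s => // m; rewrite -lee_fin -sumEFin.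
apply: (@le_trans _ _ (\sum_(n <oo) (s n `^ p)%:E)%E).
  by apply: nneseries_lim_ge => n _ _; rewrite lee_fin powR_ge0.
have i0 : (0 <= \sum_(n <oo) (s n `^ p)%:E)%E.
  by apply: nneseries_ge0 => n _ _; rewrite lee_fin powR_ge0.
have -> : (\sum_(n <oo) (s n `^ p)%:E =
    ((\sum_(n <oo) (s n `^ p)%:E) `^ p^-1) `^ p)%E.
  by rewrite -poweRrM mulVf ?gt_eqF// poweRe1.
rewrite -poweR_EFin; apply: gt0_ler_poweR; rewrite ?in_itv/= ?leey ?poweR_ge0 ?ltW//.
Qed.

Lemma schattenP p T : 1 <= p -> schatten dot p T ->
  exists D, (schatten_norm dot p T < D%:E)%E.
Proof.
rewrite /schatten/=; move: (schatten_norm _ _ _) => [r|//|] _ h.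
- by exists (r + 1); rewrite lte_fin ltrDl.
- by exists 0; rewrite ltNyr.
Qed.

Lemma singular_values_fin (e f : nat -> V) (c : nat -> R) (n : nat) T :
  orthonormal_seq dot e -> orthonormal_seq dot f ->
  (forall k, 0 <= c k) -> (forall k, (n <= k)%N -> c k = 0) ->
  (forall v, T v = \sum_(k < n) ((c k)%:C * dot v (e k)) *: f k) ->
  singular_values dot T c.
Proof.
move=> oe of_ c0 cn Tv; split=> //; exists e, f; split=> // v.
apply: (@hcvg_near _ _ _ (fun=> T v) _ _ n); last exact: hcvg_cst.
move=> m nm; rewrite Tv -!(big_mkord xpredT (fun k => ((c k)%:C * dot v (e k)) *: f k)).
rewrite [RHS](@big_cat_nat _ _ _ n)//=; apply/eqP.
rewrite eq_sym -subr_eq0 addrAC subrr add0r big_nat_cond big1 // => k.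
by move=> /andP[/andP[nk _] _]; rewrite cn// mul0r scale0r.
Qed.

(** A crude form of Young's inequality: the product is at most the (M+1)-st power of the larger of
    the two numbers. *)
Lemma young_split (b x : R) (M : nat) : 0 <= b -> 0 <= x ->
  b ^+ M * x <= b ^+ M.+1 + x ^+ M.+1.
Proof.
move=> b0 x0; have [xb|bx] := leP x b.
  rewrite (le_trans (ler_wpM2l (exprn_ge0 _ b0) xb))// -exprSr lerDl.
  exact: exprn_ge0.
have : b ^+ M * x <= x ^+ M * x by rewrite ler_wpM2r// lerXn2r// ?nnegrE// ltW.
by rewrite -exprSr => /le_trans->//; rewrite lerDr exprn_ge0.
Qed.

(** Every ratio [s n / D] is at most 1, so raising the exponent from [p] to 2(M+1) only decreases
    its power. *)
Lemma sum_powR_exprn (p D : R) (s : nat -> R) (M m : nat) :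
  1 <= p -> p <= (2 * M.+1)%:R -> 0 < D -> (forall n, 0 <= s n) ->
  (forall m, \sum_(0 <= n < m) s n `^ p <= D `^ p) ->
  \sum_(0 <= n < m) (s n ^+ 2 / D ^+ 2) ^+ M.+1 <= 1.
Proof.
move=> p1 pM D0 s0 sD; have p0 : 0 < p by apply: lt_le_trans p1.
have Dp : 0 < D `^ p by exact: powR_gt0.
apply: (@le_trans _ _ (\sum_(0 <= n < m) s n `^ p / D `^ p)); last first.
  by rewrite -mulr_suml ler_pdivrMr// mul1r.
apply: ler_sum => n _; rewrite -exprVn -exprMn -exprM.
have [sn0|sn0] := eqVneq (s n) 0.
  by rewrite sn0 mul0r expr0n/= divr_ge0 ?powR_ge0.
have sp : 0 < s n by rewrite lt_def sn0 s0.
have -> : s n `^ p / D `^ p = (s n / D) `^ p.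
  rewrite powRM ?invr_ge0 ?ltW//; congr *%R.
  by rewrite -(@powR_inv1 _ D) ?ltW// -powRrM mulN1r powRN.
rewrite -powR_mulrn; last by rewrite divr_ge0 // ltW.
apply: ger_powR => //; rewrite divr_gt0//= ler_pdivrMr// mul1r leNgt.
apply/negP => Ds; have := sD n.+1; rewrite leNgt => /negP; apply.
rewrite big_nat_recr//=; apply: (@lt_le_trans _ _ (s n `^ p)).
  by rewrite gt0_ltr_powR// nnegrE ltW.
by rewrite lerDr sumr_ge0// => i _; rewrite powR_ge0.
Qed.

(* Splitting [b^M y <= D^2 (b^(M+1) + (y / D^2)^(M+1))], with [y] a squared singular
   value, turns the two moment bounds into a bound linear in [D^2]. *)
Lemma schatten_weight p T (D A : R) (M m : nat) (b : nat -> R) (E : nat -> V) :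
  1 <= p -> p <= (2 * M.+1)%:R -> (schatten_norm dot p T < D%:E)%E ->
  (forall k, 0 <= b k) -> (forall m, \sum_(0 <= k < m) b k ^+ M.+1 <= A) ->
  orthonormal_seq dot E ->
  \sum_(0 <= k < m) b k ^+ M * N (T (E k)) ^+ 2 <= D ^+ 2 * (A + 1).
Proof.
move=> p1 pM /(schatten_lt p1)[D0 [s [s0 [e [f [oe of_ Tv]]]] sD]] b0 bA oE.
(* The estimate is proved for the finite-rank truncations of [T], with a bound independent of [L],
   and then passed to the limit. *)
pose TL L v := \sum_(n < L) ((s n)%:C * dot v (e n)) *: f n.
have TLE L v : N (TL L v) ^+ 2 = \sum_(0 <= n < L) s n ^+ 2 * normc (dot v (e n)) ^+ 2.
  rewrite /TL -(big_mkord xpredT (fun n => ((s n)%:C * dot v (e n)) *: f n)).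
  rewrite (@pythagoras _ _ _ _ _ (fun n => (s n)%:C * dot v (e n))) ?iota_uniq//.
  by apply: eq_bigr => n _; rewrite normcM normcR exprMn real_normK ?num_real.
have E1 k : N (E k) = 1 by rewrite /hnorm oE eqxx/= sqrtr1.
have e1 k : N (e k) = 1 by rewrite /hnorm oe eqxx/= sqrtr1.
have TLle L : \sum_(0 <= k < m) b k ^+ M * N (TL L (E k)) ^+ 2 <= D ^+ 2 * (A + 1).
  under eq_bigr do rewrite TLE.
  pose mm k n := normc (dot (E k) (e n)) ^+ 2.
  have mm0 k n : 0 <= mm k n by exact: sqr_ge0.
  apply: (@le_trans _ _ (\sum_(0 <= k < m) \sum_(0 <= n < L)
      D ^+ 2 * (b k ^+ M.+1 * mm k n + (s n ^+ 2 / D ^+ 2) ^+ M.+1 * mm k n))).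
    apply: ler_sum => k _; rewrite mulr_sumr; apply: ler_sum => n _.
    rewrite -mulrDl mulrA mulrA; apply: ler_wpM2r; first exact: mm0.
    rewrite -ler_pdivrMl ?exprn_gt0//.
    have -> : D ^- 2 * (b k ^+ M * s n ^+ 2) = b k ^+ M * (s n ^+ 2 / D ^+ 2) by ring.
    by rewrite young_split// divr_ge0 ?sqr_ge0.
  under eq_bigr => k _ do rewrite -mulr_sumr big_split/= -mulr_sumr.
  (* Bessel's inequality is used in both directions: the numbers [mm k n] have sum at most 1 over
     [n] for fixed [k], and over [k] for fixed [n]. *)
  rewrite -mulr_sumr ler_wpM2l ?sqr_ge0// big_split/= lerD//.
    apply: le_trans (bA m); apply: ler_sum => k _.
    rewrite ler_piMr ?exprn_ge0//; have := @bessel _ _ dot _ (index_iota 0 L) e (E k).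
    by rewrite E1 expr1n; apply => //; exact: iota_uniq.
  rewrite exchange_big/=; apply: le_trans (sum_powR_exprn L p1 pM D0 s0 sD).
  apply: ler_sum => n _; rewrite -mulr_sumr ler_piMr//.
    by rewrite exprn_ge0// divr_ge0 ?sqr_ge0.
  have := @bessel _ _ dot _ (index_iota 0 m) E (e n).
  rewrite e1 expr1n /mm => h; under eq_bigr do rewrite dotC normc_conj.
  by apply: h => //; exact: iota_uniq.
have cv : (fun L => \sum_(0 <= k < m) b k ^+ M * N (TL L (E k)) ^+ 2) @ \oo -->
    \sum_(0 <= k < m) b k ^+ M * N (T (E k)) ^+ 2.
  apply: cvg_nat_sum => k; apply: cvgMr.
  have h := hcvg_norm (Tv (E k)).
  by rewrite expr2; under eq_fun do rewrite expr2; exact: cvgM.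
rewrite -(cvg_lim (@Rhausdorff R) cv); apply: limr_le.
  by apply/cvg_ex; eexists; exact: cv.
exact: nearW.
Qed.

End Schatten.

(** * Diagonal unitaries and complex reflections *)

Lemma conjc_conjB1 (R : realType) (w : R[i]) : conjc (conjc w - 1) = w - 1.
Proof. by case: w => a b; simpc. Qed.

Section Diagonal.
Variables (R : realType) (V : lmodType R[i]) (dot : {dot V for Num.conj}).
Local Notation C := R[i].
Local Notation N := (hnorm dot).

Definition orthonormal_fam n (u : 'I_n -> V) := forall i j, dot (u i) (u j) = (i == j)%:R.

(** For orthonormal [u] this multiplies [u i] by [z i] and is the identity on the orthogonal
    complement; for [n = 1] it is a complex reflection. *)
Definition diagop n (u : 'I_n -> V) (z : 'I_n -> C) (v : V) : V :=
  v + \sum_i ((z i - 1) * dot v (u i)) *: u i.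

Section Fam.
Variables (n : nat) (u : 'I_n -> V).
Hypothesis ou : orthonormal_fam u.

Lemma dot_fam_sum (c : 'I_n -> C) j : dot (\sum_i c i *: u i) (u j) = c j.
Proof.
rewrite linear_sumlz/= (bigD1 j)//= big1 ?addr0 => [|i ij].
  by rewrite dotZl ou eqxx mulr1.
by rewrite dotZl ou (negPf ij) mulr0.
Qed.

Lemma dot_diagop z v j : dot (diagop u z v) (u j) = z j * dot v (u j).
Proof. by rewrite /diagop linearDl/= dot_fam_sum; ring. Qed.

Lemma diagop_fam z j : diagop u z (u j) = z j *: u j.
Proof.
rewrite /diagop (bigD1 j)//= big1 ?addr0 => [|i ij].
  by rewrite ou eqxx mulr1 scalerBl scale1r addrC subrK.
by rewrite ou eq_sym (negPf ij) mulr0 scale0r.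
Qed.

Lemma diagop_orth z v : (forall j, dot v (u j) = 0) -> diagop u z v = v.
Proof. by move=> vu; rewrite /diagop big1 ?addr0// => i _; rewrite vu mulr0 scale0r. Qed.

Lemma diagopM z z' v : diagop u z (diagop u z' v) = diagop u (fun i => z i * z' i) v.
Proof.
rewrite [LHS]/diagop /diagop -addrA -big_split/=; congr (_ + _).
apply: eq_bigr => i _; rewrite -/(diagop u z' v) dot_diagop -scalerDl.
by congr (_ *: _); ring.
Qed.

Lemma diagop1 v : diagop u (fun=> 1) v = v.
Proof. by rewrite /diagop big1 ?addr0// => i _; rewrite subrr mul0r scale0r. Qed.

Lemma diagop_lin z : linear (diagop u z).
Proof.
move=> a v w; rewrite /diagop scalerDr scaler_sumr addrACA -big_split/=.
congr (_ + _); apply: eq_bigr => i _.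
by rewrite scalerA -scalerDl linearPl/=; congr (_ *: _); ring.
Qed.

Lemma diagop_adj z v w : dot (diagop u z v) w = dot v (diagop u (fun i => conjc (z i)) w).
Proof.
rewrite /diagop linearDl/= linearDr/= linear_sumlz/= linear_sumr/=; congr (_ + _).
apply: eq_bigr => i _; rewrite dotZl dotZr (dotC _ w) rmorphM/= conjcK.
by rewrite conjc_conjB1; ring.
Qed.

Lemma diagop_unitary z : (forall i, normc (z i) = 1) -> unitary dot (diagop u z).
Proof.
move=> z1; have zJ i : z i * conjc (z i) = 1 by rewrite mulJc z1 expr1n.
split; [exact: diagop_lin| |].
  move=> v w; rewrite diagop_adj diagopM.
  by under [X in diagop _ X]eq_fun do rewrite mulrC zJ; rewrite diagop1.
move=> w; exists (diagop u (fun i => conjc (z i)) w).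
by rewrite diagopM; under [X in diagop _ X]eq_fun do rewrite zJ; rewrite diagop1.
Qed.

End Fam.

Lemma fam1P (a : V) : a != 0 -> orthonormal_fam (fun _ : 'I_1 => ((N a)^-1)%:C *: a).
Proof.
move=> a0 i j; rewrite !ord1 eqxx dotZl dotZr conjc_real dotvv -!rmorphM/=.
have n0 : N a != 0 by rewrite hnorm_eq0.
by congr (_%:C); field.
Qed.

(** A complex reflection along a = x - y. As <x, y> need not be real, the eigenvalue -1 does not
    suffice: with w = <x, a> one has |a|^2 = w + conj w, and the phase z = - conj w / w is the one
    with (z - 1) w = - |a|^2, which sends x to x - a = y. *)
Lemma householder (x y : V) : N x = N y -> exists S,
  [/\ unitary dot S, S x = y & forall v, dot v x = 0 -> dot v y = 0 -> S v = v].
Proof.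
move=> nxy; have [<-|xy] := eqVneq x y; first by exists id; split=> //; exact: unitary_id.
have a0 : x - y != 0 by rewrite subr_eq0.
set a := x - y in a0; set w := dot x a.
have na : N a ^+ 2 = 2 * Re w.
  have := sqr_hnormB dot x a; rewrite /a opprB addrC subrK -/a -/w nxy; lra.
have naC : (N a ^+ 2)%:C = w + conjc w.
  by rewrite na /w; case: (dot x a) => p q; simpc; congr (_ +i* _) => /=; ring.
have n0 : N a != 0 by rewrite hnorm_eq0.
have w0 : w != 0.
  apply: contra n0 => /eqP w0; move: na; rewrite w0/= mulr0.
  by move=> /eqP; rewrite sqrf_eq0.
pose u := fun _ : 'I_1 => ((N a)^-1)%:C *: a; have ou := fam1P a0; rewrite -/u in ou.
pose z := fun _ : 'I_1 => - conjc w / w.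
have z1 i : normc (z i) = 1.
  by rewrite normcM normcN normc_conj normcV divff// normc_eq0.
exists (diagop u z); split.
- exact: diagop_unitary.
- rewrite /diagop big_ord1 /u dotZr conjc_real -/w scalerA.
  set c := (X in X *: a); suff -> : c = -1 by rewrite scaleN1r /a opprB addrC subrK.
  have E : ((N a)^-1)%:C * ((N a)^-1)%:C = (w + conjc w)^-1.
    by rewrite -naC -rmorphM/= -fmorphV/=; congr (_%:C); field.
  have s0 : w + conjc w != 0 by rewrite -naC fmorph_eq0 sqrf_eq0.
  have key (y' t : C) : y' != 0 ->
      (- conjc y' / y' - 1) * (t * y') * t = - (y' + conjc y') * (t * t).
    by move=> ?; field.
  by rewrite /c /z key// E mulNr divff.
- by move=> v vx vy; apply: diagop_orth => j; rewrite dotZr linearBr/= vx vy subrr mulr0.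
Qed.

End Diagonal.

(** * Diagonal unitaries as elements of the Schatten unitary group *)

Section UpMembers.
Variables (R : realType).
Local Notation C := R[i].
Local Notation H := (l2 R nat).
Local Notation dot := (@l2_dot R nat : {dot H for Num.conj}).
Local Notation N := (hnorm dot).

(** In the induction step a Householder map moves the image of the next basis vector to [u n]; it
    fixes the earlier [u i], which are orthogonal to both vectors. *)
Lemma unitary_extend n (u : nat -> H) :
  (forall i j, (i < n)%N -> (j < n)%N -> dot (u i) (u j) = (i == j)%:R) ->
  exists2 W, unitary dot W & forall i, (i < n)%N -> W (delta R i) = u i.
Proof.
elim: n => [|n ih] ou; first by exists id => //; exact: unitary_id.
have [|W uW Wu] := ih; first by move=> i j hi hj; apply: ou; exact: ltnW.
have [|S [uS Sx Sv]] := @householder _ _ dot (W (delta R n)) (u n).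
  by rewrite unitary_norm// norm_delta /hnorm ou// eqxx/= sqrtr1.
exists (S \o W); first exact: unitary_comp.
move=> i; rewrite ltnS leq_eqVlt => /orP[/eqP->//|hi]; rewrite /= Wu// Sv//.
  by rewrite -Wu// unitary_dot// delta_on ltn_eqF.
by rewrite ou ?ltn_eqF//; exact: ltnW.
Qed.

(** Singular value expansions are indexed by infinite orthonormal sequences, so finite families have
    to be completed. *)
Lemma orthonormal_extend n (u : 'I_n -> H) : orthonormal_fam dot u ->
  exists2 e, orthonormal_seq dot e & forall i : 'I_n, e i = u i.
Proof.
move=> ou; pose v k := if insub k is Some i then u i else 0.
have vE (i : 'I_n) : v i = u i by rewrite /v insubT// => hi; congr u; apply: val_inj.
have [|W uW We] := @unitary_extend n v.
  by move=> i j hi hj; rewrite (vE (Ordinal hi)) (vE (Ordinal hj)) ou.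
exists (fun k => W (delta R k)); first by move=> i j; rewrite unitary_dot// delta_on.
by move=> i; rewrite We ?vE.
Qed.

(** The singular values are the moduli of the [c i]; their phases are absorbed in the second
    orthonormal sequence. The factor [n] is a crude bound for n^(1/p). *)
Lemma schatten_fam (p : R) n (u : 'I_n -> H) (c : 'I_n -> C) (B : R) T :
  1 <= p -> orthonormal_fam dot u -> 0 <= B -> (forall i, normc (c i) <= B) ->
  (forall v, T v = \sum_i (c i * dot v (u i)) *: u i) ->
  (schatten_norm dot p T <= (n%:R * B)%:E)%E.
Proof.
move=> p1 ou B0 cB TE; have p0 : 0 < p by apply: lt_le_trans p1.
have [e oe eu] := orthonormal_extend ou.
pose d k := if insub k is Some i then c i else 0.
have dE (i : 'I_n) : d i = c i by rewrite /d insubT// => hi; congr c; apply: val_inj.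
have d0 k : (n <= k)%N -> d k = 0 by move=> nk; rewrite /d insubF// ltnNge nk.
have dB k : normc (d k) <= B.
  by rewrite /d; case: insubP => [i _ _//|_]; rewrite normc0.
(* Where [d k] vanishes the phase is set to 1, so that [f] stays orthonormal. *)
pose f k := (if d k == 0 then 1 else d k / (normc (d k))%:C) *: e k.
have fJ k : normc (if d k == 0 then 1 else d k / (normc (d k))%:C) = 1.
  case: ifPn => [|dk]; rewrite ?normc1// normcM normcV normcR ger0_norm ?normc_ge0//.
  by rewrite divff// normc_eq0.
apply: (@schatten_norm_le _ _ _ _ _ (fun k => normc (d k))) => //.
- by rewrite mulr_ge0.
- apply: (@singular_values_fin _ _ _ e f _ n) => //.
  + move=> i j; rewrite /f dotZl dotZr oe; have [->|ij] := eqVneq i j.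
      by rewrite mulr1 mulJc fJ expr1n.
    by rewrite !mulr0.
  + by move=> k; exact: normc_ge0.
  + by move=> k /d0 ->; rewrite normc0.
  + move=> v; rewrite TE; apply: eq_bigr => i _.
    rewrite /f scalerA -eu -dE; congr (_ *: _).
    have [->|dk] := eqVneq (d i) 0; first by rewrite normc0 !mul0r.
    have nn0 : (normc (d i))%:C != 0 :> C by rewrite fmorph_eq0 normc_eq0.
    have key (x y t : C) : t != 0 -> x * y = t * y * (x / t) by move=> ?; field.
    exact: key.
- move=> m; apply: (@le_trans _ _ (\sum_(0 <= k < n) B `^ p)).
    have h k : normc (d k) `^ p <= B `^ p.
      by apply: ge0_ler_powR (dB k); rewrite ?nnegrE ?normc_ge0// ltW.
    have z k : (n <= k)%N -> normc (d k) `^ p = 0.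
      by move=> /d0 ->; rewrite normc0 powR0// gt_eqF.
    have [mn|/ltnW nm] := leqP m n.
      rewrite [leRHS](@big_cat_nat _ _ _ m)//= -[leLHS]addr0 lerD ?ler_sum//.
      by apply: sumr_ge0 => k _; exact: powR_ge0.
    rewrite (@big_cat_nat _ _ _ n)//= [X in _ + X]big_nat_cond.
    rewrite [X in _ + X]big1 ?addr0 ?ler_sum// => k /andP[/andP[nk _] _].
    exact: z.
  rewrite sumr_const_nat subn0 powRM// -[leLHS]mulr_natl ler_wpM2r ?powR_ge0//.
  (* The inequality n <= n^p needs n >= 1; for n = 0 the left-hand side is zero. *)
  case: n {u c ou cB TE e oe eu d dE d0 dB f fJ} => [|n]; first exact: powR_ge0.
  by rewrite le1r_powR// ler1n.
Qed.

Lemma diagop_Up (p : R) n (u : 'I_n -> H) (z : 'I_n -> C) :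
  1 <= p -> orthonormal_fam dot u -> (forall i, normc (z i) = 1) ->
  Up dot p (diagop dot u z).
Proof.
move=> p1 ou z1; split; first exact: diagop_unitary.
rewrite /schatten/=; apply: le_lt_trans (ltry _).
apply: (@schatten_fam p n u (fun i => z i - 1) 2) => //.
  by move=> i; rewrite (le_trans (le_normcD _ _))// normcN z1 normc1.
by move=> v; rewrite /diagop addrAC subrr add0r.
Qed.

Lemma Up_dist_diagop (p : R) n (u : 'I_n -> H) (z : 'I_n -> C) (B : R) :
  1 <= p -> orthonormal_fam dot u -> 0 <= B -> (forall i, normc (z i - 1) <= B) ->
  (Up_dist dot p id (diagop dot u z) <= (n%:R * B)%:E)%E.
Proof.
move=> p1 ou B0 zB; apply: (@schatten_fam p n u (fun i => 1 - z i)) => //.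
  by move=> i; rewrite normcB.
move=> v; rewrite /diagop opprD addrA subrr sub0r -sumrN; apply: eq_bigr => i _.
by rewrite -scaleNr -mulNr opprB.
Qed.

Lemma Up_id (p : R) : 1 <= p -> Up dot p id.
Proof.
move=> p1; have ou : orthonormal_fam dot (fun _ : 'I_0 => 0 : H) by case.
have := @diagop_Up p 0 _ (fun=> 1) p1 ou; have -> : diagop dot (fun _ : 'I_0 => 0) (fun=> 1) = id.
  by apply/funext => v; exact: diagop1.
by apply; case.
Qed.

End UpMembers.

(** * Continuous homomorphisms on the Schatten unitary group *)

Lemma tail_small (R : realType) (a : nat -> R) (B e : R) : (forall n, 0 <= a n) ->
  (forall m, \sum_(0 <= n < m) a n <= B) -> 0 < e ->
  exists L, forall m, \sum_(L <= n < m) a n < e.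
Proof.
move=> a0 aB e0; pose S := [set \sum_(0 <= n < m) a n | m in [set: nat]].
have hS : has_sup S.
  by split; [exists (\sum_(0 <= n < 0) a n); exists 0%N|exists B => _ [m _ <-]].
have [_ [L _ <-] hL] := sup_adherent e0 hS.
exists L => m; have [Lm|mL] := leqP L m; last by rewrite big_geq// ltnW.
have : \sum_(0 <= n < m) a n <= sup S by apply: sup_upper_bound => //; exists m.
by rewrite (@big_cat_nat _ _ _ L)//=; move: hL; rewrite ltrBlDr; lra.
Qed.

(** Of the two square roots take one with nonnegative real part: then |w + 1|^2 = 2 + 2 Re w >= 2,
    and z - 1 = (w - 1)(w + 1). *)
Lemma unit_sqrt (R : realType) (z : R[i]) : normc z = 1 ->
  exists w, [/\ normc w = 1, w ^+ 2 = z & 2 * normc (w - 1) ^+ 2 <= normc (z - 1) ^+ 2].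
Proof.
move=> z1; wlog [w [w1 wz w0]] : / exists w, [/\ normc w = 1, w ^+ 2 = z & 0 <= Re w].
  apply; have s1 : normc (sqrtc z) = 1.
    apply/eqP; rewrite -(@eqrXn2 _ 2)// ?normc_ge0//.
    by rewrite -normcX sqr_sqrtc z1 expr1n.
  have [h|h] := leP 0 (Re (sqrtc z)).
    by exists (sqrtc z); split=> //; exact: sqr_sqrtc.
  exists (- sqrtc z); rewrite normcN sqrrN ReN; split=> //; first exact: sqr_sqrtc.
  by rewrite oppr_ge0 ltW.
exists w; split=> //; rewrite -wz.
have -> : w ^+ 2 - 1 = (w - 1) * (w + 1) by ring.
rewrite normcM exprMn.
rewrite mulrC ler_wpM2l ?sqr_ge0//.
move: w1 w0; move/(congr1 (fun t => t ^+ 2)); rewrite !Defs.sqr_normc expr1n.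
case: w {wz} => a b /=; rewrite addr0 => w1 w0; nra.
Qed.

Lemma div_exp2_small (R : realType) (c e : R) : 0 < e -> exists j, c / 2 ^+ j <= e.
Proof.
move=> e0; exists (Num.bound (c / e)).
rewrite ler_pdivrMr ?exprn_gt0// mulrC -ler_pdivrMr//.
exact/ltW/upper_nthrootP.
Qed.

Lemma normc_nat (R : realType) m : normc (m%:R : R[i]) = m%:R.
Proof. by rewrite -(rmorph_nat (real_complex R)) normcR ger0_norm. Qed.

Lemma hnormMn (R : realType) (V : lmodType R[i]) (dot : {dot V for Num.conj}) v m :
  hnorm dot (v *+ m) = m%:R * hnorm dot v.
Proof.
by rewrite -scaler_nat hnormZ normc_nat.
Qed.

Section Homs.
Variables (R : realType) (p : R).
Local Notation C := R[i].
Local Notation H := (l2 R nat).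
Local Notation dot := (@l2_dot R nat : {dot H for Num.conj}).
Local Notation N := (hnorm dot).
Local Notation G := (Up dot p).
Variables (K : lmodType C) (dotK : {dot K for Num.conj}) (b : (H -> H) -> K).
Hypothesis p1 : 1 <= p.
Hypothesis bM : forall g h, G g -> G h -> b (g \o h) = b g + b h.
Hypothesis bC : forall g, G g -> forall e : R, 0 < e -> exists2 d : R, 0 < d &
  forall h, G h -> (Up_dist dot p g h < d%:E)%E -> hnorm dotK (b g - b h) < e.

Lemma hom_id : b id = 0.
Proof.
have := bM (Up_id p1) (Up_id p1); have -> : (id \o id : H -> H) = id by [].
by move=> /eqP; rewrite -subr_eq0 opprD addNKr oppr_eq0 => /eqP.
Qed.

Section Torus.
Variables (n : nat) (u : 'I_n -> H).
Hypothesis ou : orthonormal_fam dot u.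
Let chi (z : 'I_n -> C) : K := b (diagop dot u z).
Let T (z : 'I_n -> C) := forall i, normc (z i) = 1.

Let chiM z z' : T z -> T z' -> chi (fun i => z i * z' i) = chi z + chi z'.
Proof.
move=> Tz Tz'; rewrite /chi -bM; [|exact: diagop_Up..]; congr b.
by apply/funext => v; rewrite /= diagopM.
Qed.

Let chiX m z : T z -> chi (fun i => z i ^+ m) = chi z *+ m.
Proof.
move=> Tz; elim: m => [|m ih].
  rewrite /chi mulr0n; have -> : diagop dot u (fun i => z i ^+ 0) = id.
    by apply/funext => v; exact: diagop1.
  exact: hom_id.
rewrite mulrS -ih -chiM// => [|i]; last by rewrite normcX Tz expr1n.
by congr chi; apply/funext => i; rewrite exprS.
Qed.

(** Each square root at least halves the squared distances to 1, which are at most 4 at the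
    start. *)
Let chi_root j z : T z -> exists w, [/\ T w, chi z = chi w *+ 2 ^ j &
  forall i, normc (w i - 1) ^+ 2 <= 4 / 2 ^+ j].
Proof.
move=> Tz; elim: j => [|j [w [Tw zw wj]]].
  exists z; split=> // i; rewrite expr0 divr1.
  have : normc (z i - 1) <= 2.
    by rewrite (le_trans (le_normcD _ _))// normcN normc1 Tz.
  by have := normc_ge0 (z i - 1); nra.
have /choice[w' hw'] i := unit_sqrt (Tw i).
exists w'; split=> [i||i]; first by case: (hw' i).
  rewrite zw; have -> : chi w = chi w' *+ 2.
    rewrite -chiX => [|i]; last by case: (hw' i).
    by congr chi; apply/funext => i; case: (hw' i).
  by rewrite -mulrnA expnS.
have [_ _ h] := hw' i; have := le_trans h (wj i).
by rewrite [2 ^+ j.+1]exprS invfM; lra.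
Qed.

Lemma hom_diagop (z : 'I_n -> C) : (forall i, normc (z i) = 1) -> b (diagop dot u z) = 0.
Proof.
have [d d0 hd] := bC (Up_id p1) ltr01.
have n1 : 0 < n%:R + 1 :> R by rewrite ltr_wpDl.
(* Since [n * eta < d], torus elements with all entries within [eta] of 1 are [d]-close to the
   identity; the [+ 1] covers n = 0. The number [j] chosen next does not depend on [z], so the bound
   [bnd] is uniform on the torus. *)
pose eta := d / 2 / (n%:R + 1); have e0 : 0 < eta by rewrite !divr_gt0.
have [j hj] := div_exp2_small 4 (exprn_gt0 2 e0).
have bnd w : T w -> hnorm dotK (chi w) <= 2 ^+ j.
  move=> /(chi_root j)[v [Tv -> vj]].
  rewrite hnormMn natrX ler_piMr ?exprn_ge0//.
  have ve i : normc (v i - 1) <= eta.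
    rewrite -(@ler_pXn2r _ 2)// ?nnegrE ?normc_ge0 ?(ltW e0)//.
    exact: le_trans (vj i) hj.
  apply/ltW; rewrite -[chi v]opprK hnormN -[- chi v]add0r -hom_id; apply: hd.
    exact: diagop_Up.
  apply: le_lt_trans (Up_dist_diagop p1 ou (ltW e0) ve) _.
  rewrite lte_fin /eta; apply: (@le_lt_trans _ _ (d / 2)); last by lra.
  by rewrite mulrCA ler_piMr ?divr_ge0 ?ltW// ltr_pdivrMr// mul1r ltrDl.
move=> Tz; apply/eqP; rewrite -(hnorm_eq0 dotK) -/(chi z) eq_le hnorm_ge0 andbT.
rewrite leNgt; apply/negP => c0.
(* If [chi z] were nonzero, its [m]-fold multiple [chi (z^m)] would exceed the uniform bound. *)
have [m hm] : exists m, 2 ^+ j / hnorm dotK (chi z) < m%:R.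
  by eexists; exact: truncnS_gt.
have := bnd (fun i => z i ^+ m); rewrite chiX// hnormMn.
have Tm : T (fun i => z i ^+ m) by move=> i; rewrite normcX Tz expr1n.
move=> /(_ Tm); rewrite leNgt => /negP; apply.
by rewrite -ltr_pdivrMr.
Qed.

End Torus.
End Homs.

(** * Approximation by unitaries that are diagonal on a finite family *)

Section Approx.
Variables (R : realType) (V : lmodType R[i]) (dot : {dot V for Num.conj}).
Local Notation C := R[i].
Local Notation N := (hnorm dot).
Local Open Scope sesquilinear_scope.

(** On the invariant span of [e] the matrix of [g] is unitary, hence normal, and the spectral
    theorem diagonalizes it. The rows of [P] are the coordinates of the eigenvectors, as [M] acts on
    row vectors. *)
Lemma unitary_eigenbasis n (g : V -> V) (e : 'I_n -> V) :
  unitary dot g -> orthonormal_fam dot e ->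
  (forall i, g (e i) = \sum_j dot (g (e i)) (e j) *: e j) ->
  exists (u : 'I_n -> V) (z : 'I_n -> C) (P : 'M[C]_n), [/\ orthonormal_fam dot u,
    forall i, normc (z i) = 1, forall i, g (u i) = z i *: u i,
    forall i, u i = \sum_j P i j *: e j & forall j, e j = \sum_i conjc (P i j) *: u i].
Proof.
move=> ug oe ge; pose M : 'M[C]_n := \matrix_(i, j) dot (g (e i)) (e j).
have MM : M *m M ^t* = 1%:M.
  apply/matrixP => i k; rewrite !mxE -oe -(unitary_dot ug) (ge i) (ge k).
  rewrite linear_sumlz/=; apply: eq_bigr => j _; rewrite !mxE dotZl; congr (_ * _).
  by rewrite [RHS]dotC dot_fam_sum.
have nM : M \is normalmx by apply/normalmxP; rewrite MM (mulmx1C MM).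
set P := spectralmx M; set sp := spectral_diag M.
have PP : P *m P ^t* = 1%:M by apply/unitarymxP; exact: spectral_unitarymx.
have PM : P *m M = diag_mx sp *m P.
  have /orthomx_spectralP -> := nM; rewrite -/P -/sp !mulmxA mulmxV ?mul1mx//.
  exact: spectral_unit.
pose u i := \sum_j P i j *: e j; pose z i := sp 0 i.
have ou : orthonormal_fam dot u.
  move=> i k; rewrite /u linear_sumr/=.
  under eq_bigr => j _ do rewrite dotZr (dot_fam_sum oe).
  have := congr1 (fun A : 'M[C]_n => A i k) PP; rewrite !mxE => <-.
  by apply: eq_bigr => j _; rewrite !mxE mulrC.
have gu i : g (u i) = z i *: u i.
  rewrite /u (linear_bigsum (unitary_lin ug)).
  under eq_bigr => j _ do rewrite (linear_Z (unitary_lin ug)) ge scaler_sumr.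
  rewrite exchange_big/= scaler_sumr; apply: eq_bigr => k _.
  under eq_bigr => j _ do rewrite scalerA.
  rewrite -scaler_suml scalerA; congr (_ *: _).
  have := congr1 (fun A : 'M[C]_n => A i k) PM; rewrite mul_diag_mx !mxE => <-.
  by apply: eq_bigr => j _; rewrite !mxE.
have u1 i : N (u i) = 1 by rewrite /hnorm ou eqxx/= sqrtr1.
exists u, z, P; split=> // [i|j].
  by have := unitary_norm (u i) ug; rewrite gu hnormZ u1 mulr1.
rewrite /u; under eq_bigr => i _ do rewrite scaler_sumr.
rewrite exchange_big/= (bigD1 j)//= [X in _ + X]big1 ?addr0 => [|k kj].
  under eq_bigr => i _ do rewrite scalerA.
  rewrite -scaler_suml.
  have := congr1 (fun A : 'M[C]_n => A j j) (mulmx1C PP); rewrite !mxE eqxx mulr1n => h.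
  rewrite -[LHS]scale1r; congr (_ *: _); apply/esym; apply: etrans h.
  by apply: eq_bigr => i _; rewrite !mxE.
under eq_bigr => i _ do rewrite scalerA.
rewrite -scaler_suml.
have := congr1 (fun A : 'M[C]_n => A j k) (mulmx1C PP); rewrite !mxE eq_sym (negPf kj) mulr0n => h.
rewrite -[RHS](scale0r (e k)); congr (_ *: _); apply: etrans h.
  by apply: eq_bigr => i _; rewrite !mxE.
Qed.

Section SingularExpansion.
Variables (g : V -> V) (s : nat -> R) (e f : nat -> V).
Hypotheses (ug : unitary dot g) (s0 : forall n, 0 <= s n).
Hypotheses (oe : orthonormal_seq dot e) (of_ : orthonormal_seq dot f).
Hypothesis Tv : forall v,
  hcvg dot (fun m => \sum_(n < m) ((s n)%:C * dot v (e n)) *: f n) (g v - v).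
(** [S'] is the adjoint of [S], because the inverse of the unitary [g] is its adjoint. The two
    commute: [S] is normal. *)
Let S v := g v - v.
Let S' v := op_inv g v - v.

Let linS : linear S.
Proof. by move=> a v w; rewrite /S (unitary_lin ug) scalerBr opprD addrACA. Qed.

Let linS' : linear S'.
Proof.
by move=> a v w; rewrite /S' (unitary_lin (unitary_inv ug)) scalerBr opprD addrACA.
Qed.

Let Se n : S (e n) = (s n)%:C *: f n.
Proof.
apply: hcvg_unique (Tv (e n)) _; apply: (@hcvg_near _ _ _ (fun=> (s n)%:C *: f n) _ _ n.+1); last exact: hcvg_cst.
move=> m nm; rewrite (bigD1 (Ordinal nm))//= oe eqxx mulr1 big1 ?addr0// => i.
by rewrite -val_eqE/= => /negPf ni; rewrite oe eq_sym ni mulr0 scale0r.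
Qed.

Let Sf v n : dot (S v) (f n) = (s n)%:C * dot v (e n).
Proof.
apply: (@hcvg_dot_eq _ _ _ _ _ _ _ n.+1 (Tv v)) => m nm.
rewrite linear_sumlz/= (bigD1 (Ordinal nm))//= dotZl of_ eqxx mulr1 big1 ?addr0// => i.
by rewrite -val_eqE/= => /negPf ni; rewrite dotZl of_ ni mulr0.
Qed.

Let Sadj v w : dot (S v) w = dot v (S' w).
Proof.
by rewrite /S /S' linearBl/= linearBr/= -{1}(op_invK ug w) (unitary_dot ug).
Qed.

Let Sadj' v w : dot (S' v) w = dot v (S w).
Proof. by rewrite dotC -Sadj -dotC. Qed.

Let S'f n : S' (f n) = (s n)%:C *: e n.
Proof.
apply: (@dot_ext _ _ dot) => w; rewrite [LHS]dotC -Sadj Sf [RHS]dotZl [LHS]rmorphM.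
by congr (_ * _); [exact: conjc_real|rewrite [RHS]dotC].
Qed.

Let SS' w : S (S' w) = S' (S w).
Proof.
rewrite /S /S' (linear_B (unitary_lin ug)) (linear_B (unitary_lin (unitary_inv ug))).
by rewrite (op_invK ug) (op_invKV ug) !opprB addrC.
Qed.

(** Both vectors are eigenvectors of the self-adjoint operator S S' = S' S, [f n] for [s n ^+ 2] and
    [e m] for [s m ^+ 2]. *)
Let orth n m : s n != s m -> dot (f n) (e m) = 0.
Proof.
move=> nm; apply/eqP; have : (s n ^+ 2)%:C * dot (f n) (e m) = (s m ^+ 2)%:C * dot (f n) (e m).
  have h1 : dot (S (S' (f n))) (e m) = (s n ^+ 2)%:C * dot (f n) (e m).
    by rewrite S'f (linear_Z linS) Se scalerA dotZl expr2 rmorphM.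
  have h2 : dot (S (S' (f n))) (e m) = (s m ^+ 2)%:C * dot (f n) (e m).
    rewrite Sadj Sadj' SS' Se (linear_Z linS') S'f scalerA dotZr -rmorphM/=.
    by rewrite expr2; simpc.
  by rewrite -h1 h2.
move=> /eqP; rewrite -subr_eq0 -mulrBl -rmorphB/= mulf_eq0 fmorph_eq0 subr_eq0.
by rewrite eqrXn2// (negPf nm).
Qed.

Let Sq0 q : (forall m, s m * normc (dot q (e m)) = 0) -> S q = 0.
Proof.
move=> h; apply: hcvg_unique (Tv q) _.
apply: (@hcvg_near _ _ _ (fun=> 0) _ _ 0); last exact: hcvg_cst.
move=> m _; rewrite big1// => i _; have /eqP := h i.
by rewrite mulf_eq0 normc_eq0 => /orP[/eqP->|/eqP->]; rewrite ?mulr0 ?mul0r scale0r.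
Qed.

Variable t : R.
Hypothesis t0 : 0 < t.

Section Level.
Variables (n : nat) (a : 'I_n -> nat).
Hypothesis a_inj : injective a.
Hypothesis aP : forall k, reflect (exists i, a i = k) (t <= s k).
Let e' i := e (a i).

Let oe' : orthonormal_fam dot e'.
Proof. by move=> i j; rewrite /e' oe (inj_eq a_inj). Qed.

(** Let [q] be the part of [f k] orthogonal to all [e']. It is orthogonal to the [e m] of level at
    least [t] by construction and to the others by [orth], so S q = 0 and then S' q = 0. Hence [q]
    is orthogonal to the range of [S], which contains [f k], and so to itself. *)
Let f_span k : t <= s k -> f k = \sum_j dot (f k) (e' j) *: e' j.
Proof.
move=> tk; have sk : 0 < s k by apply: lt_le_trans tk.
apply/eqP; rewrite -subr_eq0; set q := _ - _.
have qe' i : dot q (e' i) = 0 by rewrite /q linearBl/= (dot_fam_sum oe') subrr.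
have qe m : s m * normc (dot q (e m)) = 0.
  have [tm|tm] := boolP (t <= s m).
    by have [i <-] := aP _ tm; rewrite -/(e' i) qe' normc0 mulr0.
  rewrite /q linearBl/= orth; last by apply: contra tm => /eqP <-.
  rewrite linear_sumlz/= big1 ?subr0 ?normc0 ?mulr0// => j _.
  rewrite dotZl oe; have [E|] := eqVneq (a j) m; last by rewrite mulr0.
  by move: tm; rewrite -E; have -> : t <= s (a j) by apply/aP; exists j.
have S'q : S' q = 0.
  have : g (S' q) = 0.
    by rewrite /S' (linear_B (unitary_lin ug)) (op_invK ug) -opprB -/(S q) Sq0// oppr0.
  by move=> h; apply: (unitary_inj ug); rewrite h (linear_0 (unitary_lin ug)).
have fq : dot (f k) q = 0.
  apply/eqP; have := Sadj (e k) q; rewrite S'q linear0r Se dotZl => /eqP.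
  by rewrite mulf_eq0 fmorph_eq0 gt_eqF.
rewrite -(dnorm_eq0 dot) {1}/q linearBl/= fq linear_sumlz/= big1 ?subrr// => j _.
by rewrite dotZl (dotC dot (e' j) q) qe' conjc0 mulr0.
Qed.

(** The span of the [e'] is invariant, as g e_k = e_k + s_k f_k and [f_span] applies. The diagonal
    operator is chosen to agree with [g] there and is the identity on the complement, so the
    difference has the expansion of [g - 1] with the levels from [t] upwards deleted. *)
Lemma level_diag : exists (u : 'I_n -> V) (z : 'I_n -> C),
  [/\ orthonormal_fam dot u, forall i, normc (z i) = 1 &
   singular_values dot (fun v => g v - diagop dot u z v)
     (fun k => if t <= s k then 0 else s k)].
Proof.
have gE i : g (e' i) = \sum_j dot (g (e' i)) (e' j) *: e' j.
  have E : g (e' i) = e' i + (s (a i))%:C *: f (a i) by rewrite -Se /S addrC subrK.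
  rewrite {1}E (f_span (k := a i)); last by apply/aP; exists i.
  under [RHS]eq_bigr => j _ do rewrite E linearDl/= dotZl scalerDl oe' -scalerA.
  rewrite big_split/= -scaler_sumr; congr (_ + _).
  rewrite (bigD1 i)//= eqxx scale1r big1 ?addr0// => j ji.
  by rewrite eq_sym (negPf ji) scale0r.
have [u [z [P [ou z1 gu uP eP]]]] := unitary_eigenbasis ug oe' gE.
exists u, z; split=> //; split; first by move=> k; case: ifP.
exists e, f; split=> // v.
(* Only the component [v2] orthogonal to the eigenvectors contributes to the difference. *)
pose v1 := \sum_i dot v (u i) *: u i; pose v2 := v - v1.
have v2u i : dot v2 (u i) = 0 by rewrite /v2 linearBl/= (dot_fam_sum ou) subrr.
have v2e k : t <= s k -> dot v2 (e k) = 0.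
  move=> /aP[j <-]; rewrite -/(e' j) eP linear_sumr/= big1// => i _.
  by rewrite dotZr v2u mulr0.
have v2E k : ~~ (t <= s k) -> dot v2 (e k) = dot v (e k).
  move=> tk; rewrite /v2 linearBl/= linear_sumlz/= big1 ?subr0// => i _.
  rewrite dotZl [X in _ * X](_ : _ = 0) ?mulr0// uP linear_sumlz/= big1// => j _.
  rewrite dotZl oe; have [E|] := eqVneq (a j) k; last by rewrite mulr0.
  by move: tk; rewrite -E; have -> : t <= s (a j) by apply/aP; exists j.
have -> : g v - diagop dot u z v = g v2 - v2.
  have vE : v = v1 + v2 by rewrite /v2 addrC subrK.
  rewrite {1 2}vE (linear_D (unitary_lin ug)) (linear_D (diagop_lin _ _ _)).
  rewrite (diagop_orth _ v2u) opprD addrACA.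
  rewrite (linear_bigsum (unitary_lin ug)) (linear_bigsum (diagop_lin _ _ _)).
  rewrite -sumrB big1 ?add0r// => i _.
  by rewrite (linear_Z (unitary_lin ug)) (linear_Z (diagop_lin _ _ _)) gu diagop_fam// subrr.
apply: (@hcvg_near _ _ _ (fun m => \sum_(k < m) ((s k)%:C * dot v2 (e k)) *: f k) _ _ 0); last exact: Tv.
move=> m _; apply: eq_bigr => k _; case: ifPn => [tk|tk].
  by rewrite v2e// mulr0 mul0r.
by rewrite v2E.
Qed.

End Level.
End SingularExpansion.
End Approx.

Section UpApprox.
Variables (R : realType) (p : R).
Local Notation C := R[i].
Local Notation H := (l2 R nat).
Local Notation dot := (@l2_dot R nat : {dot H for Num.conj}).
Local Notation N := (hnorm dot).
Local Notation G := (Up dot p).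

Lemma Up_approx (g : H -> H) (d : R) : 1 <= p -> G g -> 0 < d ->
  exists n (u : 'I_n -> H) (z : 'I_n -> C), [/\ orthonormal_fam dot u,
    forall i, normc (z i) = 1 & (Up_dist dot p g (diagop dot u z) < d%:E)%E].
Proof.
move=> p1 [ug /(schattenP p1)[D /(schatten_lt p1)[D0 [s [s0 [e [f [oe of_ Tv]]]] sD]]]] d0.
have p0 : 0 < p by apply: lt_le_trans p1.
have P0 n : 0 <= s n `^ p by exact: powR_ge0.
have d2 : 0 < d / 2 by rewrite divr_gt0.
have [L hL] := tail_small P0 sD (powR_gt0 p d2).
(* [t] lies below every positive [s k] with [k < L], so deleting the levels from [t] upwards
   annihilates the first [L] terms and leaves a part of the small tail. *)
have [t t0 ht] : exists2 t, 0 < t & forall k, (k < L)%N -> 0 < s k -> t <= s k.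
  elim: (L) => [|m [t t0 ht]]; first by exists 1.
  have [sm|sm] := leP (s m) 0.
    exists t => // k; rewrite ltnS leq_eqVlt => /orP[/eqP->|/ht//].
    by rewrite ltNge sm.
  exists (Num.min t (s m)); first by rewrite lt_min t0.
  move=> k; rewrite ltnS leq_eqVlt => /orP[/eqP->|/ht h /h]; rewrite ge_min ?lexx ?orbT//.
  by move=> ->.
(* From [L2] on all [s k] are below [t], so only finitely many levels are deleted. *)
have [L2 hL2] := tail_small P0 sD (powR_gt0 p t0).
have sL2 k : (L2 <= k)%N -> s k < t.
  move=> Lk; rewrite ltNge; apply/negP => tk; have := hL2 k.+1.
  rewrite ltNge => /negP; apply; rewrite big_nat_recr//=.
  apply: (@le_trans _ _ (s k `^ p)); last by rewrite lerDr sumr_ge0.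
  by apply: (ge0_ler_powR _ _ _ tk); rewrite ?nnegrE ?s0// ltW.
pose r := [seq k <- iota 0 L2 | t <= s k]; pose n := size r.
pose a (i : 'I_n) := nth 0%N r i.
have ur : uniq r by rewrite filter_uniq ?iota_uniq.
have a_inj : injective a.
  by move=> i j /eqP; rewrite /a nth_uniq// => /eqP ij; exact: val_inj.
have aP k : reflect (exists i, a i = k) (t <= s k).
  apply: (iffP idP) => [tk|[i <-]].
    have kr : k \in r.
      rewrite mem_filter tk mem_iota add0n/= ltnNge; apply/negP => /sL2.
      by rewrite ltNge tk.
    have kn : (index k r < n)%N by rewrite index_mem.
    by exists (Ordinal kn); rewrite /a/= nth_index.
  have : a i \in r by rewrite mem_nth.
  by rewrite mem_filter => /andP[].
have [u [z [ou z1 sv]]] := level_diag ug s0 oe of_ Tv t0 a_inj aP.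
exists n, u, z; split=> //.
apply: (@le_lt_trans _ _ (d / 2)%:E); last by rewrite lte_fin; lra.
apply: (schatten_norm_le p1 _ sv); first exact: ltW.
move=> m; apply: (@le_trans _ _ (\sum_(L <= k < maxn L m) s k `^ p)); last exact/ltW.
apply: (@le_trans _ _ (\sum_(0 <= k < maxn L m) (if t <= s k then 0 else s k) `^ p)).
  rewrite [leRHS](@big_cat_nat _ _ _ m)//= ?leq_maxr// lerDl sumr_ge0// => k _.
  exact: powR_ge0.
rewrite (@big_cat_nat _ _ _ L)//= ?leq_maxl// big_nat_cond big1 ?add0r => [|k].
  apply: ler_sum => k _; apply: ge0_ler_powR; rewrite ?nnegrE ?s0//; first exact: ltW.
  - by case: ifP.
  - by case: ifP.
move=> /andP[/andP[_ kL] _]; case: ifPn => [_|tk]; first by rewrite powR0 ?gt_eqF.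
suff -> : s k = 0 by rewrite powR0 ?gt_eqF.
apply/eqP; apply: contraNT tk => sk; apply: ht => //.
by rewrite lt_def sk s0.
Qed.

Variables (K : lmodType C) (dotK : {dot K for Num.conj}) (b : (H -> H) -> K).

Lemma Up_hom_eq0 : 1 <= p ->
  (forall g h, G g -> G h -> b (g \o h) = b g + b h) ->
  (forall g, G g -> forall e : R, 0 < e -> exists2 d : R, 0 < d &
    forall h, G h -> (Up_dist dot p g h < d%:E)%E -> hnorm dotK (b g - b h) < e) ->
  forall g, G g -> b g = 0.
Proof.
move=> p1 bM bC g Gg; apply/eqP; rewrite -(hnorm_eq0 dotK) eq_le hnorm_ge0 andbT.
rewrite leNgt; apply/negP => n0; have [d d0 hd] := bC g Gg _ n0.
have [n [u [z [ou z1 gd]]]] := Up_approx p1 Gg d0.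
have := hd _ (diagop_Up p1 ou z1) gd.
by rewrite (hom_diagop p1 bM bC ou z1) subr0 ltxx.
Qed.

End UpApprox.

(** * The identity representation and its conjugate *)

Section Twisted.
Variables (R : realType) (p : R).
Local Notation C := R[i].
Local Notation H := (l2 R nat).
Local Notation dot := (@l2_dot R nat : {dot H for Num.conj}).
Local Notation N := (hnorm dot).
Local Notation G := (Up dot p).

Definition crefl (x : H) (z : C) : H -> H :=
  diagop dot (fun _ : 'I_1 => ((N x)^-1)%:C *: x) (fun=> z).

Lemma creflE x z v : crefl x z v = v + ((z - 1) * dot v x * ((N x) ^- 2)%:C) *: x.
Proof.
rewrite /crefl /diagop big_ord1 dotZr scalerA conjc_real; congr (_ + _ *: _).
by rewrite -exprVn expr2 rmorphM/=; ring.
Qed.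

Lemma crefl_Up x z : 1 <= p -> x != 0 -> normc z = 1 -> G (crefl x z).
Proof. by move=> p1 x0 z1; apply: diagop_Up => //; exact: fam1P. Qed.

Lemma creflxx x z : x != 0 -> crefl x z x = z *: x.
Proof.
move=> x0; rewrite creflE dotvv -mulrA -rmorphM/= divff ?sqrf_eq0 ?hnorm_eq0//.
by rewrite mulr1 scalerBl scale1r addrC subrK.
Qed.

Lemma crefl_orth x z v : dot v x = 0 -> crefl x z v = v.
Proof. by move=> vx; rewrite creflE vx mulr0 mul0r scale0r addr0. Qed.

Lemma creflZ x z a : a != 0 -> crefl (a *: x) z = crefl x z.
Proof.
move=> a0; apply/funext => v; rewrite !creflE scalerA; congr (_ + _ *: _).
have h : a * conjc a * (normc a ^- 2)%:C = 1.
  by rewrite mulJc -rmorphM/= divff// sqrf_eq0 normc_eq0.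
rewrite dotZr hnormZ exprMn invfM rmorphM/=.
have key (t ca d q q' c : C) : t * (ca * d) * (q * q') * c = t * d * q' * (c * ca * q).
  by ring.
by rewrite key h mulr1.
Qed.

Lemma crefl_conj x z g : unitary dot g -> g \o crefl x z = crefl (g x) z \o g.
Proof.
move=> ug; apply/funext => v /=; rewrite !creflE (linear_D (unitary_lin ug)).
by rewrite (linear_Z (unitary_lin ug)) (unitary_dot ug) (unitary_norm _ ug).
Qed.

Variables (K : lmodType C) (dotK : {dot K for Num.conj}) (pi : (H -> H) -> K -> K).
(** [sigma] stands for the identity or for complex conjugation, and [J] for a [sigma]-linear
    isometry with total range. This treats the identity representation and its dual at once. *)
Variables (sigma : {rmorphism C -> C}) (J : H -> K) (b : (H -> H) -> K).
Local Notation NK := (hnorm dotK).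
Hypothesis p1 : 1 <= p.
Hypothesis Kc : hcomplete dotK.
Hypothesis pU : forall g, G g -> unitary dotK (pi g).
Hypothesis sigmaR : forall x : R, sigma x%:C = x%:C.
Hypothesis sigmaJ : forall z, sigma (conjc z) = conjc (sigma z).
Hypothesis sigmaK : involutive sigma.
Hypothesis JD : forall u v, J (u + v) = J u + J v.
Hypothesis JZ : forall a u, J (a *: u) = sigma a *: J u.
Hypothesis Jdot : forall u v, dotK (J u) (J v) = sigma (dot u v).
Hypothesis Jpi : forall g u, G g -> pi g (J u) = J (g u).
Hypothesis Jtotal : forall y, (forall u, dotK y (J u) = 0) -> y = 0.
Hypothesis bM : forall g h, G g -> G h -> b (g \o h) = b g + pi g (b h).
Hypothesis bC : forall g, G g -> forall e : R, 0 < e -> exists2 d : R, 0 < d &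
  forall h, G h -> (Up_dist dot p g h < d%:E)%E -> NK (b g - b h) < e.

Let sigma_norm z : normc (sigma z) = normc z.
Proof.
apply/eqP; rewrite -(@eqrXn2 _ 2)// ?normc_ge0//; apply/eqP/(@complexI R).
by rewrite -!mulJc -sigmaJ -rmorphM/= mulJc sigmaR.
Qed.

Let NJ u : NK (J u) = N u.
Proof.
apply/eqP; rewrite -(@eqrXn2 _ 2)// ?hnorm_ge0//; apply/eqP/(@complexI R).
by rewrite -!dotvv Jdot dotvv sigmaR.
Qed.

Let VN x : x != 0 -> (N x ^- 2)%:C * dotK (J x) (J x) = 1.
Proof.
by move=> x0; rewrite dotvv NJ -rmorphM/= mulVf// sqrf_eq0 hnorm_eq0.
Qed.

Let J0 : J 0 = 0. Proof. by rewrite -(scale0r 0) JZ rmorph0 scale0r. Qed.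

Let GU g : G g -> unitary dot g. Proof. by case. Qed.

Let b1 : b id = 0.
Proof.
have G1 := Up_id p1; have := bM G1 G1; have -> : (id \o id : H -> H) = id by [].
move=> /eqP; rewrite -subr_eq0 opprD addNKr oppr_eq0 => /eqP h.
by apply: (unitary_inj (pU G1)); rewrite h (linear_0 (unitary_lin (pU G1))).
Qed.

Local Notation r x := (crefl x (-1)).

Let Gr x : x != 0 -> G (r x).
Proof. by move=> x0; apply: crefl_Up; rewrite // normcN normc1. Qed.

Let rr x : x != 0 -> r x \o r x = id.
Proof.
move=> x0; apply/funext => v /=; rewrite /crefl diagopM; last exact: fam1P.
have -> : (fun _ : 'I_1 => -1 * -1) = (fun=> 1 : C) by apply/funext => _; rewrite mulrNN mulr1.
exact: diagop1.
Qed.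

Let pi_anti x w : x != 0 -> dotK (pi (r x) w) (J x) = - dotK w (J x).
Proof.
move=> x0; rewrite -(unitary_dot (pU (Gr x0)) w) Jpi; last exact: Gr.
by rewrite creflxx// scaleN1r -scaleN1r JZ rmorphN1 scaleN1r linearNr opprK.
Qed.

Let pi_orth x w v : x != 0 -> dot v x = 0 -> dotK (pi (r x) w) (J v) = dotK w (J v).
Proof.
by move=> x0 vx; rewrite -[RHS](unitary_dot (pU (Gr x0))) Jpi ?crefl_orth//; exact: Gr.
Qed.

Let A x : C := dotK (b (r x)) (J x).

(** As [r x] is an involution, b r_x + pi(r_x) b r_x = 0. For [v'] orthogonal to [x] the operator
    [pi (r x)] fixes [J v'], so [b (r x)] has no component along [J v']. *)
Let bJ x : x != 0 -> b (r x) = (A x * (N x ^- 2)%:C) *: J x.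
Proof.
move=> x0; have := bM (Gr x0) (Gr x0); rewrite rr// b1 => bE.
apply/eqP; rewrite -subr_eq0; apply/eqP/Jtotal => v.
have n0 : (N x ^+ 2)%:C != 0 :> C by rewrite fmorph_eq0 sqrf_eq0 hnorm_eq0.
pose c := dot v x * (N x ^- 2)%:C; pose v' := v - c *: x.
have v'x : dot v' x = 0.
  rewrite /v' linearBl/= dotZl dotvv /c -mulrA -rmorphM/= mulVf ?mulr1 ?subrr//.
  by rewrite sqrf_eq0 hnorm_eq0.
have bv' : dotK (b (r x)) (J v') = 0.
  have := congr1 (fun t => dotK t (J v')) bE; rewrite linear0l linearDl/= pi_orth//.
  by move=> /esym/eqP; rewrite -mulr2n mulrn_eq0 => /eqP.
have -> : v = v' + c *: x by rewrite /v' subrK.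
rewrite linearBl/= JD JZ !linearDr/= !dotZr bv' !dotZl !Jdot dotvv sigmaR.
rewrite -[dot x v']conjcK -dotC v'x conjc0 rmorph0 !mulr0 !add0r -/(A x).
rewrite -[A x * _ * (N x ^+ 2)%:C]mulrA -rmorphM/= mulVf ?mulr1 ?subrr//.
by rewrite sqrf_eq0 hnorm_eq0.
Qed.

Let AZ a x : A (a *: x) = conjc (sigma a) * A x.
Proof.
have [->|a0] := eqVneq a 0.
  by rewrite scale0r rmorph0 conjc0 mul0r /A J0 linear0r.
by rewrite /A creflZ// JZ dotZr.
Qed.

Let AN x : A (- x) = - A x.
Proof. by rewrite -scaleN1r AZ rmorphN1 [conjc _]rmorphN1 mulN1r. Qed.

Let A0 : A 0 = 0. Proof. by rewrite /A J0 linear0r. Qed.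

(* Apply b to r_x r_e = r_w r_x with w = r_x e. *)
Let A_refl x e : x != 0 ->
  A (r x e) = A e - 2 * (A x * (N x ^- 2)%:C * sigma (dot x e)).
Proof.
move=> x0; have Gx := Gr x0; have ux := GU Gx.
have [->|e0] := eqVneq e 0.
  by rewrite (linear_0 (unitary_lin ux)) A0 linear0r rmorph0 !mulr0 subr0.
set w := r x e; have w0 : w != 0.
  by rewrite -(hnorm_eq0 dot) (unitary_norm _ ux) hnorm_eq0.
have := bM Gx (Gr e0); rewrite (crefl_conj e (-1) ux) -/w (bM (Gr w0) Gx).
move=> /(congr1 (fun t => dotK t (J w))); rewrite !linearDl/= pi_anti// -/(A w).
have -> : dotK (pi (r x) (b (r e))) (J w) = A e by rewrite -Jpi// unitary_dot//; exact: pU.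
have -> : dotK (b (r x)) (J w) = - (A x * (N x ^- 2)%:C * sigma (dot x e)).
  rewrite bJ// dotZl Jdot -mulrN; congr (_ * _).
  rewrite -(unitary_dot ux x e) -/w creflxx// scaleN1r linearNl/= rmorphN opprK.
  by [].
by move=> h; move/eqP: h; rewrite subr_eq => /eqP ->; ring.
Qed.

(* For orthogonal x, y one has r_x r_y (x + y) = - (x + y). *)
Let A_orthD x y : dot x y = 0 -> A (x + y) = A x + A y.
Proof.
move=> xy; have [->|x0] := eqVneq x 0; first by rewrite A0 !add0r.
have [->|y0] := eqVneq y 0; first by rewrite A0 !addr0.
have yx : dot y x = 0 by rewrite dotC xy conjc0.
have E1 : r y (x + y) = x - y.
  by rewrite (linear_D (unitary_lin (GU (Gr y0)))) crefl_orth// creflxx// scaleN1r.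
have E2 : r x (x - y) = - (x + y).
  by rewrite (linear_B (unitary_lin (GU (Gr x0)))) creflxx// crefl_orth// scaleN1r opprD.
have V z : z != 0 -> A z * (N z ^- 2)%:C * sigma (dot z z) = A z.
  move=> z0; rewrite dotvv sigmaR -mulrA -rmorphM/= mulVf ?mulr1//.
  by rewrite sqrf_eq0 hnorm_eq0.
have := A_refl (x - y) x0; rewrite E2 -E1 A_refl// E1 linearBr/= linearDr/= yx xy.
rewrite add0r subr0 !V// AN => h.
have h2 : A (x + y) * 2 = (A x + A y) * 2.
  transitivity (A (x + y) - - A (x + y)); first by ring.
  by rewrite h; ring.
by apply: mulIf h2; rewrite pnatr_eq0.
Qed.

(** For [g = crefl x z], which commutes with [r x], comparing the two expansions of [b] gives 2 <b
    g, J x> = A x (1 - sigma z). A fixed z, different from 1 but close to it, keeps |b g| <= 1 for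
    all [x] simultaneously. *)
Let A_bounded : exists2 B, 0 <= B & forall x, normc (A x) <= B * N x.
Proof.
have [d d0 hd] := bC (Up_id p1) ltr01.
have [z z1 /andP[zp zd]] : exists2 z : C, normc z = 1 & 0 < normc (z - 1) < d.
  (* Such a [z] arises from -1, at squared distance 4 from 1, by iterated square roots. *)
  have [j hj] := div_exp2_small 4 (exprn_gt0 2 (divr_gt0 d0 (ltr0n R 2))).
  have [w [w1 wn wj]] : exists w : C,
      [/\ normc w = 1, w != 1 & normc (w - 1) ^+ 2 <= 4 / 2 ^+ j].
    elim: (j) => [|k [w [w1 wn wk]]].
      exists (-1); rewrite normcN normc1; split=> //.
        by rewrite -subr_eq0 -opprD oppr_eq0 -[1 + 1]/(2%:R) pnatr_eq0.
      by rewrite -opprD normcN -[1 + 1]/(2%:R) normc_nat expr0 divr1; lra.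
    have [w' [w'1 w'w hw]] := unit_sqrt w1; exists w'; split=> //.
      by apply: contra wn => /eqP w'E; rewrite -w'w w'E expr1n.
    by have := le_trans hw wk; rewrite [2 ^+ k.+1]exprS invfM; lra.
  exists w => //; rewrite normc_gt0 subr_eq0 wn/=.
  have : normc (w - 1) <= d / 2.
    rewrite -(@ler_pXn2r _ 2)// ?nnegrE ?normc_ge0 ?divr_ge0 ?(ltW d0)//.
    exact: le_trans wj hj.
  by lra.
exists (2 / normc (z - 1)); first by rewrite divr_ge0// ltW.
move=> x; have [->|x0] := eqVneq x 0; first by rewrite A0 normc0 hnorm0 mulr0.
pose g := crefl x z; have Gg : G g by exact: crefl_Up.
have comm : g \o r x = r x \o g.
  apply/funext => v /=; rewrite /g /crefl !diagopM; [|exact: fam1P..].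
  by congr diagop; apply/funext => _; rewrite mulrC.
have bg : NK (b g) <= 1.
  have dg : (Up_dist dot p id g < d%:E)%E.
    apply: (@le_lt_trans _ _ (normc (z - 1))%:E); last by rewrite lte_fin.
    have ou : orthonormal_fam dot (fun _ : 'I_1 => ((N x)^-1)%:C *: x) by exact: fam1P.
    have := @Up_dist_diagop R p 1 _ (fun=> z) _ p1 ou (normc_ge0 (z - 1)).
    by rewrite mul1r; apply.
  by have := hd g Gg dg; rewrite b1 sub0r hnormN => /ltW.
have E : 2 * dotK (b g) (J x) = A x * (1 - sigma z).
  have := bM Gg (Gr x0); rewrite comm (bM (Gr x0) Gg).
  move=> /(congr1 (fun t => dotK t (J x))); rewrite !linearDl/= (pi_anti (b g) x0) -/(A x).
  have -> : dotK (pi g (b (r x))) (J x) = sigma z * A x.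
    have gx : g x = z *: x by exact: creflxx.
    rewrite (bJ x0) (linear_Z (unitary_lin (pU Gg))) (Jpi _ Gg) gx JZ scalerA dotZl.
    have key (t t' t'' y : C) : t'' * y = 1 -> t * t'' * t' * y = t' * t.
      by move=> h; transitivity (t' * t * (t'' * y)); [ring|rewrite h mulr1].
    exact/key/VN.
  move=> h; rewrite mulrBr mulr1 [A x * _]mulrC.
  have -> : sigma z * A x = A x - dotK (b g) (J x) - dotK (b g) (J x).
    by rewrite h; ring.
  ring.
have nz : normc (1 - sigma z) = normc (z - 1).
  have -> : 1 - sigma z = - sigma (z - 1) by rewrite (rmorphB sigma) (rmorph1 sigma) opprB.
  by rewrite normcN sigma_norm.
have := congr1 (@normc R) E; rewrite !normcM nz normc_nat => h.
have h' : normc (A x) * normc (z - 1) <= 2 * N x.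
  have -> : normc (A x) * normc (z - 1) = 2 * normc (dotK (b g) (J x)) by exact: esym h.
  apply: (ler_wpM2l (ler0n R 2)).
  apply: (le_trans (cauchy_schwarz _ _ _)).
  rewrite NJ.
  exact: (ler_piMl (hnorm_ge0 _ _) bg).
by rewrite mulrAC ler_pdivlMr.
Qed.

Let A_trunc m x : A (l2_trunc (index_iota 0 m) x) =
  \sum_(0 <= i < m) conjc (sigma (x i)) * A (delta R i).
Proof.
elim: m => [|m ih]; first by rewrite /l2_trunc !big_nil A0.
rewrite /l2_trunc !big_nat_recr//= A_orthD ?AZ -?ih//.
rewrite linear_sumlz/= big_nat_cond big1// => i /andP[/andP[_ im] _].
by rewrite dotZl dotZr delta_on ltn_eqF// !mulr0.
Qed.

(** The values of [A] on the basis are square summable, so they are the coefficients of a vector [y]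
    of the complete space [K]; density of truncations extends the identity from the basis. *)
Let A_riesz : exists y, forall x, A x = dotK y (J x).
Proof.
have [B B0 hB] := A_bounded.
have sB m : \sum_(0 <= i < m) normc (A (delta R i)) ^+ 2 <= B ^+ 2.
  (* The coefficients are chosen so that [A x] equals |x|^2 = S; boundedness of [A] then gives S <=
     B^2. *)
  pose x : H := \sum_(0 <= i < m) sigma (A (delta R i)) *: delta R i.
  set S := \sum_(0 <= i < m) _.
  have nx : N x ^+ 2 = S.
    rewrite /x (@pythagoras _ _ dot _ (index_iota 0 m) (fun i => sigma (A (delta R i)))) ?iota_uniq//.
      by apply: eq_bigr => i _; rewrite sigma_norm.
    by move=> i j _ _; rewrite delta_on.
  have xi i : (i < m)%N -> x i = sigma (A (delta R i)).
    move=> im; rewrite -dot_delta linear_sumlz/= (bigD1_seq i) ?iota_uniq ?mem_index_iota//=.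
    rewrite big1 ?addr0 => [|j ji]; rewrite dotZl delta_on ?eqxx ?mulr1//.
    by rewrite (negPf ji) mulr0.
  have Ax : A x = S%:C.
    have xE : x = l2_trunc (index_iota 0 m) x.
      rewrite {1}/x /l2_trunc !big_nat; apply: eq_bigr => i /andP[_ im].
      by rewrite xi.
    rewrite xE A_trunc /S rmorph_sum/= !big_nat; apply: eq_bigr => i /andP[_ im].
    by rewrite xi// sigmaK -mulJc mulrC.
  have S0 : 0 <= S by apply: sumr_ge0 => i _; exact: sqr_ge0.
  have := hB x; rewrite Ax normcR ger0_norm// => h.
  have [/eqP->|Sn0] := boolP (S == 0); first exact: sqr_ge0.
  have Sp : 0 < S by rewrite lt_def Sn0.
  rewrite -(ler_pM2l Sp) -expr2 -{2}nx mulrC -exprMn.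
  by rewrite ler_pXn2r// nnegrE ?mulr_ge0 ?hnorm_ge0.
have oJ i j : dotK (J (delta R i)) (J (delta R j)) = (i == j)%:R.
  by rewrite Jdot delta_on rmorph_nat.
pose ys m := \sum_(0 <= i < m) A (delta R i) *: J (delta R i).
have [y hy] : exists y, hcvg dotK ys y.
  apply: Kc => e e0; have A20 i : 0 <= normc (A (delta R i)) ^+ 2 by exact: sqr_ge0.
  have [L hL] := tail_small A20 sB (exprn_gt0 2 e0).
  exists L => m n; wlog mn : m n / (n <= m)%N => [hw Lm Ln|].
    by have /orP[h|h] := leq_total n m; [|rewrite hnormB]; exact: hw.
  move=> Lm Ln; rewrite /ys (@big_cat_nat _ _ _ n)//= addrAC subrr add0r.
  rewrite -(@ltr_pXn2r _ 2)// ?nnegrE ?hnorm_ge0 ?(ltW e0)//.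
  rewrite (@pythagoras _ _ _ _ (index_iota n m) (fun i => A (delta R i))) ?iota_uniq//.
  apply: le_lt_trans (hL m); rewrite [leRHS](@big_cat_nat _ _ _ n)//= lerDr.
  by apply: sumr_ge0 => i _; exact: sqr_ge0.
exists y => x; have yd i : dotK y (J (delta R i)) = A (delta R i).
  apply: (@hcvg_dot_eq _ _ _ _ _ _ _ i.+1 hy) => m im.
  rewrite /ys linear_sumlz/= (bigD1_seq i) ?iota_uniq ?mem_index_iota//=.
  rewrite big1 ?addr0 => [|j ji]; rewrite dotZl oJ ?eqxx ?mulr1//.
  by rewrite (negPf ji) mulr0.
have J_sum m v : J (l2_trunc (index_iota 0 m) v) = \sum_(0 <= i < m) sigma (v i) *: J (delta R i).
  elim: m => [|m ih]; first by rewrite /l2_trunc !big_nil J0.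
  by rewrite /l2_trunc !big_nat_recr//= JD JZ -ih.
apply/eqP; rewrite -subr_eq0 -normc_eq0 eq_le normc_ge0 andbT leNgt; apply/negP => D0.
have c0 : 0 < B + NK y + 1 by have := hnorm_ge0 dotK y; lra.
have [m hm] := hcvg_trunc x (divr_gt0 D0 c0).
have {hm} := hm m (leqnn m); rewrite hnormB; set t := l2_trunc _ x => hm.
have At : A t = dotK y (J t).
  rewrite A_trunc J_sum linear_sumr/=; apply: eq_bigr => i _.
  by rewrite dotZr yd.
(* [A] is known to be additive on orthogonal vectors only. The remainder [x - t] is orthogonal to
   the truncation [t], and both functionals are small on it. *)
have xE : x = t + (x - t) by rewrite addrC subrK.
have ot : dot t (x - t) = 0.
  rewrite /t /l2_trunc linear_sumlz/= big_nat big1// => i /andP[_ im].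
  rewrite dotZl dot_deltal.
  have -> : (x - l2_trunc (index_iota 0 m) x) i = 0; last by rewrite conjc0 mulr0.
  rewrite -dot_delta linearBl/= dot_delta linear_sumlz/=.
  rewrite (bigD1_seq i) ?iota_uniq ?mem_index_iota//=.
  rewrite dotZl delta_on eqxx mulr1 big1 ?addr0 ?subrr// => j ji.
  by rewrite dotZl delta_on (negPf ji) mulr0.
have E : A x - dotK y (J x) = A (x - t) - dotK y (J (x - t)).
  by rewrite {1 2}xE A_orthD// JD linearDr/= At opprD addrACA subrr add0r.
have : normc (A x - dotK y (J x)) <= (B + NK y) * N (x - t).
  rewrite E mulrDl (le_trans (le_normcD _ _))// lerD// normcN.
  by rewrite (le_trans (cauchy_schwarz _ _ _))// NJ.
move: hm; rewrite ltr_pdivlMr// => hm; rewrite leNgt => /negP; apply.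
by apply: le_lt_trans hm; rewrite mulrC ler_wpM2l ?hnorm_ge0//; lra.
Qed.

Lemma twisted_coboundary : exists v, forall g, G g -> b g = pi g v - v.
Proof.
(* The factor comes from pi(r_x) v - v = - 2 <v, J x> / |x|^2 J x, to be matched with <y, J x> /
   |x|^2 J x. *)
have [y Ay] := A_riesz; pose v := (- 2^-1) *: y; exists v => g Gg.
have br x : x != 0 -> b (r x) = pi (r x) v - v.
  move=> x0; apply/eqP; rewrite -subr_eq0; apply/eqP/Jtotal => w.
  pose c := dot w x * (N x ^- 2)%:C; pose w' := w - c *: x.
  have w'x : dot w' x = 0.
    rewrite /w' linearBl/= dotZl dotvv /c -mulrA -rmorphM/= mulVf ?mulr1 ?subrr//.
    by rewrite sqrf_eq0 hnorm_eq0.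
  have xw' : dot x w' = 0 by rewrite dotC w'x conjc0.
  have -> : w = w' + c *: x by rewrite /w' subrK.
  rewrite JD JZ linearDr/= !dotZr !linearBl/= (pi_orth _ x0 w'x) (pi_anti _ x0).
  rewrite {1}bJ// dotZl Jdot xw' rmorph0 mulr0 subrr subr0 add0r -/(A x) Ay /v !dotZl.
  by rewrite mulNr opprK; set t := dotK y _; field.
have lin_g := unitary_lin (pU Gg).
(* The remainder [q] will be fixed by [pi (r (g x'))] for every nonzero [x'], hence orthogonal to
   [J (g x')]; since [g] is onto, [q] vanishes. *)
apply/eqP; rewrite -subr_eq0; apply/eqP; set q := _ - _; apply: Jtotal => x.
have [x' <-] : exists x', g x' = x by case: (GU Gg).
have [->|x0] := eqVneq x' 0; first by rewrite (linear_0 (unitary_lin (GU Gg))) J0 linear0r.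
have gx0 : g x' != 0 by rewrite -(hnorm_eq0 dot) (unitary_norm _ (GU Gg)) hnorm_eq0.
have lin_r := unitary_lin (pU (Gr gx0)).
have := bM Gg (Gr x0); rewrite (crefl_conj x' (-1) (GU Gg)) (bM (Gr gx0) Gg) => h.
(* The multiplicativity needed here is derived by testing against the total family of vectors [J w],
   on which [pi] is known. *)
have comm : pi g (pi (r x') v) = pi (r (g x')) (pi g v).
  apply/eqP; rewrite -subr_eq0; apply/eqP/Jtotal => w.
  have [w0 <-] : exists w0, g w0 = w by case: (GU Gg).
  rewrite linearBl/= -Jpi// (unitary_dot (pU Gg)).
  have [_ _ sr] := GU (Gr x0); have [w1 <-] := sr w0.
  rewrite -{1}Jpi; last exact: Gr.
  rewrite (unitary_dot (pU (Gr x0))) Jpi//.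
  have -> : g (r x' w1) = r (g x') (g w1) by have := crefl_conj x' (-1) (GU Gg); move/(congr1 (fun f => f w1)).
  rewrite -[J (r (g x') _)]Jpi; last exact: Gr.
  by rewrite (unitary_dot (pU (Gr gx0))) -Jpi// (unitary_dot (pU Gg)) subrr.
have qE : q = pi (r (g x')) q.
  rewrite /q (linear_B lin_r) (linear_B lin_r); move: h; rewrite !br// (linear_B lin_g) comm.
  move=> h; apply/eqP; rewrite -subr_eq0.
  set X := pi (r (g x')) (b g) in h *; set Y := pi _ (pi g v) in h *.
  set Z := pi (r (g x')) v in h *.
  have -> : b g - (pi g v - v) - (X - (Y - Z)) = (b g + (Y - pi g v)) - (Z - v + X).
    rewrite !opprD !opprK !addrA.
    by rewrite [LHS](ACl (1*5*2*6*3*4))/=.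
  by rewrite -h subrr.
have := congr1 (fun t => dotK t (J (g x'))) qE; rewrite pi_anti//.
move=> /eqP; rewrite -subr_eq0 opprK -mulr2n mulrn_eq0 => /eqP //.
Qed.

End Twisted.

(** * Tensor powers, Young modules and their duals *)

Section Tensors.
Variables (R : realType) (n : nat).
Local Notation C := R[i].
Local Notation H := (l2 R nat).
Local Notation idx := {ffun 'I_n -> nat}.
Local Notation T := (l2 R idx).
Local Notation dot := (@l2_dot R nat : {dot H for Num.conj}).
Local Notation dotT := (@l2_dot R idx : {dot T for Num.conj}).
Local Notation U := (unitary dot).
Implicit Types (g h : H -> H) (F : T) (i j : idx) (s : {perm 'I_n}).

Lemma tens_delta i : tens (fun k => delta R (i k)) = delta R i.
Proof.
apply: l2_ext => j; rewrite /= /tens_fun /=.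
have [->|ji] := eqVneq j i; first by rewrite big1// => k _; rewrite eqxx.
have [k jk] : exists k, j k != i k.
  apply/existsP; apply: contraR ji; rewrite negb_exists => /forallP h.
  by apply/eqP/ffunP => k; apply/eqP; have := h k; rewrite negbK.
by rewrite (bigD1 k)//= (negPf jk) mul0r.
Qed.

Lemma hnorm_sqsum (F F' : T) : sqsum F = sqsum F' -> hnorm dotT F = hnorm dotT F'.
Proof.
move=> e; apply/eqP; rewrite -(@eqrXn2 _ 2)// ?hnorm_ge0//.
by have := e; rewrite -!sqr_l2_norm => -[->].
Qed.

Lemma slot_linear g (k : 'I_n) : U g -> linear (slot g k).
Proof.
move=> ug a F F'; apply: l2_ext => i; rewrite (slotE _ _ _ ug).
have -> : slice k i (a *: F + F') = a *: slice k i F + slice k i F' by exact: l2_ext.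
rewrite (unitary_lin ug).
have -> : (a *: slot g k F + slot g k F') i = a *: slot g k F i + slot g k F' i by [].
by rewrite !(slotE _ _ _ ug).
Qed.

Lemma slot_norm g k F : U g -> hnorm dotT (slot g k F) = hnorm dotT F.
Proof.
move=> ug; apply: hnorm_sqsum; rewrite -(sqsum_slot k F ug).
by congr sqsum; apply/funext => i; rewrite slotE.
Qed.

Lemma tpow_linear g : U g -> linear (tpow g : T -> T).
Proof.
move=> ug a F F'; rewrite /tpow; elim: (enum 'I_n) => //= k r ->.
by rewrite (slot_linear k ug).
Qed.

Lemma tpow_norm g F : U g -> hnorm dotT (tpow g F) = hnorm dotT F.
Proof.
by move=> ug; rewrite /tpow; elim: (enum 'I_n) => //= k r <-; rewrite slot_norm.
Qed.

Lemma tpow_dot g F F' : U g -> dotT (tpow g F) (tpow g F') = dotT F F'.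
Proof.
move=> ug; apply: polarization; first exact: tpow_linear.
by move=> G; exact: tpow_norm.
Qed.

(** Identities between the operators [tpow g] and [rho s] can thus be checked on tensors of basis
    vectors. *)
Lemma isometry_eq (L1 L2 : T -> T) : linear L1 -> linear L2 ->
  (forall F, hnorm dotT (L1 F) = hnorm dotT F) ->
  (forall F, hnorm dotT (L2 F) = hnorm dotT F) ->
  (forall i, L1 (tens (fun k => delta R (i k))) = L2 (tens (fun k => delta R (i k)))) ->
  L1 = L2.
Proof.
move=> l1 l2 i1 i2 e; apply: (@bounded_lin_eq _ _ _ dotT _ _ 1 1) => //.
- by move=> F; rewrite mul1r i1.
- by move=> F; rewrite mul1r i2.
- by move=> i; rewrite -tens_delta e.
Qed.

Lemma tpowM g h F : U g -> U h -> tpow (g \o h) F = tpow g (tpow h F).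
Proof.
move=> ug uh; have ugh := unitary_comp ug uh.
apply: (congr1 (fun L => L F) (_ : tpow (g \o h) = tpow g \o tpow h)).
apply: isometry_eq.
- exact: tpow_linear.
- by move=> a G G' /=; rewrite (tpow_linear uh) (tpow_linear ug).
- by move=> G; exact: tpow_norm.
- by move=> G /=; rewrite !tpow_norm.
- by move=> i /=; rewrite !tpow_tens.
Qed.

Lemma tpow_id F : tpow id F = F.
Proof.
have u1 : U id by exact: unitary_id.
apply: (congr1 (fun L => L F) (_ : tpow id = id)).
apply: isometry_eq => //; first exact: tpow_linear.
- by move=> G; exact: tpow_norm.
- by move=> i; rewrite tpow_tens.
Qed.

Lemma rho_norm s F : hnorm dotT (rho s F) = hnorm dotT F.
Proof.
apply: hnorm_sqsum; rewrite /sqsum; apply/esym.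
by rewrite (reindex_esum _ _ _ _ (perm_idx_bij s)).
Qed.

Lemma tpow_rho g s F : U g -> tpow g (rho s F) = rho s (tpow g F).
Proof.
move=> ug; apply: (congr1 (fun L => L F) (_ : tpow g \o rho s = rho s \o tpow g)).
apply: isometry_eq.
- by move=> a G G' /=; rewrite rho_linear (tpow_linear ug).
- by move=> a G G' /=; rewrite (tpow_linear ug) rho_linear.
- by move=> G /=; rewrite tpow_norm// rho_norm.
- by move=> G /=; rewrite rho_norm tpow_norm.
- by move=> i /=; rewrite !rho_tens tpow_tens// tpow_tens// rho_tens.
Qed.

Lemma dot_tens_delta (u : 'I_n -> H) (j : 'I_n -> nat) :
  dotT (tens u) (tens (fun k => delta R (j k))) = \prod_k dot (u k) (delta R (j k)).
Proof.
have -> : (fun k => delta R (j k)) = (fun k => delta R ([ffun k => j k] k)).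
  by apply/funext => k; rewrite ffunE.
rewrite tens_delta dot_delta /= /tens_fun; apply: eq_bigr => k _.
by rewrite dot_delta ffunE.
Qed.

(** Applying the inverse of [h] on both sides turns the second tensor into a basis tensor, and
    pairing with that is evaluation of a coordinate. *)
Lemma dot_tens_unitary g h (i j : 'I_n -> nat) : U g -> U h ->
  dotT (tens (fun k => g (delta R (i k)))) (tens (fun k => h (delta R (j k)))) =
  \prod_k dot (g (delta R (i k))) (h (delta R (j k))).
Proof.
move=> ug uh; have uhi := unitary_inv uh.
have E k : h (op_inv h (g (delta R (i k)))) = g (delta R (i k)) by rewrite (op_invK uh).
have -> : (fun k => g (delta R (i k))) = (fun k => h (op_inv h (g (delta R (i k))))).
  by apply/funext => k; rewrite E.
rewrite -[tens (fun k => h (op_inv h _))](tpow_tens (fun k => op_inv h (g (delta R (i k)))) uh).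
rewrite -[tens (fun k => h (delta R _))](tpow_tens (fun k => delta R (j k)) uh).
rewrite (tpow_dot _ _ uh) dot_tens_delta; apply: eq_bigr => k _.
by rewrite -(unitary_dot uh) (op_invK uh).
Qed.

End Tensors.

(** * Young modules, their representations and their duals *)

Section Young.
Variables (R : realType) (s : seq nat).
Local Notation C := R[i].
Local Notation H := (l2 R nat).
Local Notation n := (sumn s).
Local Notation idx := {ffun 'I_n -> nat}.
Local Notation T := (l2 R idx).
Local Notation dot := (@l2_dot R nat : {dot H for Num.conj}).
Local Notation dotT := (@l2_dot R idx : {dot T for Num.conj}).
Local Notation Y := (young_mod R s).
Local Notation dotY := (@young_dot R s : {dot Y for Num.conj}).
Local Notation U := (unitary dot).
Implicit Types (g h : H -> H) (v w : Y).

Lemma young_proj_tpow g (F : T) : U g -> tpow g (young_proj F) = young_proj (tpow g F).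
Proof.
move=> ug; have lg := tpow_linear (n := n) ug; rewrite /young_proj (linear_bigsum lg).
apply: eq_bigr => r _; rewrite (linear_bigsum lg); apply: eq_bigr => c _.
by rewrite (linear_Z lg) tpow_rho.
Qed.

Lemma young_repE g v : U g -> val (young_rep g v) = tpow g (val v).
Proof.
move=> ug; rewrite /young_rep insubdK//.
have /asboolP[F ->] := valP v; apply/asboolP; exists (tpow g F).
by rewrite young_proj_tpow.
Qed.

Lemma young_rep_dot g v w : U g -> dotY (young_rep g v) (young_rep g w) = dotY v w.
Proof.
move=> ug; rewrite -[LHS]/(dotT (val (young_rep g v)) (val (young_rep g w))).
by rewrite !young_repE// tpow_dot.
Qed.

Lemma young_repM g h v : U g -> U h -> young_rep (g \o h) v = young_rep g (young_rep h v).
Proof.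
move=> ug uh; apply: val_inj; rewrite !young_repE//; last exact: unitary_comp.
by rewrite tpowM.
Qed.

Lemma young_rep_id v : young_rep id v = v.
Proof. by apply: val_inj; rewrite young_repE ?tpow_id//; exact: unitary_id. Qed.

Lemma young_tens_subproof (u : 'I_n -> H) : young_proj (tens u) \in @young_pred R s.
Proof. by apply/asboolP; exists (tens u). Qed.

Definition young_tens (u : 'I_n -> H) : Y := YoungMod (young_tens_subproof u).

Lemma young_rep_tens g u : U g -> young_rep g (young_tens u) = young_tens (fun k => g (u k)).
Proof. by move=> ug; apply: val_inj; rewrite young_repE// young_proj_tpow// tpow_tens. Qed.

Lemma ydual_subproof (u : Y) : ((fun v => dotY v u) : Y -> C^o) \in dual_pred dotY.
Proof.
apply/asboolP; split=> [a v w|]; first by rewrite linearPl.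
by exists (hnorm dotY u) => v; rewrite mulrC cauchy_schwarz.
Qed.

Definition ydual (u : Y) : dual dotY := Dual (ydual_subproof u).

Lemma riesz_ydual u : riesz (ydual u) = u.
Proof.
rewrite /riesz; case: xgetP => [w _ hw|/(_ u)[]//].
by apply: (@dot_ext _ _ dotY) => v; rewrite dotC -hw -dotC.
Qed.

Lemma dual_dot_ydual u v : dual_dot (ydual u) (ydual v) = dotY v u.
Proof. by rewrite /dual_dot !riesz_ydual. Qed.

Lemma ydual_conj_lin a u v : ydual (a *: u + v) = conjc a *: ydual u + ydual v.
Proof.
apply: val_inj; apply/funext => w /=.
by rewrite -[LHS]/(dotY w (a *: u + v)) linearDr/= dotZr.
Qed.

Lemma ydualZ a u : ydual (a *: u) = conjc a *: ydual u.
Proof.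
apply: val_inj; apply/funext => w /=.
by rewrite -[LHS]/(dotY w (a *: u)) dotZr.
Qed.

Lemma ydualN u : ydual (- u) = - ydual u.
Proof.
apply: val_inj; apply/funext => w /=.
by rewrite -[LHS]/(dotY w (- u)) linearNr.
Qed.

(** Under the Riesz map the dual representation becomes the original one, as <pi(g^-1) v, u> = <v,
    pi(g) u>. *)
Lemma young_dual_rep_ydual g u : U g ->
  young_dual_rep g (ydual u) = ydual (young_rep g u).
Proof.
move=> ug; have uig := unitary_inv ug.
have E : (fun v => ydual u (young_rep (op_inv g) v)) = val (ydual (young_rep g u)).
  apply/funext => v /=; rewrite -[LHS]/(dotY (young_rep (op_inv g) v) u).
  rewrite -(young_rep_dot _ _ ug) -young_repM//.
  have -> : g \o op_inv g = id by apply/funext => w /=; rewrite (op_invK ug).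
  by rewrite young_rep_id.
by rewrite /young_dual_rep E valKd.
Qed.

End Young.

(** * Weights with at most one box *)

Section SmallDiagrams.
Variables (R : realType) (s : seq nat).
Local Notation C := R[i].
Local Notation H := (l2 R nat).
Local Notation n := (sumn s).
Local Notation idx := {ffun 'I_n -> nat}.
Local Notation T := (l2 R idx).
Local Notation dot := (@l2_dot R nat : {dot H for Num.conj}).
Local Notation dotT := (@l2_dot R idx : {dot T for Num.conj}).
Local Notation Y := (young_mod R s).
Local Notation dotY := (@young_dot R s : {dot Y for Num.conj}).

(** The number of factors is a variable with an equation, so that it can be substituted even though
    [sumn s] occurs in the index types. *)
Lemma tpow0 m g (F : l2 R {ffun 'I_m -> nat}) : m = 0%N -> tpow g F = F.
Proof. by move=> m0; rewrite /tpow (size0nil (s := enum 'I_m))// size_enum_ord. Qed.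

Lemma tens0E m (u : 'I_m -> H) (F : l2 R {ffun 'I_m -> nat}) : m = 0%N ->
  F = F [ffun=> 0%N] *: tens u.
Proof.
move=> m0; subst m; apply: l2_ext => i.
rewrite -[RHS]/(F _ * \prod_k u k (i k)) big_ord0 mulr1; congr (F _); apply/ffunP; by case.
Qed.

Lemma tens0_norm m (u : 'I_m -> H) : m = 0%N ->
  hnorm (@l2_dot R {ffun 'I_m -> nat}) (tens u) = 1.
Proof.
move=> m0; subst m; have -> : tens u = delta R [ffun=> 0%N].
  rewrite -tens_delta; congr tens; apply/funext; by case.
by rewrite norm_delta.
Qed.

Lemma tens1E m (k : 'I_m) (F : l2 R {ffun 'I_m -> nat}) : m = 1%N ->
  F = tens (fun=> slice k [ffun=> 0%N] F).
Proof.
move=> m1; subst m; apply: l2_ext => i; rewrite /= /tens_fun big_ord1 /=.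
congr (F _); apply/ffunP => l; rewrite ffunE !ord1 eqxx//.
Qed.

Lemma tens1_linear m : m = 1%N -> linear (fun u : H => tens (fun _ : 'I_m => u)).
Proof.
move=> m1; subst m => a u v; apply: l2_ext => i.
rewrite -[RHS]/(a * \prod_(k < 1) u (i k) + \prod_(k < 1) v (i k)).
by rewrite -[LHS]/(\prod_(k < 1) (a *: u + v) (i k)) !big_ord1.
Qed.

Lemma tens1_norm m (u : H) : m = 1%N ->
  hnorm (@l2_dot R {ffun 'I_m -> nat}) (tens (fun _ : 'I_m => u)) = hnorm dot u.
Proof.
move=> m1; subst m; apply/eqP; rewrite -(@eqrXn2 _ 2)// ?hnorm_ge0//; apply/eqP.
apply: (@EFin_inj R); rewrite !sqr_l2_norm /sqsum.
rewrite (@reindex_esum _ _ _ [set: nat] _ (fun j : nat => [ffun _ : 'I_1 => j])).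
  by apply: eq_esum => j _; rewrite /= /tens_fun big_ord1 ffunE.
split=> // [j j' _ _ /ffunP/(_ ord0)|i _]; first by rewrite !ffunE.
by exists (i ord0) => //; apply/ffunP => l; rewrite ffunE (ord1 l).
Qed.

(** On at most one letter the identity is the only permutation, so the Young module is the whole
    tensor power. *)
Lemma young_proj_small (F : T) : (n <= 1)%N -> young_proj F = F.
Proof.
move=> n1; have p1 (t : {perm 'I_n}) : t = 1%g.
  apply/permP => k; apply: val_inj; rewrite perm1.
  have h (l : 'I_n) : l = 0%N :> nat by have := leq_trans (ltn_ord l) n1; case: (l : nat).
  exact: etrans (h _) (esym (h _)).
have r1 : row_stab (s := s) 1%g by apply/forallP => k; rewrite perm1.
have c1 : col_stab (s := s) 1%g by apply/forallP => k; rewrite perm1.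
rewrite /young_proj (bigD1 1%g)//= [X in _ + X]big1 ?addr0 => [|t /andP[_]]; last first.
  by rewrite (p1 t) eqxx.
rewrite (bigD1 1%g)//= [X in _ + X]big1 ?addr0 => [|t /andP[_]]; last first.
  by rewrite (p1 t) eqxx.
rewrite mulg1 odd_perm1 expr0 scale1r; apply: l2_ext => i /=; congr (F _).
by apply/ffunP => k; rewrite ffunE perm1.
Qed.

Lemma young_tens_small (u : 'I_n -> H) : (n <= 1)%N -> val (young_tens u) = tens u.
Proof. by move=> n1; rewrite /= young_proj_small. Qed.

Lemma ydual_surj (f : dual dotY) : (n <= 1)%N -> exists w, f = ydual w.
Proof.
move=> n1; have [fl [M fM]] := asboolW (valP f).
have pr (F : T) : F \in @young_pred R s by apply/asboolP; exists F; rewrite young_proj_small.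
pose emb F : Y := YoungMod (pr F).
have [|F|u hu] := @l2_riesz R idx (fun F => f (emb F)) M.
- move=> a F F'; have -> : emb (a *: F + F') = a *: emb F + emb F' by exact: val_inj.
  exact: fl.
- exact: fM.
exists (emb u); apply: val_inj; apply/funext => v /=.
have vE : v = emb (val v) by exact: val_inj.
by rewrite {1}vE; exact: hu.
Qed.

Lemma young_rep0 g (v : Y) : n = 0%N -> young_rep g v = v.
Proof. by move=> n0; rewrite /young_rep tpow0// valKd. Qed.

Lemma young_dual_rep0 g (f : dual dotY) : n = 0%N -> young_dual_rep g f = f.
Proof.
move=> n0; rewrite /young_dual_rep (_ : (fun v => _) = val f) ?valKd//.
by apply/funext => v; rewrite young_rep0.
Qed.

Definition young_vec (u : H) : Y := young_tens (fun=> u).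

Lemma young_vec_linear : n = 1%N -> linear young_vec.
Proof.
move=> n1 a u v; apply: val_inj.
rewrite [LHS]young_tens_small ?n1// (tens1_linear n1).
by rewrite -(young_tens_small (fun=> u)) ?n1// -(young_tens_small (fun=> v)) ?n1.
Qed.

Lemma young_vec_dot u v : n = 1%N -> dotY (young_vec u) (young_vec v) = dot u v.
Proof.
move=> n1; apply: (polarization (young_vec_linear n1)) => w.
rewrite -(tens1_norm w n1) -(young_tens_small (fun=> w)) ?n1//.
Qed.

Lemma young_vec_surj (v : Y) : n = 1%N -> exists u, v = young_vec u.
Proof.
move=> n1; have k : 'I_n by rewrite n1; exact: ord0.
exists (slice k [ffun=> 0%N] (val v)); apply: val_inj.
by rewrite [RHS]young_tens_small ?n1// -tens1E.
Qed.

(** Meant for the empty diagram: the empty tensor does not depend on its factors, and [0] is a dummy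
    value. *)
Definition young_unit : Y := young_tens (fun=> 0).

Lemma young_unit_dot : n = 0%N -> dotY young_unit young_unit = 1.
Proof.
move=> n0; rewrite dotvv.
have -> : hnorm dotY young_unit = 1; last by rewrite expr1n.
by rewrite -(tens0_norm (fun=> 0) n0) -young_tens_small ?n0.
Qed.

Lemma young_unit_span (v : Y) : n = 0%N -> exists a, v = a *: young_unit.
Proof.
move=> n0; exists (val v [ffun=> 0%N]); apply: val_inj.
rewrite (_ : val (_ *: young_unit) = val v [ffun=> 0%N] *: val young_unit)//.
by rewrite young_tens_small ?n0// -tens0E.
Qed.

End SmallDiagrams.

(** * Vanishing of the cohomology for at most one box *)

Section Model.
Variables (R : realType) (p : R) (sm sp : seq nat).
Local Notation C := R[i].
Local Notation H := (l2 R nat).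
Local Notation dot := (@l2_dot R nat : {dot H for Num.conj}).
Local Notation G := (Up dot p).
Variables (K : lmodType C) (dotK : {dot K for Num.conj}) (pi : (H -> H) -> K -> K).
Variable tau : {bilinear dual (@young_dot R sm) -> young_mod R sp -> K}.
Hypothesis p1 : 1 <= p.
Hypothesis ht : hilbert_tensor (@dual_dot R _ (@young_dot R sm)) (@young_dot R sp) dotK tau.
Hypothesis hp : forall g, G g -> unitary dotK (pi g) /\
  forall f v, pi g (tau f v) = tau (young_dual_rep g f) (young_rep g v).

(** A finite sum [x] of elementary tensors is orthogonal to such a [y], so |y - x| >= |y|; density
    then forces y = 0. *)
Lemma tensor_total y : (forall f v, dotK y (tau f v) = 0) -> y = 0.
Proof.
move=> h; apply/eqP; rewrite -(hnorm_eq0 dotK) eq_le hnorm_ge0 andbT leNgt.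
apply/negP => n0; have [_ _ dn] := ht; have [m [v [w hm]]] := dn y _ n0.
set x := \sum_i _ in hm; have yx : dotK y x = 0.
  by rewrite linear_sumr/= big1// => i _; exact: h.
have := sqr_hnormB dotK y x; rewrite yx /= mulr0 subr0 => E.
have := ltr_pXn2r (n := 2) isT; move=> /(_ _ (hnorm dotK (y - x)) (hnorm dotK y)).
rewrite !nnegrE !hnorm_ge0 hm => /(_ isT isT); rewrite E.
by have := sqr_ge0 (hnorm dotK x); lra.
Qed.

Lemma model_unitary g : G g -> unitary dotK (pi g). Proof. by move=> /hp[]. Qed.

Lemma H1_zero_trivial : sumn sm = 0%N -> sumn sp = 0%N -> Z1 dot p dotK pi `<=` B1 dot p pi.
Proof.
move=> sm0 sp0 b [bM bC].
have pi1 g y : G g -> pi g y = y.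
  move=> Gg; have [ug pg] := hp Gg; apply/eqP; rewrite -subr_eq0; apply/eqP.
  apply: tensor_total => f v; have tE : pi g (tau f v) = tau f v.
    by rewrite pg young_dual_rep0// young_rep0.
  by rewrite linearBl/= -{1}tE (unitary_dot ug) subrr.
exists 0 => g Gg; rewrite pi1// subrr.
have bM' g' h : G g' -> G h -> b (g' \o h) = b g' + b h.
  by move=> Gg' Gh; rewrite (bM _ _ Gg' Gh) (pi1 _ _ Gg').
exact: (Up_hom_eq0 p1 bM' bC Gg).
Qed.

(** Tensoring with the unit functional [f0] of the one-dimensional dual factor gives a linear
    isometry [J]. *)
Lemma H1_zero_pos : sumn sm = 0%N -> sumn sp = 1%N -> Z1 dot p dotK pi `<=` B1 dot p pi.
Proof.
move=> sm0 sp1 b [bM bC]; have [Kc tdot _] := ht.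
pose f0 := ydual (young_unit R sm).
have f01 : dual_dot f0 f0 = 1 by rewrite dual_dot_ydual young_unit_dot.
apply: (@twisted_coboundary _ _ _ dotK _ idfun (fun u => tau f0 (young_vec sp u))) => //.
- exact: model_unitary.
- by move=> u v; rewrite (linear_D (young_vec_linear sp1)) linearDr.
- by move=> a u; rewrite (linear_Z (young_vec_linear sp1)) linearZr_LR.
- by move=> u v; rewrite tdot f01 mul1r young_vec_dot.
- move=> g u Gg; have [_ ->] := hp Gg; rewrite young_dual_rep0//.
  by congr (tau _ _); rewrite young_rep_tens//; case: Gg.
- move=> y hy; apply: tensor_total => f v.
  have smle : (sumn sm <= 1)%N by rewrite sm0.
  have [w ->] := ydual_surj f smle.
  have [a ->] := young_unit_span w sm0; have [u ->] := young_vec_surj v sp1.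
  have -> : ydual (a *: young_unit R sm) = conjc a *: f0.
    exact: ydualZ.
  by rewrite linearZl_LR/= dotZr hy mulr0.
Qed.

(** The Riesz map makes [J] antilinear, so [sigma] is complex conjugation. *)
Lemma H1_zero_neg : sumn sm = 1%N -> sumn sp = 0%N -> Z1 dot p dotK pi `<=` B1 dot p pi.
Proof.
move=> sm1 sp0 b [bM bC]; have [Kc tdot _] := ht.
pose v0 := young_unit R sp.
apply: (@twisted_coboundary _ _ _ dotK _ (@conjc R) (fun u => tau (ydual (young_vec sm u)) v0)) => //.
- exact: model_unitary.
- by move=> x; exact: conjc_real.
- exact: conjcK.
- move=> u v; rewrite (linear_D (young_vec_linear sm1)) -[young_vec sm u]scale1r.
  by rewrite ydual_conj_lin conjc1 !scale1r linearDl.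
- by move=> a u; rewrite (linear_Z (young_vec_linear sm1)) ydualZ linearZl_LR.
- by move=> u v; rewrite tdot young_unit_dot// mulr1 dual_dot_ydual young_vec_dot// dotC.
- move=> g u Gg; have [_ ->] := hp Gg; have [ug _] := Gg.
  by rewrite young_rep0// young_dual_rep_ydual// young_rep_tens.
- move=> y hy; apply: tensor_total => f v.
  have smle : (sumn sm <= 1)%N by rewrite sm1.
  have [w ->] := ydual_surj f smle; have [u ->] := young_vec_surj w sm1.
  have [a ->] := young_unit_span v sp0.
  by rewrite linearZr_LR/= dotZr hy mulr0.
Qed.

End Model.

(** * Weights with at least two boxes *)

Section ScalarBounds.
Variable R : realType.
Implicit Types c : R[i].

(** The expression 2 - 2 Re c is the squared distance of unit vectors with inner product c. It is
    subadditive under products up to a factor 2, which is lost once per factor. *)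
Lemma re_prod_le (m : nat) (c : 'I_m -> R[i]) : (forall j, normc (c j) <= 1) ->
  2 - 2 * Re (\prod_j c j) <= 2 ^+ m * \sum_j (2 - 2 * Re (c j)).
Proof.
have D0 (z : R[i]) : normc z <= 1 -> 0 <= 2 - 2 * Re z by have := ler_Re z; lra.
have D2 (z w : R[i]) : normc z <= 1 -> normc w <= 1 ->
    2 - 2 * Re (z * w) <= 2 * (2 - 2 * Re z) + 2 * (2 - 2 * Re w).
  have sq (t : R[i]) : normc t <= 1 -> Re t ^+ 2 + Im t ^+ 2 <= 1.
    by move=> t1; rewrite -Defs.sqr_normc -(expr1n _ 2) ler_pXn2r// nnegrE ?normc_ge0.
  move=> /sq + /sq; case: z w => [a b] [x y] /= h1 h2.
  (* These squares add up to at most the required difference, because |z|^2 + |w|^2 <= 2. *)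
  have := sqr_ge0 (a + x - 2); have := sqr_ge0 (b - y); nra.
elim: m c => [|m ih] c c1.
  by rewrite !big_ord0 mulr0 mulr1 subrr.
rewrite !big_ord_recl/=; set w := \prod_(i < m) _; set Sm := \sum_(i < m) _.
have w1 : normc w <= 1.
  rewrite normc_prod; apply: prodr_ile1 => j _.
  by rewrite normc_ge0 c1.
have := D2 _ _ (c1 ord0) w1; have := ih (fun j => c (lift ord0 j)) (fun j => c1 _).
rewrite -/w -/Sm exprS => h1 h2.
have p1 : 1 <= 2 ^+ m :> R by apply: exprn_ege1; rewrite ler1n.
have := ler_wpM2r (D0 _ (c1 ord0)) p1; rewrite mul1r.
lra.
Qed.

Lemma hnorm_unit_sub (V : lmodType R[i]) (dot : {dot V for Num.conj}) u v :
  hnorm dot u = 1 -> hnorm dot v = 1 -> hnorm dot (u - v) ^+ 2 = 2 - 2 * Re (dot u v).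
Proof. by move=> u1 v1; rewrite sqr_hnormB u1 v1 expr1n. Qed.

End ScalarBounds.

Section YoungBounds.
Variables (R : realType) (s : seq nat).
Local Notation C := R[i].
Local Notation H := (l2 R nat).
Local Notation n := (sumn s).
Local Notation idx := {ffun 'I_n -> nat}.
Local Notation T := (l2 R idx).
Local Notation dot := (@l2_dot R nat : {dot H for Num.conj}).
Local Notation dotT := (@l2_dot R idx : {dot T for Num.conj}).
Local Notation Y := (young_mod R s).
Local Notation dotY := (@young_dot R s : {dot Y for Num.conj}).
Local Notation U := (unitary dot).

(** The product of the orders of the row and column groups, a bound for the operator norm of
    [young_proj]. *)
Definition young_cst : R := \sum_(r | row_stab (s := s) r) \sum_(c | col_stab (s := s) c) 1.

Lemma young_cst_ge0 : 0 <= young_cst.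
Proof. by apply: sumr_ge0 => r _; apply: sumr_ge0. Qed.

Lemma sign_norm (b : bool) : normc ((-1) ^+ b : C) = 1.
Proof. by rewrite normcX normcN normc1 expr1n. Qed.

Lemma young_proj_norm (F : T) : hnorm dotT (young_proj F) <= young_cst * hnorm dotT F.
Proof.
rewrite /young_proj (le_trans (hnorm_sum _ _ _ _))// /young_cst mulr_suml.
apply: ler_sum => r _; rewrite (le_trans (hnorm_sum _ _ _ _))// mulr_suml.
by apply: ler_sum => c _; rewrite hnormZ sign_norm rho_norm.
Qed.

Definition young_orbit (i : 'I_n -> nat) (g : H -> H) : Y :=
  young_tens (fun k => g (delta R (i k))).

Lemma young_rep_orbit g h i : U h -> young_rep h (young_orbit i g) = young_orbit i (h \o g).
Proof. by move=> uh; rewrite young_rep_tens. Qed.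

Lemma tens_delta_norm (i : 'I_n -> nat) g : U g ->
  hnorm dotT (tens (fun k => g (delta R (i k)))) = 1.
Proof.
move=> ug; rewrite -(tpow_tens _ ug) tpow_norm//.
have -> : (fun k => delta R (i k)) = (fun k => delta R ([ffun k => i k] k)).
  by apply/funext => k; rewrite ffunE.
by rewrite tens_delta norm_delta.
Qed.

Lemma young_orbit_norm_le i g : U g -> hnorm dotY (young_orbit i g) <= young_cst.
Proof.
move=> ug; have := young_proj_norm (tens (fun k => g (delta R (i k)))).
by rewrite tens_delta_norm// mulr1.
Qed.

(** Expanding both projectors leaves [young_cst ^+ 2] terms, each a product of [n] overlaps bounded
    by [m]. *)
Lemma young_orbit_dot_le i j g h m : U g -> U h -> 0 <= m ->
  (forall k l, normc (dot (g (delta R (i k))) (h (delta R (j l)))) <= m) ->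
  normc (dotY (young_orbit i g) (young_orbit j h)) <= young_cst ^+ 2 * m ^+ n.
Proof.
move=> ug uh m0 hm.
rewrite -[dotY _ _]/(dotT (young_proj (tens (fun k => g (delta R (i k)))))
  (young_proj (tens (fun k => h (delta R (j k)))))).
have E t t' : normc (dotT (rho t (tens (fun k => g (delta R (i k)))))
    (rho t' (tens (fun k => h (delta R (j k)))))) <= m ^+ n.
  rewrite !rho_tens (dot_tens_unitary (fun k => i (t^-1%g k)) (fun k => j (t'^-1%g k)) ug uh).
  rewrite normc_prod -[X in m ^+ X]card_ord -prodr_const; apply: ler_prod => k _.
  by rewrite normc_ge0 hm.
have Sum (P : pred {perm 'I_n}) (f : {perm 'I_n} -> T) F' B : 
    (forall t, P t -> normc (dotT (f t) F') <= B) ->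
    normc (dotT (\sum_(t | P t) f t) F') <= (\sum_(t | P t) 1) * B.
  move=> h1; rewrite linear_sumlz/= (le_trans (normc_sum _ _ _))// mulr_suml.
  by apply: ler_sum => t Pt; rewrite mul1r h1.
have B1 t0 : normc (dotT (rho t0 (tens (fun k => g (delta R (i k)))))
   (young_proj (tens (fun k => h (delta R (j k)))))) <= young_cst * m ^+ n.
  rewrite /young_proj linear_sumr/= (le_trans (normc_sum _ _ _))// /young_cst mulr_suml.
  apply: ler_sum => r _; rewrite linear_sumr/= (le_trans (normc_sum _ _ _))// mulr_suml.
  apply: ler_sum => c _; rewrite dotZr normcM normc_conj sign_norm mul1r mul1r.
  exact: E.
rewrite {1}/young_proj linear_sumlz/= (le_trans (normc_sum _ _ _))//.
rewrite expr2 -mulrA {1}/young_cst mulr_suml.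
apply: ler_sum => r _; rewrite linear_sumlz/= (le_trans (normc_sum _ _ _))// mulr_suml.
by apply: ler_sum => c _; rewrite dotZl normcM sign_norm mul1r mul1r.
Qed.

Lemma young_orbit_sub_le i g h : U g -> U h ->
  hnorm dotY (young_orbit i g - young_orbit i h) ^+ 2 <=
  young_cst ^+ 2 * (2 ^+ n * \sum_k hnorm dot (g (delta R (i k)) - h (delta R (i k))) ^+ 2).
Proof.
move=> ug uh; set tg := tens (fun k => g (delta R (i k))).
set th := tens (fun k => h (delta R (i k))).
have -> : hnorm dotY (young_orbit i g - young_orbit i h) = hnorm dotT (young_proj (tg - th)).
  by rewrite (linear_B (young_proj_linear (s := s))).
apply: (@le_trans _ _ (young_cst ^+ 2 * hnorm dotT (tg - th) ^+ 2)).
  rewrite -exprMn ler_pXn2r// ?nnegrE ?mulr_ge0 ?hnorm_ge0 ?young_cst_ge0//.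
  exact: young_proj_norm.
apply: ler_wpM2l; first exact: sqr_ge0.
have d1 k : hnorm dot (delta R (i k)) = 1 by rewrite norm_delta.
rewrite hnorm_unit_sub ?tens_delta_norm// dot_tens_unitary//.
under [X in _ <= _ * X]eq_bigr => k _ do rewrite hnorm_unit_sub ?unitary_norm ?d1//.
apply: re_prod_le => k; rewrite (le_trans (cauchy_schwarz _ _ _))//.
by rewrite !unitary_norm// d1 mulr1.
Qed.

Lemma box_inj : sorted geq s -> injective (box (s := s)).
Proof.
move=> ss k l; rewrite /box => /eqP; rewrite nth_uniq ?size_young_boxes//.
  by move=> /eqP kl; exact: val_inj.
rewrite filter_uniq// allpairs_uniq ?iota_uniq// => -[c r] [c' r'] _ _ /=.
by move=> [-> ->].
Qed.

(** The coefficient of the symmetrized tensor at the original basis tensor is 1. Indeed r c = 1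
    forces [r] to preserve rows and columns alike; a box is determined by its row and column, so r =
    c = 1. *)
Lemma young_orbit_norm_ge i : sorted geq s -> injective i -> 1 <= hnorm dotY (young_orbit i id).
Proof.
move=> ss i_inj; set F := young_proj (tens (fun k => delta R (i k))).
have -> : hnorm dotY (young_orbit i id) = hnorm dotT F by [].
pose i0 : idx := [ffun k => i k].
have tE : tens (fun k => delta R (i k)) = delta R i0.
  by rewrite -tens_delta; congr tens; apply/funext => k; rewrite ffunE.
have rhoE t : rho t (delta R i0) i0 = (t == 1%g)%:R.
  rewrite /= ; congr (_%:R); congr nat_of_bool; apply/eqP/eqP => [|->].
    move=> /ffunP h; apply/permP => k; apply: i_inj.
    by have := h k; rewrite !ffunE perm1.
  by apply/ffunP => k; rewrite !ffunE perm1.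
have F1 : dotT F (delta R i0) = 1.
  rewrite /F tE /young_proj linear_sumlz/= (bigD1 1%g)/=; last by apply/forallP => k; rewrite perm1.
  have c1 : col_stab (s := s) 1%g by apply/forallP => k; rewrite perm1.
  rewrite linear_sumlz/= (bigD1 1%g)//= dotZl dot_delta rhoE mulg1 eqxx mulr1 odd_perm1 expr0.
  rewrite big1 => [|c /andP[_ cn1]]; last by rewrite dotZl dot_delta rhoE mul1g (negPf cn1) mulr0.
  rewrite addr0 big1 ?addr0// => r /andP[/forallP rs rn1].
  rewrite linear_sumlz/= big1// => c /forallP cs; rewrite dotZl dot_delta rhoE.
  have [rc|] := eqVneq (r * c)%g 1%g; last by rewrite mulr0.
  case/eqP: rn1; apply/permP => k; rewrite perm1; apply: (box_inj ss).
  have := cs (r k); rewrite -permM rc perm1 => /eqP h2; have /eqP h1 := rs k.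
  by move: h1 h2; case: (box (r k)) => ? ?; case: (box k) => ? ? /= -> ->.
by have := cauchy_schwarz dotT F (delta R i0); rewrite F1 normc1 norm_delta mulr1.
Qed.

End YoungBounds.

(** * Almost orthogonality of the orbits of block vectors *)

Section Orbits.
Variables (R : realType) (p : R) (sm sp : seq nat).
Local Notation C := R[i].
Local Notation H := (l2 R nat).
Local Notation dot := (@l2_dot R nat : {dot H for Num.conj}).
Local Notation G := (Up dot p).
Local Notation U := (unitary dot).
Local Notation Ym := (young_mod R sm).
Local Notation Yp := (young_mod R sp).
Local Notation dotm := (@young_dot R sm : {dot Ym for Num.conj}).
Local Notation dotp := (@young_dot R sp : {dot Yp for Num.conj}).
Local Notation nm := (sumn sm).
Local Notation np := (sumn sp).
Variables (K : lmodType C) (dotK : {dot K for Num.conj}) (pi : (H -> H) -> K -> K).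
Variable tau : {bilinear dual (@young_dot R sm) -> young_mod R sp -> K}.
Hypothesis ht : hilbert_tensor (@dual_dot R _ (@young_dot R sm)) (@young_dot R sp) dotK tau.
Hypothesis hp : forall g, G g -> unitary dotK (pi g) /\
  forall f v, pi g (tau f v) = tau (young_dual_rep g f) (young_rep g v).
Hypothesis n2 : (2 <= nm + np)%N.
Local Notation n := (nm + np)%N.
Local Notation NK := (hnorm dotK).
Local Notation N := (hnorm dot).
Implicit Types (g h : H -> H) (k l : nat).

(** Block [k] consists of [n] consecutive basis vectors; the first [nm] positions serve the dual
    factor, the others the positive one. *)
Definition block_idx (k j : nat) := (k * n + j)%N.

Lemma block_idx_inj k l (i j : 'I_n) : (block_idx k i == block_idx l j) = (k == l) && (i == j).
Proof.
apply/eqP/andP => [|[/eqP -> /eqP ->]//]; rewrite /block_idx => E.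
have n0 : (0 < n)%N by exact: leq_trans n2.
have := congr1 (fun t => (t %/ n)%N) E; rewrite !divnMDl// !divn_small// !addn0 => kl.
by move: E; rewrite kl => /addnI ij; split=> //; apply/eqP/val_inj.
Qed.

Definition neg_slot k (j : 'I_nm) := block_idx k (lshift np j).
Definition pos_slot k (j : 'I_np) := block_idx k (rshift nm j).

Definition orbit_m k g := young_orbit (neg_slot k) g : Ym.
Definition orbit_p k g := young_orbit (pos_slot k) g : Yp.

Definition weight_orbit k g : K := tau (ydual (orbit_m k g)) (orbit_p k g).

Lemma pi_orbit k g h : G h -> U g -> pi h (weight_orbit k g) = weight_orbit k (h \o g).
Proof.
move=> Gh ug; have [uh ph] := hp Gh; have [uh' _] := Gh.
by rewrite ph young_dual_rep_ydual// !young_rep_orbit.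
Qed.

Lemma tau_dot u v u' v' : dotK (tau (ydual u) v) (tau (ydual u') v') = dotm u' u * dotp v v'.
Proof. by have [_ -> _] := ht; rewrite dual_dot_ydual. Qed.

Lemma tau_norm u v : NK (tau (ydual u) v) = hnorm dotm u * hnorm dotp v.
Proof.
apply/eqP; rewrite -(@eqrXn2 _ 2)// ?mulr_ge0 ?hnorm_ge0//; apply/eqP/(@complexI R).
by rewrite -dotvv tau_dot !dotvv exprMn [RHS]rmorphM.
Qed.

(** For unitary [g] and [h], the squared Hilbert-Schmidt norm of the block of h^-1 g from block [k]
    to block [l]. *)
Definition overlap g h k l : R :=
  \sum_(i < n) \sum_(j < n) normc (dot (g (delta R (block_idx k i))) (h (delta R (block_idx l j)))) ^+ 2.

Definition defect g h k : R := \sum_(i < n) N (g (delta R (block_idx k i)) - h (delta R (block_idx k i))) ^+ 2.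

Lemma overlap_ge0 g h k l : 0 <= overlap g h k l.
Proof. by apply: sumr_ge0 => i _; apply: sumr_ge0 => j _; exact: sqr_ge0. Qed.

Lemma overlapC g h k l : overlap g h k l = overlap h g l k.
Proof.
rewrite /overlap exchange_big; apply: eq_bigr => j _; apply: eq_bigr => i _.
by rewrite dotC normc_conj.
Qed.

Lemma defectC g h k : defect g h k = defect h g k.
Proof. by apply: eq_bigr => i _; rewrite hnormB. Qed.

Lemma overlap_id g k l : U g -> k != l -> overlap g g k l = 0.
Proof.
move=> ug kl; rewrite /overlap big1// => i _; rewrite big1// => j _.
by rewrite unitary_dot// delta_on block_idx_inj (negPf kl) normc0 expr0n.
Qed.

Let cst : R := young_cst R sm ^+ 2 * young_cst R sp ^+ 2.

Lemma cst_ge0 : 0 <= cst. Proof. by rewrite mulr_ge0 ?sqr_ge0. Qed.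

(** All overlaps are bounded by m = min(1, sqrt Q). The inner product involves products of n >= 2 of
    them, and m^n <= m^2 <= Q: this is where two boxes are needed. *)
Lemma orbit_dot_le g h k l : U g -> U h ->
  normc (dotK (weight_orbit k g) (weight_orbit l h)) <= cst * overlap g h k l.
Proof.
move=> ug uh; set Q := overlap g h k l.
have Q0 : 0 <= Q by exact: overlap_ge0.
pose m := Num.min 1 (Num.sqrt Q).
have m0 : 0 <= m by rewrite le_min ler01 sqrtr_ge0.
have m1 : m <= 1 by rewrite ge_min lexx.
have mQ : m ^+ 2 <= Q.
  rewrite -[leRHS](sqr_sqrtr Q0) ler_pXn2r// ?nnegrE ?sqrtr_ge0//.
  by rewrite ge_min lexx orbT.
have hm (i j : 'I_n) : normc (dot (g (delta R (block_idx k i))) (h (delta R (block_idx l j)))) <= m.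
  rewrite le_min; apply/andP; split.
    by rewrite (le_trans (cauchy_schwarz _ _ _))// !unitary_norm// !norm_delta mulr1.
  rewrite -[leLHS]ger0_norm ?normc_ge0// -sqrtr_sqr ler_wsqrtr//.
  rewrite /Q /overlap (bigD1 i)//= (bigD1 j)//= -addrA lerDl addr_ge0//.
    by apply: sumr_ge0 => ? _; exact: sqr_ge0.
  by apply: sumr_ge0 => ? _; apply: sumr_ge0 => ? _; exact: sqr_ge0.
have hM : normc (dotm (orbit_m l h) (orbit_m k g)) <= young_cst R sm ^+ 2 * m ^+ nm.
  apply: young_orbit_dot_le => // i j.
  by rewrite dotC normc_conj hm.
have hP : normc (dotp (orbit_p k g) (orbit_p l h)) <= young_cst R sp ^+ 2 * m ^+ np.
  by apply: young_orbit_dot_le => // i j; rewrite hm.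
rewrite tau_dot normcM; apply: (le_trans (ler_pM _ _ hM hP)); rewrite ?normc_ge0//.
rewrite mulrACA -exprD ler_wpM2l ?cst_ge0//; apply: le_trans mQ.
by rewrite ler_wiXn2l.
Qed.

Definition diag_cst : R := 2 * (cst * (2 ^+ nm + 2 ^+ np)).

Lemma diag_cst_ge0 : 0 <= diag_cst.
Proof. by rewrite mulr_ge0// mulr_ge0 ?cst_ge0// addr_ge0// exprn_ge0. Qed.

Lemma defect_split g h k : defect g h k =
  \sum_j N (g (delta R (neg_slot k j)) - h (delta R (neg_slot k j))) ^+ 2 +
  \sum_j N (g (delta R (pos_slot k j)) - h (delta R (pos_slot k j))) ^+ 2.
Proof. exact: big_split_ord. Qed.

Lemma orbit_sub_le g h k : U g -> U h ->
  NK (weight_orbit k g - weight_orbit k h) ^+ 2 <= diag_cst * defect g h k.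
Proof.
move=> ug uh.
(* One tensor factor is changed at a time. *)
have -> : weight_orbit k g - weight_orbit k h =
    tau (ydual (orbit_m k g - orbit_m k h)) (orbit_p k g) +
    tau (ydual (orbit_m k h)) (orbit_p k g - orbit_p k h).
  rewrite /weight_orbit; have -> : ydual (orbit_m k g - orbit_m k h) =
      ydual (orbit_m k g) - ydual (orbit_m k h).
    rewrite addrC -scaleN1r ydual_conj_lin addrC.
    by rewrite (_ : conjc (-1) = -1 :> C) ?scaleN1r// rmorphN1.
  by rewrite linearBl/= linearBr/= addrA subrK.
apply: (le_trans (sqr_hnormD_le _ _ _)); rewrite !tau_norm !exprMn.
rewrite /diag_cst -mulrA ler_wpM2l// defect_split.
set dm := \sum_j _; set dp := \sum_j _.
have dm0 : 0 <= dm by apply: sumr_ge0 => j _; exact: sqr_ge0.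
have dp0 : 0 <= dp by apply: sumr_ge0 => j _; exact: sqr_ge0.
have hm : hnorm dotm (orbit_m k g - orbit_m k h) ^+ 2 <= young_cst R sm ^+ 2 * (2 ^+ nm * dm).
  exact: young_orbit_sub_le.
have hp' : hnorm dotp (orbit_p k g - orbit_p k h) ^+ 2 <= young_cst R sp ^+ 2 * (2 ^+ np * dp).
  exact: young_orbit_sub_le.
have nP : hnorm dotp (orbit_p k g) ^+ 2 <= young_cst R sp ^+ 2.
  by rewrite ler_pXn2r// ?nnegrE ?hnorm_ge0 ?young_cst_ge0// young_orbit_norm_le.
have nM : hnorm dotm (orbit_m k h) ^+ 2 <= young_cst R sm ^+ 2.
  by rewrite ler_pXn2r// ?nnegrE ?hnorm_ge0 ?young_cst_ge0// young_orbit_norm_le.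
have h1 := ler_pM (sqr_ge0 _) (sqr_ge0 _) hm nP.
have h2 := ler_pM (sqr_ge0 _) (sqr_ge0 _) nM hp'.
have e1 : 0 <= 2 ^+ nm * dp by rewrite mulr_ge0// exprn_ge0.
have e2 : 0 <= 2 ^+ np * dm by rewrite mulr_ge0// exprn_ge0.
apply: (le_trans (lerD h1 h2)).
have -> : young_cst R sm ^+ 2 * (2 ^+ nm * dm) * young_cst R sp ^+ 2 +
   young_cst R sm ^+ 2 * (young_cst R sp ^+ 2 * (2 ^+ np * dp)) =
   cst * (2 ^+ nm * dm + 2 ^+ np * dp) by rewrite /cst; ring.
rewrite -mulrA ler_wpM2l ?cst_ge0//.
by move: e1 e2; move: (2 ^+ nm) (2 ^+ np) => x y; nra.
Qed.

(** Distinct blocks stay orthogonal under [h], so [g] may be replaced by [g - h] in the overlaps;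
    Bessel's inequality for the orthonormal images under [h] then bounds the sum. *)
Lemma overlap_sum g h k (r : seq nat) : U g -> U h -> uniq r ->
  \sum_(l <- r | l != k) overlap g h k l <= defect g h k.
Proof.
move=> ug uh ur; rewrite exchange_big; apply: ler_sum => i _.
pose x := g (delta R (block_idx k i)) - h (delta R (block_idx k i)).
pose E (q : nat * 'I_n) := h (delta R (block_idx q.1 q.2)).
have oE q q' : dot (E q) (E q') = (q == q')%:R.
  by rewrite /E unitary_dot// delta_on block_idx_inj.
pose r' := [seq l <- r | l != k].
pose rr := [seq (l, j) | l <- r', j <- enum 'I_n].
have urr : uniq rr.
  apply: allpairs_uniq; [by rewrite filter_uniq|exact: enum_uniq|by move=> [a b] [c d]].
have := @bessel _ _ dot _ rr E x urr (fun q q' _ _ => oE q q').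
have dE l (j : 'I_n) : l != k ->
    dot (g (delta R (block_idx k i))) (h (delta R (block_idx l j))) = dot x (E (l, j)).
  move=> lk; rewrite /x linearBl/= (unitary_dot uh) delta_on block_idx_inj eq_sym.
  by rewrite (negPf lk) subr0.
apply: le_trans; rewrite /rr big_allpairs_dep /r' big_filter.
apply: ler_sum => l lk; rewrite big_enum; apply: ler_sum => j _.
by rewrite (dE _ _ lk).
Qed.

Definition main_cst : R := diag_cst + 2 * cst.

Lemma main_cst_ge0 : 0 <= main_cst.
Proof. by rewrite addr_ge0 ?diag_cst_ge0// mulr_ge0// cst_ge0. Qed.

Lemma orbit_combination_le g h (a : nat -> R) (r : seq nat) : U g -> U h -> uniq r ->
  (forall k, 0 <= a k) ->
  NK (\sum_(k <- r) (a k)%:C *: (weight_orbit k g - weight_orbit k h)) ^+ 2 <=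
  main_cst * \sum_(k <- r) a k ^+ 2 * defect g h k.
Proof.
move=> ug uh ur a0.
pose S k l := if k == l then diag_cst * defect g h k
              else cst * (overlap g h k l + overlap h g k l).
apply: (@schur_test _ _ dotK 0 _ _ S) => //.
- move=> k l _ _; rewrite /S; have [<-|kl] := eqVneq k l.
    by rewrite dotvv normcR ger0_norm ?sqr_ge0// orbit_sub_le.
  (* Vectors of different blocks moved by the same unitary are orthogonal, so only the two mixed
     inner products remain. *)
  have z f : U f -> dotK (weight_orbit k f) (weight_orbit l f) = 0.
    move=> uf; apply/eqP; rewrite -normc_eq0 eq_le normc_ge0 andbT.
    by rewrite (le_trans (orbit_dot_le k l uf uf))// overlap_id// mulr0.
  rewrite linearBl/= !linearBr/= !z// sub0r subr0 -opprD normcN.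
  by rewrite (le_trans (le_normcD _ _))// mulrDr lerD// orbit_dot_le.
- move=> k l; rewrite /S eq_sym; case: eqP => [->//|_].
  by rewrite (overlapC g h k) (overlapC h g k) [X in _ * X]addrC.
- move=> k kr; rewrite (bigD1_seq k)//= {1}/S eqxx /main_cst mulrDl lerD2l.
  rewrite (eq_bigr (fun l => cst * (overlap g h k l + overlap h g k l))); last first.
    by move=> l lk; rewrite /S eq_sym (negPf lk).
  rewrite -mulr_sumr big_split.
  apply: (@le_trans _ _ (cst * (defect g h k + defect g h k))); last by lra.
  apply: ler_wpM2l; first exact: cst_ge0.
  apply: lerD; first exact: overlap_sum.
  by rewrite defectC overlap_sum.
Qed.

Lemma orbit_norm_ge k : sorted geq sm -> sorted geq sp -> 1 <= NK (weight_orbit k id).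
Proof.
move=> ssm ssp; rewrite tau_norm; apply: mulr_ege1; apply: young_orbit_norm_ge => //.
  by move=> i j /eqP; rewrite block_idx_inj eqxx/= => /eqP/lshift_inj.
by move=> i j /eqP; rewrite block_idx_inj eqxx/= => /eqP/rshift_inj.
Qed.

End Orbits.

(* [b k = (k + 1)^(-1/M)]: the powers [b k ^ M] are the harmonic sequence, whereas
   [b (k+1) ^ (M+1) <= M (b k - b (k+1))] telescopes. *)
Lemma weight_exists (R : realType) (M : nat) : (0 < M)%N -> exists (b : nat -> R) (A : R),
  [/\ forall k, 0 <= b k, forall m, \sum_(0 <= k < m) b k ^+ M.+1 <= A &
      forall B, exists m, B < \sum_(0 <= k < m) b k ^+ M].
Proof.
move=> M0; have Mr : (M%:R : R) != 0 by rewrite pnatr_eq0 -lt0n.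
pose b (k : nat) : R := k.+1%:R `^ (- M%:R^-1).
have b0 k : 0 <= b k by exact: powR_ge0.
have bM k : b k ^+ M = k.+1%:R^-1.
  by rewrite -powR_mulrn// -powRrM mulNr mulVf// powR_inv1.
have bd k : b k.+1 <= b k.
  rewrite -(@ler_pXn2r _ M)// ?nnegrE// !bM lef_pV2 ?posrE// ler_nat.
  exact: leqnSn.
have tel k : b k.+1 ^+ M.+1 <= M%:R * (b k - b k.+1).
  have bp : 0 < b k by exact: powR_gt0.
  set x := b k in bp *; set y := b k.+1.
  have yx : y <= x by exact: bd.
  have y0 : 0 <= y by exact: b0.
  (* Consecutive harmonic terms differ by their product. Factoring x - y out of the left-hand side
     then bounds x y^M by M (x - y). *)
  have E : x ^+ M - y ^+ M = x ^+ M * y ^+ M.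
    rewrite /x /y !bM -[k.+2%:R]natr1; have k0 : (k.+1%:R : R) != 0 by rewrite pnatr_eq0.
    have k1 : (k.+1%:R + 1 : R) != 0 by rewrite natr1 pnatr_eq0.
    have key (t : R) : t != 0 -> t + 1 != 0 -> t^-1 - (t + 1)^-1 = t^-1 * (t + 1)^-1.
      by move=> t0 t1; field; rewrite t0 t1.
    exact: key.
  have S_le : \sum_(i < M) x ^+ (M.-1 - i) * y ^+ i <= M%:R * x ^+ M.-1.
    apply: (@le_trans _ _ (\sum_(i < M) x ^+ M.-1)); last first.
      by rewrite sumr_const card_ord mulr_natl.
    apply: ler_sum => i _; have iM : (i <= M.-1)%N by rewrite -ltnS prednK.
    rewrite -{2}(subnK iM) exprD ler_wpM2l ?exprn_ge0 ?(ltW bp)//.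
    by rewrite lerXn2r// nnegrE ltW.
  have H : x ^+ M * y ^+ M <= (x - y) * (M%:R * x ^+ M.-1).
    by rewrite -E subrXX ler_wpM2l// subr_ge0.
  have H2 : x * y ^+ M <= M%:R * (x - y).
    rewrite -(@ler_pM2l _ (x ^+ M.-1)) ?exprn_gt0//.
    move: H; rewrite -{1}(prednK M0) exprSr => H.
    by apply: le_trans (le_trans H _); rewrite le_eqVlt; apply/orP; left; apply/eqP; ring.
  apply: le_trans H2; rewrite exprS ler_wpM2r// exprn_ge0//.
(* The term [b 0 = 1] contributes 1 and the telescoping sum at most [M]. *)
exists b, (M%:R + 1); split=> // [[|m]|B].
- by rewrite big_nil addr_ge0.
- rewrite big_nat_recl//= addrC lerD//; last first.
    by rewrite exprS bM invr1 mulr1 /b powR1.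
  apply: (@le_trans _ _ (M%:R * (b 0%N - b m))).
    elim: (m) => [|j ih]; first by rewrite big_nil subrr mulr0.
    rewrite big_nat_recr//=; have := tel j; lra.
  rewrite -[leRHS]mulr1 ler_wpM2l// /b powR1.
  by have := b0 m; rewrite /b; lra.
- apply: contrapT => hB; apply: (@dvg_harmonic R).
  apply: nondecreasing_is_cvgn.
    by apply: nondecreasing_series => *; exact: harmonic_ge0.
  exists B => _ [m _ <-]; rewrite leNgt; apply/negP => Bm; apply: hB; exists m.
  move: Bm; rewrite /series /=; under eq_bigr do rewrite /harmonic -bM.
  by [].
Qed.

Lemma young_tens_neg (R : realType) (s : seq nat) (u u' : 'I_(sumn s) -> l2 R nat) j0 :
  u' j0 = - u j0 -> (forall j, j != j0 -> u' j = u j) -> young_tens u' = - young_tens u.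
Proof.
move=> h0 h1; have E : tens u' = - tens u.
  apply: l2_ext => i; rewrite -[LHS]/(\prod_k u' k (i k)) -[RHS]/(- \prod_k u k (i k)).
  rewrite (bigD1 j0)//= [in RHS](bigD1 j0)//= h0 -[(- u j0) _]/(- (u j0 _)) mulNr.
  by congr (- (_ * _)); apply: eq_bigr => k /h1 ->.
by apply: val_inj; rewrite /= E (linear_N (young_proj_linear (s := s))).
Qed.

(** * Construction of a cocycle that is not a coboundary *)

Section Cocycle.
Variables (R : realType) (p : R) (sm sp : seq nat).
Local Notation C := R[i].
Local Notation H := (l2 R nat).
Local Notation dot := (@l2_dot R nat : {dot H for Num.conj}).
Local Notation G := (Up dot p).
Local Notation U := (unitary dot).
Local Notation nm := (sumn sm).
Local Notation np := (sumn sp).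
Local Notation n := (nm + np)%N.
Variables (K : lmodType C) (dotK : {dot K for Num.conj}) (pi : (H -> H) -> K -> K).
Variable tau : {bilinear dual (@young_dot R sm) -> young_mod R sp -> K}.
Hypothesis p1 : 1 <= p.
Hypothesis ht : hilbert_tensor (@dual_dot R _ (@young_dot R sm)) (@young_dot R sp) dotK tau.
Hypothesis hp : forall g, G g -> unitary dotK (pi g) /\
  forall f v, pi g (tau f v) = tau (young_dual_rep g f) (young_rep g v).
Hypothesis n2 : (2 <= n)%N.
Hypotheses (ssm : sorted geq sm) (ssp : sorted geq sp).
Local Notation NK := (hnorm dotK).
Local Notation N := (hnorm dot).
Local Notation w := (weight_orbit tau).
Local Notation dfct := (defect sm sp).

Variables (M : nat) (b : nat -> R) (A : R).
Hypotheses (M0 : (0 < M)%N) (pM : p <= (2 * M.+1)%:R) (b0 : forall k, 0 <= b k).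
Hypothesis bA : forall m, \sum_(0 <= k < m) b k ^+ M.+1 <= A.
Hypothesis b_unbounded : forall B, exists m, B < \sum_(0 <= k < m) b k ^+ M.

Let A0 : 0 <= A. Proof. by have := bA 0; rewrite big_nil. Qed.

Let GU g : G g -> U g. Proof. by case. Qed.
Let uid : U id. Proof. exact: unitary_id. Qed.

(** For a fixed position [i] the basis vectors of all blocks form an orthonormal sequence, so
    [schatten_weight] applies once for each of the [n] positions. *)
Lemma defect_sum_le g h D m : (Up_dist dot p g h < D%:E)%E ->
  \sum_(0 <= k < m) b k ^+ M * dfct g h k <= n%:R * (D ^+ 2 * (A + 1)).
Proof.
move=> hD; rewrite /defect; under eq_bigr => k _ do rewrite mulr_sumr.
rewrite exchange_big/= mulr_natl -[X in _ *+ X]card_ord -sumr_const.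
apply: ler_sum => i _.
have oE : orthonormal_seq dot (fun k => delta R (block_idx sm sp k i)).
  by move=> k l; rewrite delta_on (block_idx_inj n2) eqxx andbT.
exact: (schatten_weight m p1 pM hD b0 bA oE).
Qed.

Let a k := Num.sqrt (b k ^+ M).
Let a0 k : 0 <= a k. Proof. exact: sqrtr_ge0. Qed.
Let a2 k : a k ^+ 2 = b k ^+ M. Proof. by rewrite sqr_sqrtr// exprn_ge0. Qed.

Definition cocycle_approx (g : H -> H) (m : nat) : K :=
  \sum_(0 <= k < m) (a k)%:C *: (w k g - w k id).

Let cst := main_cst R sm sp.

Let comb_le g h r : U g -> U h -> uniq r ->
  NK (\sum_(k <- r) (a k)%:C *: (w k g - w k h)) ^+ 2 <=
  cst * \sum_(k <- r) b k ^+ M * dfct g h k.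
Proof.
move=> ug uh ur; apply: (le_trans (orbit_combination_le ht n2 ug uh ur a0)).
by under eq_bigr do rewrite a2.
Qed.

Let dfct0 g h k : 0 <= b k ^+ M * dfct g h k.
Proof. by rewrite mulr_ge0 ?exprn_ge0// sumr_ge0// => i _; exact: sqr_ge0. Qed.

Lemma cocycle_approx_cvg g : G g -> exists l, hcvg dotK (cocycle_approx g) l.
Proof.
move=> Gg; have [ug sg] := Gg; have [D hD] := schattenP p1 sg.
have [Kc _ _] := ht; apply: Kc => e e0.
have c0 : 0 < cst + 1 by rewrite ltr_wpDl// main_cst_ge0.
have e1 : 0 < e ^+ 2 / (cst + 1) by rewrite divr_gt0// exprn_gt0.
have [L hL] := tail_small (fun k => dfct0 g id k) (fun m => defect_sum_le m hD) e1.
exists L => m m'; wlog mm : m m' / (m' <= m)%N => [hw Lm Lm'|Lm Lm'].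
  by have /orP[h|h] := leq_total m' m; [|rewrite hnormB]; exact: hw.
rewrite /cocycle_approx (@big_cat_nat _ _ _ m')//= addrAC subrr add0r.
rewrite -(@ltr_pXn2r _ 2)// ?nnegrE ?hnorm_ge0 ?(ltW e0)//.
apply: (le_lt_trans (comb_le ug uid (iota_uniq _ _))).
have h1 : \sum_(m' <= k < m) b k ^+ M * dfct g id k < e ^+ 2 / (cst + 1).
  apply: le_lt_trans (hL m); rewrite [leRHS](@big_cat_nat _ _ _ m')//= lerDr.
  by apply: sumr_ge0 => k _; exact: dfct0.
have s0 : 0 <= \sum_(m' <= k < m) b k ^+ M * dfct g id k.
  by apply: sumr_ge0 => k _; exact: dfct0.
apply: (@le_lt_trans _ _ ((cst + 1) * \sum_(m' <= k < m) b k ^+ M * dfct g id k)).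
  by rewrite ler_wpM2r// lerDl.
by rewrite mulrC -ltr_pdivlMr.
Qed.

Definition cocycle (g : H -> H) : K := xget 0 [set l | hcvg dotK (cocycle_approx g) l].

Lemma cocycleP g l : hcvg dotK (cocycle_approx g) l -> cocycle g = l.
Proof.
move=> gl; rewrite /cocycle; case: xgetP => [l' _ gl'|/(_ l)//].
exact: hcvg_unique gl' gl.
Qed.

Lemma cocycle_cvg g : G g -> hcvg dotK (cocycle_approx g) (cocycle g).
Proof. by move=> /cocycle_approx_cvg[l gl]; rewrite (cocycleP gl). Qed.

(** Each partial sum is a coboundary. *)
Lemma cocycle_approxM g h m : G g -> G h -> cocycle_approx (g \o h) m = cocycle_approx g m + pi g (cocycle_approx h m).
Proof.
move=> Gg Gh; have lg := unitary_lin (hp Gg).1.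
rewrite /cocycle_approx (linear_bigsum lg) -big_split/=; apply: eq_bigr => k _.
rewrite (linear_Z lg) (linear_B lg) -scalerDr; congr (_ *: _).
rewrite (pi_orbit hp _ Gg (GU Gh)) (pi_orbit hp _ Gg uid).
by rewrite [RHS]addrC addrA subrK.
Qed.

Lemma cocycle_Z1 : Z1 dot p dotK pi cocycle.
Proof.
split=> [g h Gg Gh|g Gg e e0].
  apply: cocycleP; apply: (@hcvg_near _ _ _ (fun m => cocycle_approx g m + pi g (cocycle_approx h m)) _ _ 0).
    by move=> m _; rewrite (cocycle_approxM m Gg Gh).
  exact: (hcvgD (cocycle_cvg Gg) (hcvg_unitary (hp Gg).1 (cocycle_cvg Gh))).
(* Adding 1 gives cst n (A + 1) <= c <= c^2, so that [c] can serve as a Lipschitz constant without a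
   square root. *)
pose c := cst * (n%:R * (A + 1)) + 1.
have c0 : 0 <= cst * (n%:R * (A + 1)) by rewrite mulr_ge0 ?main_cst_ge0// mulr_ge0// addr_ge0.
have c1 : 1 <= c by rewrite lerDr.
have cp : 0 < c by exact: lt_le_trans c1.
exists (e / (2 * c)); first by rewrite divr_gt0// mulr_gt0.
move=> h Gh hd; apply: (@le_lt_trans _ _ (e / 2)); last by lra.
apply: (hcvg_le (hcvgB (cocycle_cvg Gg) (cocycle_cvg Gh))) => m.
have -> : cocycle_approx g m - cocycle_approx h m = \sum_(0 <= k < m) (a k)%:C *: (w k g - w k h).
  rewrite /cocycle_approx -sumrB; apply: eq_bigr => k _; rewrite -scalerBr; congr (_ *: _).
  by rewrite opprB addrA subrK.
rewrite -(@ler_pXn2r _ 2)// ?nnegrE ?hnorm_ge0 ?divr_ge0 ?(ltW e0)//.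
apply: (le_trans (comb_le (GU Gg) (GU Gh) (iota_uniq _ _))).
apply: (le_trans (ler_wpM2l (main_cst_ge0 _ _ _) (defect_sum_le m hd))).
have -> : main_cst R sm sp * (n%:R * ((e / (2 * c)) ^+ 2 * (A + 1))) =
   (cst * (n%:R * (A + 1))) * (e / (2 * c)) ^+ 2 by rewrite /cst; ring.
apply: (@le_trans _ _ (c ^+ 2 * (e / (2 * c)) ^+ 2)).
  rewrite ler_wpM2r ?sqr_ge0//; apply: (@le_trans _ _ c); first by rewrite lerDl.
  by rewrite expr2 ler_peMl// ltW.
rewrite -exprMn le_eqVlt; apply/orP; left; apply/eqP; congr (_ ^+ 2).
by field; rewrite gt_eqF.
Qed.

(* The reflection in the first basis vector of the k-th block acts by -1 on [w k id]
   and fixes the other [w l id]. *)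
Let refl k : H -> H := crefl (delta R (block_idx sm sp k 0)) (-1).

Let d_neq0 i : delta R i != 0 :> H.
Proof. by rewrite -(hnorm_eq0 dot) norm_delta oner_eq0. Qed.

Let refl_G k : G (refl k).
Proof. by apply: crefl_Up => //; [exact: d_neq0|rewrite normcN normc1]. Qed.

Let refl_eq k : refl k (delta R (block_idx sm sp k 0)) = - delta R (block_idx sm sp k 0).
Proof. by rewrite /refl (creflxx _ (d_neq0 _)) scaleN1r. Qed.

Let refl_neq k l (j : 'I_n) : (l != k) || (j != 0%N :> nat) ->
  refl k (delta R (block_idx sm sp l j)) = delta R (block_idx sm sp l j).
Proof.
move=> h; apply: crefl_orth; rewrite delta_on.
have n0 : (0 < n)%N by exact: leq_trans n2.
have -> : block_idx sm sp k 0 = block_idx sm sp k (Ordinal n0) by [].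
rewrite (block_idx_inj n2); case/orP: h => [/negPf->//|h].
by rewrite -val_eqE/= (negPf h) andbF.
Qed.

Let w_refl_neq k l : l != k -> w l (refl k) = w l id.
Proof.
move=> lk; rewrite /weight_orbit; congr (tau (ydual (young_tens _)) (young_tens _)).
  by apply/funext => j; rewrite refl_neq ?lk.
by apply/funext => j; rewrite refl_neq ?lk.
Qed.

Let w_refl_eq k : w k (refl k) = - w k id.
Proof.
(* The first vector of a block belongs to the dual factor unless that factor has no boxes. *)
have [nm0|nm0] := posnP nm.
  have np0 : (0 < np)%N by move: n2; rewrite nm0 add0n => /ltnW.
  have E1 : orbit_m sm sp k (refl k) = orbit_m sm sp k id.
    congr young_tens; apply/funext => j; have := ltn_ord j; by rewrite {2}nm0.
  have E2 : orbit_p sm sp k (refl k) = - orbit_p sm sp k id.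
    apply: (@young_tens_neg _ _ _ _ (Ordinal np0)).
      have e : pos_slot sm k (Ordinal np0) = block_idx sm sp k 0.
        by rewrite /pos_slot/= nm0.
      by rewrite e refl_eq.
    move=> j j0; rewrite refl_neq//=; apply/orP; right.
    by rewrite nm0 add0n; move: j0; rewrite -val_eqE.
  by rewrite /weight_orbit E1 E2 linearNr.
have E1 : orbit_m sm sp k (refl k) = - orbit_m sm sp k id.
  apply: (@young_tens_neg _ _ _ _ (Ordinal nm0)); first exact: refl_eq.
  move=> j j0; rewrite refl_neq//=; apply/orP; right.
  by move: j0; rewrite -val_eqE.
have E2 : orbit_p sm sp k (refl k) = orbit_p sm sp k id.
  congr young_tens; apply/funext => j; rewrite refl_neq//=; apply/orP; right.
  by rewrite -lt0n ltn_addr.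
by rewrite /weight_orbit E1 E2 ydualN linearNl.
Qed.

Lemma cocycle_not_B1 : ~ B1 dot p pi cocycle.
Proof.
move=> [v bv].
have br k : cocycle (refl k) = (- (2 * a k))%:C *: w k id.
  apply: cocycleP; apply: (@hcvg_near _ _ _ (fun=> (- (2 * a k))%:C *: w k id) _ _ k.+1);
    last exact: hcvg_cst.
  move=> m km; rewrite /cocycle_approx (bigD1_seq k) ?iota_uniq ?mem_index_iota//=.
  rewrite big1 ?addr0 => [|l lk]; last by rewrite w_refl_neq// subrr scaler0.
  have -> : (- (2 * a k))%:C = - ((a k)%:C + (a k)%:C) :> C.
    by simpc; congr (_ +i* _); ring.
  by rewrite w_refl_eq scaleNr scalerDl scalerBr scalerN opprD.
(* Pairing the coboundary equation at [refl k] with [w k id] gives - 2 a_k |w_k|^2 = - 2 <v,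
   w_k>. *)
have vw k : dotK v (w k id) = (a k)%:C * (NK (w k id) ^+ 2)%:C.
  have Gr := refl_G k; have [ur _] := hp Gr.
  have pw : pi (refl k) (w k id) = - w k id by rewrite (pi_orbit hp _ Gr uid) w_refl_eq.
  have := congr1 (fun t => dotK t (w k id)) (bv _ Gr); rewrite br linearBl/= dotZl dotvv.
  have -> : dotK (pi (refl k) v) (w k id) = - dotK v (w k id).
    by rewrite -(unitary_dot ur v) pw linearNr opprK.
  move=> h; have h2 : dotK v (w k id) * 2 = (a k)%:C * (NK (w k id) ^+ 2)%:C * 2.
    transitivity (- (- dotK v (w k id) - dotK v (w k id))); first by ring.
    by rewrite -h rmorphN rmorphM rmorph_nat; ring.
  by apply: mulIf h2; rewrite pnatr_eq0.
have w1 k : 1 <= NK (w k id) by exact: (orbit_norm_ge ht n2).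
have wp k : 0 < NK (w k id) by exact: lt_le_trans (w1 k).
have wo k l : k != l -> dotK (w k id) (w l id) = 0.
  move=> kl; apply/eqP; rewrite -normc_eq0 eq_le normc_ge0 andbT.
  by rewrite (le_trans (orbit_dot_le ht n2 k l uid uid))// overlap_id// mulr0.
pose E k := ((NK (w k id))^-1)%:C *: w k id.
have oE k l : dotK (E k) (E l) = (k == l)%:R.
  rewrite /E dotZl dotZr conjc_real; have [<-|kl] := eqVneq k l; last first.
    by rewrite wo// !mulr0.
  rewrite dotvv -!rmorphM/= expr2 mulKf ?gt_eqF// mulVf ?gt_eqF//.
have vE k : dotK v (E k) = (a k * NK (w k id))%:C.
  rewrite /E dotZr conjc_real vw -!rmorphM/=; congr (_%:C).
  by field; rewrite gt_eqF.
(* Since |w_k| >= 1, Bessel's inequality for the normalized w_k would bound the partial sums of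
   a_k^2 = b_k^M by |v|^2. *)
have [m hm] := b_unbounded (NK v ^+ 2).
have := @bessel _ _ dotK _ (index_iota 0 m) E v (iota_uniq _ _) (fun i j _ _ => oE i j).
rewrite leNgt => /negP; apply; apply: (lt_le_trans hm); apply: ler_sum => k _.
rewrite vE normcR real_normK ?num_real// exprMn a2 ler_peMr ?exprn_ge0//.
by rewrite exprn_ege1.
Qed.

End Cocycle.

(** * The total weight and the equivalence *)

Lemma sorted_sort_geq (s : seq nat) : sorted geq (sort geq s).
Proof. by apply: sort_sorted => x y; exact: leq_total. Qed.

Lemma sumn_weight (lambda : {fsfun nat -> int with 0}) :
  (sumn (weight_neg lambda) + sumn (weight_pos lambda))%N =
  (\sum_(i <- finsupp lambda) `|lambda i|%N)%N.
Proof.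
rewrite /weight_neg /weight_pos !(perm_sumn (permEl (perm_sort _ _))) !sumnE !big_map.
rewrite -big_split/=; apply: eq_bigr => i _.
have [l0|/ltW l0] := leP 0 (lambda i).
  by rewrite (max_idPr _) ?oppr_le0// (max_idPl _).
by rewrite (max_idPl _) ?oppr_ge0// addn0 abszN.
Qed.

Theorem theorem7p7 (R : realType) (p : R) (hp : 1 <= p)
    (lambda : {fsfun nat -> int with 0})
    (K : lmodType R[i]) (dotK : {dot K for Num.conj})
    (pi : (l2 R nat -> l2 R nat) -> K -> K)
    (hpi : highest_weight_rep p lambda dotK pi) :
  H1_zero (@l2_dot R nat) p dotK pi <->
  (\sum_(i <- finsupp lambda) `|lambda i|%N <= 1)%N.
Proof.
have [tau [ht hrep]] := hpi.
rewrite H1_zeroP => [|g Gg]; last exact: unitary_lin (hrep g Gg).1.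
rewrite -sumn_weight; split=> [Z1B1|].
  rewrite leqNgt; apply/negP => n2.
  (* Any positive [M] with p <= 2(M + 1) would do. *)
  pose M := (Num.trunc p).+1; have pM : p <= (2 * M.+1)%:R.
    apply: (le_trans (ltW (truncnS_gt p))); rewrite ler_nat -/M mul2n -addnn.
    exact: leq_trans (leqnSn _) (leq_addr _ _).
  have [b [A [b0 bA bU]]] := weight_exists R (isT : (0 < M)%N).
  have h := cocycle_not_B1 hp ht hrep n2 (sorted_sort_geq _) (sorted_sort_geq _) b0 bU.
  apply/h/Z1B1; exact: (cocycle_Z1 hp ht hrep n2 pM b0 bA).
(* At most one box in total leaves the trivial representation, the identity representation and its
   dual. *)
case Em: (sumn (weight_neg lambda)) => [|[|m]]; case Ep: (sumn (weight_pos lambda)) => [|[|q]] // _.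
- exact: (H1_zero_trivial hp ht hrep Em Ep).
- exact: (H1_zero_pos hp ht hrep Em Ep).
- exact: (H1_zero_neg hp ht hrep Em Ep).
Qed.
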